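(* Let $G$ be a non-cyclic, torsion-free hyperbolic group and let $g\in G$ be a nontrivial element that is not a proper power. Then there exists $N_0\in\mathbb N$ such that for every prime $n> N_0$: (a) $G/[\langle\langle g^n\rangle\rangle,\langle\langle g^n\rangle\rangle]\in \mathcal{WR}_b(\mathbb Z,\, G/\langle\langle g^n\rangle\rangle\curvearrowright I)$ for some set $I$ on which $G/\langle\langle g^n\rangle\rangle$ acts transitively with all point stabilizers isomorphic to $\mathbb Z/n\mathbb Z$; (b) $G/\langle\langle g^n\rangle\rangle$ is a non-elementary (i.e. not virtually cyclic), ICC, hyperbolic group; (c) the image of $g$ in $G/\langle\langle g^n\rangle\rangle$ has order exactly $n$, and every nontrivial element of $G/\langle\langle g^n\rangle\rangle$ has order $n$ or $\infty$.
   Context: $\langle\langle S\rangle\rangle$ denotes the normal closure of $S$ in $G$, and $[K,K]$ the commutator subgroup. Wreath-like products: $G\in\mathcal{WR}(A,B\curvearrowright I)$ means there is a short exact sequence $1\to\bigoplus_{i\in I}A_i\to G\xrightarrow{\varepsilon}B\to1$ with $A_i\cong A$ for all $i$ and $gA_ig^{-1}=A_{\varepsilon(g)i}$ for all $g\in G$, $i\in I$. Such $G$ has bounded cocycle, written $G\in\mathcal{WR}_b(A,B\curvearrowright I)$, if there is a set-theoretic map $\varsigma\colon B\to G$ with $\varepsilon\circ\varsigma=\mathrm{id}_B$ and a constant $C\in\mathbb N$ such that for all $x,y\in B$ the element $\alpha(x,y)=\varsigma(x)\varsigma(y)\varsigma(xy)^{-1}\in\bigoplus_{i\in I}A_i$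 has support $\{i\in I:\alpha(x,y)(i)\neq1\}$ of cardinality at most $C$. A group is ICC if every nontrivial element has infinite conjugacy class. *)

(* Defs.v *)
From Stdlib Require Import ZArith Znumtheory List Lia.
Import ListNotations.
Open Scope nat_scope.

Record Group := {
  gcar :> Type;
  mul : gcar -> gcar -> gcar;
  one : gcar;
  inv : gcar -> gcar;
  mul_assoc : forall x y z, mul x (mul y z) = mul (mul x y) z;
  mul_1l : forall x, mul one x = x;
  mul_1r : forall x, mul x one = x;
  mul_Vl : forall x, mul (inv x) x = one;
  mul_Vr : forall x, mul x (inv x) = one
}.
Arguments mul {g} _ _.
Arguments one {g}.
Arguments inv {g} _.

Definition Zgrp : Group.
Proof.
  refine {| gcar := Z; mul := Z.add; one := 0%Z; inv := Z.opp |}; intros; lia.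
Defined.

Section GroupNotions.
Context {G : Group}.

Fixpoint npow (x : G) (n : nat) : G :=
  match n with O => one | S m => mul x (npow x m) end.

Definition zpow (x : G) (z : Z) : G :=
  match z with
  | Z0 => one
  | Zpos p => npow x (Pos.to_nat p)
  | Zneg p => inv (npow x (Pos.to_nat p))
  end.

Definition is_subgroup (H : G -> Prop) : Prop :=
  H one /\ (forall x y, H x -> H y -> H (mul x y)) /\ (forall x, H x -> H (inv x)).

Definition is_normal (H : G -> Prop) : Prop :=
  is_subgroup H /\ forall g x, H x -> H (mul (mul g x) (inv g)).

Definition gen (S : G -> Prop) (x : G) : Prop :=
  forall H, is_subgroup H -> (forall s, S s -> H s) -> H x.

Definition nclosure (S : G -> Prop) (x : G) : Prop :=
  forall H, is_normal H -> (forall s, S s -> H s) -> H x.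

Definition commutator (a b : G) : G := mul (mul (inv a) (inv b)) (mul a b).

Definition comm_sub (K : G -> Prop) : G -> Prop :=
  gen (fun c => exists a b, K a /\ K b /\ c = commutator a b).

Definition torsion_free : Prop :=
  forall x : G, x <> one -> forall n, 0 < n -> npow x n <> one.

Definition cyclic : Prop := exists a : G, forall x, exists z, x = zpow a z.

Definition proper_power (g : G) : Prop := exists h k, 2 <= k /\ g = npow h k.

Definition elt_order (x : G) (n : nat) : Prop :=
  0 < n /\ npow x n = one /\ forall m, 0 < m < n -> npow x m <> one.

Definition infinite_order (x : G) : Prop := forall m, 0 < m -> npow x m <> one.

Definition virtually_cyclic : Prop :=
  exists H : G -> Prop, is_subgroup H /\
    (exists L : list G, forall x, exists l h, In l L /\ H h /\ x = mul l h) /\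
    (exists a, H a /\ forall h, H h -> exists z, h = zpow a z).

Definition icc : Prop :=
  forall x : G, x <> one ->
    ~ exists L : list G, forall y, In (mul (mul y x) (inv y)) L.

Definition word_len_le (S : list G) (x : G) (n : nat) : Prop :=
  exists w : list G, Forall (fun s => In s S \/ In (inv s) S) w /\
    length w <= n /\ fold_right mul one w = x.

Definition wdist (S : list G) (x y : G) (d : nat) : Prop :=
  word_len_le S (mul (inv x) y) d /\
  forall m, word_len_le S (mul (inv x) y) m -> d <= m.

(* Gromov hyperbolicity of the word metric (four-point condition) *)
Definition hyperbolic : Prop :=
  exists S : list G, (forall x, exists n, word_len_le S x n) /\
  exists delta : nat, forall x y z w a b c d e f,
    wdist S x y a -> wdist S z w b -> wdist S x z c -> wdist S y w d ->
    wdist S x w e -> wdist S y z f ->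
    c + d <= Nat.max (a + b) (e + f) + 2 * delta.

End GroupNotions.

Definition is_hom {G H : Group} (f : G -> H) : Prop :=
  forall x y, f (mul x y) = mul (f x) (f y).

Definition is_quotient {G Q : Group} (N : G -> Prop) (pi : G -> Q) : Prop :=
  is_hom pi /\ (forall q, exists x, pi x = q) /\ (forall x, pi x = one <-> N x).

Definition is_action {B : Group} {I : Type} (act : B -> I -> I) : Prop :=
  (forall i, act one i = i) /\ (forall b c i, act (mul b c) i = act b (act c i)).

Definition transitive {B : Group} {I : Type} (act : B -> I -> I) : Prop :=
  inhabited I /\ forall i j, exists b, act b i = j.

Definition iso_Zmod {B : Group} (H : B -> Prop) (n : nat) : Prop :=
  exists phi : Zgrp -> B, is_hom phi /\ (forall b, H b <-> exists k, phi k = b) /\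
    (forall k : Zgrp, phi k = one <-> Z.divide (Z.of_nat n) k).

(* G in WR_b(A, B ~> I), with the internal restricted direct sum of the A_i *)
Definition WRb (A B : Group) (I : Type) (act : B -> I -> I) (G : Group) : Prop :=
  exists (eps : G -> B) (Ai : I -> G -> Prop),
    is_hom eps /\ (forall b, exists x, eps x = b) /\
    (forall i, exists f : A -> G, is_hom f /\ (forall a a', f a = f a' -> a = a') /\
        forall x, Ai i x <-> exists a, f a = x) /\
    (* ker eps = (+)_i A_i *)
    (forall i x, Ai i x -> eps x = one) /\
    (forall i j x y, i <> j -> Ai i x -> Ai j y -> mul x y = mul y x) /\
    (forall x, eps x = one -> gen (fun y => exists i, Ai i y) x) /\
    (forall i x, Ai i x -> gen (fun y => exists j, j <> i /\ Ai j y) x -> x = one) /\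
    (forall (g : G) i x, Ai i x <-> Ai (act (eps g) i) (mul (mul g x) (inv g))) /\
    exists (sec : B -> G) (C : nat), (forall b, eps (sec b) = b) /\
      forall b c : B, exists L : list I, length L <= C /\
        gen (fun z => exists i, In i L /\ Ai i z)
            (mul (mul (sec b) (sec c)) (inv (sec (mul b c)))).

(* Main.v *)
Require Import Defs.
From Stdlib Require Import ZArith Znumtheory List.
From Stdlib Require Import Lia Classical ClassicalEpsilon Permutation Relation_Operators.
From Stdlib Require Import FunctionalExtensionality PropExtensionality ProofIrrelevance.
Import ListNotations.

(* Declare all powers of g to be generators. The new word metric is still hyperbolic, and each coset
   y<g> measures an angle between two elements a and b: the displacement between the points of y<g>
   nearest to a and to b. If an angle is large then geodesics must pass through the coset, so large
   angles at different cosets are ordered along geodesics and obey Behrstock's inequality.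

   The conjugate y g^n y^-1 turns by the angle n about y<g>. Let N be the normal closure of g^n and
   build it from the rotations about cosets at distance less than R from the identity, R = 0, 1, 2, ...
   By induction on R, such products turn by bounded angles about cosets whose orbits stay farther away.
   Writing an element of the next level as an alternating product of rotations about cosets at
   distance R and elements of the previous level, one sees that a nontrivial element of N has an angle
   close to n or more at some coset, where it can be turned back to a simpler element of N; and that
   the exponents of the rotations over each N-orbit of cosets have a well-defined sum.

   Hence a polygon with few sides that closes up modulo N can be made to close up in G by turning its
   sides at large angles, which never lengthens them. For quadrilaterals this gives the four-point
   condition in the quotient. An element h that is shortest in its conjugacy class modulo N and not
   conjugate into <g> cannot have a power in N, because all angles of its powers are at most about
   n/2. If t moves <g> off itself with bounded angles, then an element commuting with high powers of
   t modulo N lifts to one commuting with them in G, whence infinite conjugacy classes. For the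
   cocycle, lift x to an element of G with angles at most 3n/4 and correct it in G/[N,N] by the
   rotations nearest to its angles. The corrected lift does not change when the element is turned at
   a large angle, so the cocycle can be computed on closed triangles of G, where the corrections
   cancel at all but at most three cosets. *)

(** * Groups and word metrics *)

(* Coning off makes turning free: the bound gap + 1 + gap for the distance through a coset always
   holds, and a large angle makes it an equality ([cg_angle]), so rotating one end about the coset
   cannot increase the distance. The main obstacle is that errors could pile up: each new level of
   rotations costs 4 theta in the angle at a distant coset, and the number of levels is unbounded.
   Quasiconvexity of the translated balls ([geodesic_near]) shows that the levels more than 2 del +
   1 below the coset contribute at most D altogether, so only 2 del + 1 levels are paid for; this is
   [orbit_bound]. Behrstock's inequality keeps the cost of one level independent of the number of
   rotations in it. Coarse coordinates suffice for most of this, but the cocycle needs supports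
   exactly; therefore [c] picks the least nearest exponent, which makes it equivariant and exact
   behind a large angle ([coordinate_exact]). Primality of n gives the orders of torsion elements,
   and also oddness, so that rounding an angle to a multiple of n has no ties. *)
Declare Scope grp_scope.
Notation "x ∙ y" := (mul x y) (at level 40, left associativity) : grp_scope.
Notation "x ⁻¹" := (inv x) (at level 3, format "x ⁻¹") : grp_scope.

Local Open Scope grp_scope.

Section GroupBasics.
Context {G : Group}.
Implicit Types (x y z a b : G) (k l : Z).
Local Open Scope Z_scope.

Lemma mulA_r x y z : x ∙ y ∙ z = x ∙ (y ∙ z).
Proof. now rewrite mul_assoc. Qed.

Lemma mul_Vl_r x y : x⁻¹ ∙ (x ∙ y) = y.
Proof. now rewrite mul_assoc, mul_Vl, mul_1l. Qed.

Lemma mul_Vr_r x y : x ∙ (x⁻¹ ∙ y) = y.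
Proof. now rewrite mul_assoc, mul_Vr, mul_1l. Qed.

Lemma mul_cancel_l x y z : x ∙ y = x ∙ z -> y = z.
Proof. intros H. now rewrite <- (mul_Vl_r x y), H, mul_Vl_r. Qed.

Lemma mul_cancel_r x y z : y ∙ x = z ∙ x -> y = z.
Proof.
  intros H. rewrite <- (mul_1r _ y), <- (mul_1r _ z), <- (mul_Vr _ x), !mul_assoc.
  now rewrite H.
Qed.

Lemma inv_unique x y : x ∙ y = one -> x⁻¹ = y.
Proof. intros H. apply (mul_cancel_l x). now rewrite H, mul_Vr. Qed.

Lemma inv_mul x y : (x ∙ y)⁻¹ = y⁻¹ ∙ x⁻¹.
Proof. apply inv_unique. now rewrite mulA_r, mul_Vr_r, mul_Vr. Qed.

Lemma inv_inv x : (x⁻¹)⁻¹ = x.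
Proof. apply inv_unique, mul_Vl. Qed.

Lemma inv_one : (one : G)⁻¹ = one.
Proof. apply inv_unique, mul_1l. Qed.

Lemma eq_of_inv_mul x y : x⁻¹ ∙ y = one -> x = y.
Proof. intros H. apply (mul_cancel_l x⁻¹). now rewrite H, mul_Vl. Qed.

Lemma zpow_0 a : zpow a 0 = one.
Proof. reflexivity. Qed.

Lemma zpow_nat a n : zpow a (Z.of_nat n) = npow a n.
Proof. destruct n; [reflexivity|]. cbn [Z.of_nat zpow]. now rewrite SuccNat2Pos.id_succ. Qed.

Lemma zpow_1 a : zpow a 1 = a.
Proof. cbn. apply mul_1r. Qed.

Lemma npow_comm a n : a ∙ npow a n = npow a n ∙ a.
Proof.
  induction n; cbn. { now rewrite mul_1l, mul_1r. }
  now rewrite IHn at 1; rewrite mul_assoc.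
Qed.

Lemma zpow_succ a k : zpow a (Z.succ k) = a ∙ zpow a k.
Proof.
  destruct (Z_le_dec 0 k) as [H|H].
  - rewrite <- (Z2Nat.id k) by lia. rewrite <- Nat2Z.inj_succ, !zpow_nat. reflexivity.
  - destruct (Z.eq_dec k (-1)) as [->|H'].
    { change (one = a ∙ (a ∙ one)⁻¹). now rewrite mul_1r, mul_Vr. }
    replace k with (- Z.of_nat (S (Z.to_nat (- k - 1)))) by lia.
    set (m := Z.to_nat (- k - 1)). assert (0 < m)%nat by (unfold m; lia).
    replace (Z.succ (- Z.of_nat (S m))) with (- Z.of_nat m) by lia.
    assert (E : forall j, (0 < j)%nat -> zpow a (- Z.of_nat j) = (npow a j)⁻¹).
    { intros [|j] Hj; [lia|]. cbn [Z.of_nat Z.opp zpow]. now rewrite SuccNat2Pos.id_succ. }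
    rewrite !E by lia. cbn [npow]. rewrite npow_comm, inv_mul. now rewrite mul_Vr_r.
Qed.

Lemma zpow_add a k l : zpow a (k + l) = zpow a k ∙ zpow a l.
Proof.
  revert l. induction k using Z.peano_ind; intros l.
  - cbn. now rewrite mul_1l.
  - replace (Z.succ k + l) with (Z.succ (k + l)) by lia.
    now rewrite !zpow_succ, IHk, mul_assoc.
  - apply (mul_cancel_l a). rewrite <- zpow_succ, mul_assoc, <- zpow_succ.
    replace (Z.succ (Z.pred k + l)) with (k + l) by lia.
    now rewrite Z.succ_pred, IHk.
Qed.

Lemma zpow_opp a k : (zpow a k)⁻¹ = zpow a (- k).
Proof. apply inv_unique. rewrite <- zpow_add. now replace (k + - k) with 0 by lia. Qed.

Lemma zpow_add_r a k l x : zpow a k ∙ (zpow a l ∙ x) = zpow a (k + l) ∙ x.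
Proof. now rewrite zpow_add, mulA_r. Qed.

Lemma zpow_mul a k l : zpow (zpow a k) l = zpow a (k * l).
Proof.
  induction l using Z.peano_ind.
  - now rewrite Z.mul_0_r.
  - rewrite zpow_succ, IHl, <- zpow_add. f_equal; lia.
  - apply (mul_cancel_l (zpow a k)). rewrite <- zpow_succ, Z.succ_pred, IHl, <- zpow_add.
    f_equal; lia.
Qed.

Lemma zpow_conj x a k : zpow (x ∙ a ∙ x⁻¹) k = x ∙ zpow a k ∙ x⁻¹.
Proof.
  induction k using Z.peano_ind.
  - cbn. now rewrite mul_1r, mul_Vr.
  - rewrite !zpow_succ, IHk, !mulA_r. now rewrite mul_Vl_r.
  - apply (mul_cancel_l (x ∙ a ∙ x⁻¹)). rewrite <- zpow_succ, Z.succ_pred, IHk.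
    rewrite !mulA_r, mul_Vl_r. rewrite <- (Z.succ_pred k) at 1. now rewrite zpow_succ, !mulA_r.
Qed.

Lemma zpow_one k : zpow (one : G) k = one.
Proof.
  induction k using Z.peano_ind; [reflexivity| |].
  - now rewrite zpow_succ, IHk, mul_1l.
  - apply (mul_cancel_l one). rewrite <- zpow_succ, Z.succ_pred, IHk. now rewrite mul_1l.
Qed.

Lemma zpow_commute x a k : x ∙ a = a ∙ x -> x ∙ zpow a k = zpow a k ∙ x.
Proof.
  intros H. assert (E : x ∙ a ∙ x⁻¹ = a) by (rewrite H, mulA_r, mul_Vr, mul_1r; auto).
  rewrite <- E at 2. rewrite zpow_conj, !mulA_r, mul_Vl, mul_1r. reflexivity.
Qed.

Fixpoint prod (w : list G) : G := match w with [] => one | a :: v => a ∙ prod v end.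

Lemma prod_fold_right w : prod w = fold_right mul one w.
Proof. induction w; cbn; congruence. Qed.

Lemma prod_app u v : prod (u ++ v) = prod u ∙ prod v.
Proof. induction u; cbn; [now rewrite mul_1l|]. now rewrite IHu, mulA_r. Qed.

Lemma prod_rev_inv w : prod (rev (map inv w)) = (prod w)⁻¹.
Proof.
  induction w; cbn; [now rewrite inv_one|].
  rewrite prod_app, IHw. cbn. now rewrite mul_1r, inv_mul.
Qed.

End GroupBasics.

#[export] Hint Rewrite @mulA_r @mul_1l @mul_1r @mul_Vl @mul_Vr @mul_Vl_r @mul_Vr_r @inv_mul @inv_inv
  @inv_one @zpow_0 : grp.

Ltac grp := autorewrite with grp; try reflexivity.

Ltac zpow_kill0 :=
  repeat match goal with |- context [zpow ?a ?e] =>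
    lazymatch e with 0%Z => fail | _ => replace e with 0%Z by lia; rewrite (zpow_0 a) end end.

Ltac grpz :=
  repeat progress (autorewrite with grp; rewrite ?zpow_opp, <- ?zpow_add, ?zpow_add_r; zpow_kill0);
  try reflexivity; repeat (f_equal; try (lia || ring)).

Lemma torsion_free_zpow {G : Group} (H : torsion_free (G := G)) (x : G) (k : Z) :
  x <> one -> zpow x k = one -> k = 0%Z.
Proof.
  intros Hx E. destruct (Z.lt_trichotomy k 0) as [L|[->|L]]; auto; exfalso.
  - apply (H x Hx (Z.to_nat (- k))); [lia|].
    rewrite <- zpow_nat, Z2Nat.id by lia. now rewrite <- zpow_opp, E, inv_one.
  - apply (H x Hx (Z.to_nat k)); [lia|].
    now rewrite <- zpow_nat, Z2Nat.id by lia.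
Qed.

Lemma torsion_free_zpow_inj {G : Group} (H : torsion_free (G := G)) (x : G) (k l : Z) :
  x <> one -> zpow x k = zpow x l -> k = l.
Proof.
  intros Hx E. assert (k - l = 0)%Z; [|lia]. apply (torsion_free_zpow H x); auto.
  unfold Z.sub. now rewrite zpow_add, <- zpow_opp, E, mul_Vr.
Qed.

Section WordMetric.
Context {G : Group} (T : G -> Prop).
Local Open Scope Z_scope.

Definition wordlen_spec (x : G) (n : nat) : Prop :=
  (exists w, Forall T w /\ length w = n /\ prod w = x) /\
  forall w, Forall T w -> prod w = x -> (n <= length w)%nat.

Definition len (x : G) : Z := Z.of_nat (epsilon (inhabits 0%nat) (wordlen_spec x)).

Definition dist (x y : G) : Z := len (x⁻¹ ∙ y).

Definition hyp (delta : Z) : Prop := forall x y z w,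
  dist x z + dist y w <= Z.max (dist x y + dist z w) (dist x w + dist y z) + 2 * delta.

Definition symgen : Prop :=
  (forall x, T x -> T x⁻¹) /\ forall x, exists w, Forall T w /\ prod w = x.

Hypothesis HT : symgen.

Lemma wordlen_ex (x : G) : exists n, wordlen_spec x n.
Proof.
  destruct (proj2 HT x) as [w [Hw Ew]].
  assert (H : forall m, (exists w, Forall T w /\ prod w = x /\ (length w <= m)%nat) ->
     exists n, wordlen_spec x n).
  { induction m; intros [v [Hv [Ev Lv]]].
    - exists O. split; [exists v; split; [|split]; auto; lia|]. intros; lia.
    - destruct (classic (exists w, Forall T w /\ prod w = x /\ (length w <= m)%nat)) as [K|K].
      { auto. }
      exists (S m). split.
      + exists v. split; [|split]; auto.
        destruct (Nat.eq_dec (length v) (S m)); auto. exfalso; apply K; exists v; intuition lia.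
      + intros u Hu Eu. destruct (le_lt_dec (S m) (length u)); auto.
        exfalso; apply K; exists u; intuition lia. }
  apply (H (length w)). exists w; auto.
Qed.

Lemma len_spec x : wordlen_spec x (Z.to_nat (len x)).
Proof. unfold len. rewrite Nat2Z.id. apply epsilon_spec, wordlen_ex. Qed.

Lemma len_nonneg x : 0 <= len x.
Proof. unfold len; lia. Qed.

Lemma len_word x : exists w, Forall T w /\ Z.of_nat (length w) = len x /\ prod w = x.
Proof.
  destruct (len_spec x) as [[w [Hw [L E]]] _]. exists w. split; [|split]; auto.
  rewrite L. pose proof (len_nonneg x); lia.
Qed.

Lemma len_le w : Forall T w -> len (prod w) <= Z.of_nat (length w).
Proof.
  intros Hw. destruct (len_spec (prod w)) as [_ H]. specialize (H w Hw eq_refl).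
  pose proof (len_nonneg (prod w)); lia.
Qed.

Lemma len_one : len one = 0.
Proof. pose proof (len_le [] (Forall_nil _)). pose proof (len_nonneg one). cbn in H. lia. Qed.

Lemma len_zero x : len x = 0 -> x = one.
Proof.
  intros H. destruct (len_word x) as [w [_ [L E]]]. destruct w; cbn in *; [auto|lia].
Qed.

Lemma len_mul x y : len (x ∙ y) <= len x + len y.
Proof.
  destruct (len_word x) as [u [Hu [Lu Eu]]], (len_word y) as [v [Hv [Lv Ev]]].
  rewrite <- Lu, <- Lv, <- Nat2Z.inj_add, <- length_app. rewrite <- Eu at 1. rewrite <- Ev at 1.
  rewrite <- prod_app. apply len_le. apply Forall_app; auto.
Qed.

Lemma len_inv_le x : len x⁻¹ <= len x.
Proof.
  destruct (len_word x) as [u [Hu [Lu Eu]]]. rewrite <- Lu, <- Eu, <- prod_rev_inv.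
  rewrite <- (length_map inv u), <- length_rev. apply len_le.
  apply Forall_rev. rewrite Forall_map. eapply Forall_impl; [|exact Hu]. apply HT.
Qed.

Lemma len_inv x : len x⁻¹ = len x.
Proof.
  pose proof (len_inv_le x). pose proof (len_inv_le x⁻¹). rewrite inv_inv in *. lia.
Qed.

Lemma len_gen x : T x -> len x <= 1.
Proof.
  intros H. replace x with (prod [x]) by (cbn; apply mul_1r).
  change 1 with (Z.of_nat (length [x])). apply len_le; auto.
Qed.

Lemma len_eq1 x : len x = 1 -> T x.
Proof.
  destruct (len_word x) as [w [Hw [L E]]]. intros K. rewrite K in L.
  destruct w as [|a [|b w]]; cbn in *; try lia. rewrite mul_1r in E; subst.
  now inversion Hw.
Qed.

Lemma len_split x t : 0 <= t <= len x -> exists y, len y = t /\ len (y⁻¹ ∙ x) = len x - t.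
Proof.
  intros Ht. destruct (len_word x) as [w [Hw [L E]]].
  set (u := firstn (Z.to_nat t) w). set (v := skipn (Z.to_nat t) w).
  assert (Ew : u ++ v = w) by apply firstn_skipn.
  rewrite <- Ew in Hw. apply Forall_app in Hw. destruct Hw as [Hu Hv].
  pose proof (len_le u Hu). pose proof (len_le v Hv).
  assert (X : x = prod u ∙ prod v) by (rewrite <- prod_app; congruence).
  pose proof (len_mul (prod u) (prod v)). rewrite <- X in H1.
  assert (length u = Z.to_nat t) by (unfold u; rewrite firstn_length_le; lia).
  assert (length v = Z.to_nat (len x - t)) by (unfold v; rewrite length_skipn; lia).
  exists (prod u). rewrite X at 1. rewrite mul_Vl_r. lia.
Qed.

Lemma dist_refl x : dist x x = 0.
Proof. unfold dist. rewrite mul_Vl. apply len_one. Qed.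

Lemma dist_sym x y : dist x y = dist y x.
Proof. unfold dist. rewrite <- len_inv. grp. Qed.

Lemma dist_nonneg x y : 0 <= dist x y.
Proof. apply len_nonneg. Qed.

Lemma dist_tri x y z : dist x z <= dist x y + dist y z.
Proof.
  unfold dist. replace (x⁻¹ ∙ z) with ((x⁻¹ ∙ y) ∙ (y⁻¹ ∙ z)) by grp. apply len_mul.
Qed.

Lemma dist_left h x y : dist (h ∙ x) (h ∙ y) = dist x y.
Proof. unfold dist. grp. Qed.

Lemma dist_zero x y : dist x y = 0 -> x = y.
Proof. intros H. apply eq_of_inv_mul. now apply len_zero. Qed.

Lemma dist_one_l x : dist one x = len x.
Proof. unfold dist. grp. Qed.

Lemma dist_gen x s : T s -> dist x (x ∙ s) <= 1.
Proof. intros. unfold dist. rewrite mul_Vl_r. now apply len_gen. Qed.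

Lemma dist_split x y t : 0 <= t <= dist x y -> exists z, dist x z = t /\ dist z y = dist x y - t.
Proof.
  intros H. destruct (len_split (x⁻¹ ∙ y) t H) as [u [H1 H2]].
  exists (x ∙ u). unfold dist. rewrite mul_Vl_r. split; auto.
  rewrite <- H2. grp.
Qed.

(** Applied to the original word metric only; balls of positive radius in the coned-off metric
    contain all powers of g. *)
Lemma finite_ball (S : list G) (HS : forall x, T x -> In x S) (n : nat) :
  exists L, forall x, len x <= Z.of_nat n -> In x L.
Proof.
  induction n as [|n [L HL]].
  - exists [one]. intros x H. left. symmetry. apply len_zero. pose proof (len_nonneg x); lia.
  - exists (L ++ flat_map (fun y => map (mul y) S) L). intros x H. apply in_or_app.
    destruct (Z.eq_dec (len x) (Z.of_nat (Datatypes.S n))) as [E|E]; [|left; apply HL; lia].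
    right. destruct (len_split x (Z.of_nat n)) as [y [H1 H2]]; [lia|].
    apply in_flat_map. exists y. split; [apply HL; lia|].
    apply in_map_iff. exists (y⁻¹ ∙ x). split; [grp|]. apply HS, len_eq1. lia.
Qed.

End WordMetric.

(* Rewrites each distance between two of the listed points with the earlier point first. *)
Ltac sym_with HT a l := lazymatch l with
  | (?l', ?b) => rewrite ?(dist_sym _ HT a b) in *; sym_with HT a l'
  | ?b => rewrite ?(dist_sym _ HT a b) in * end.
Ltac symd HT l := lazymatch l with
  | (?l', ?b) => sym_with HT b l'; symd HT l'
  | _ => idtac end.

(** * Cyclic subgroups of hyperbolic groups *)

Lemma pigeonhole_list {A : Type} (f : nat -> A) (L : list A) :
  (forall i, (i <= length L)%nat -> In (f i) L) ->
  exists i j, (i < j <= length L)%nat /\ f i = f j.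
Proof.
  intros H. apply NNPP. intros N.
  assert (ND : NoDup (map f (seq 0 (S (length L))))).
  { apply NoDup_map_NoDup_ForallPairs; [|apply seq_NoDup].
    intros i j Hi Hj E. apply in_seq in Hi, Hj.
    destruct (Nat.lt_trichotomy i j) as [K|[K|K]]; auto; exfalso; apply N.
    - exists i, j. split; auto; lia.
    - exists j, i. split; auto; lia. }
  assert (I : incl (map f (seq 0 (S (length L)))) L).
  { intros y Hy. apply in_map_iff in Hy. destruct Hy as [i [<- Hi]]. apply H.
    apply in_seq in Hi; lia. }
  pose proof (NoDup_incl_length ND I) as K. rewrite length_map, length_seq in K. lia.
Qed.

Section Loxodromic.
Context {G : Group} (T : G -> Prop) (HT : symgen T) (S : list G) (HS : forall x, T x -> In x S)
  (del : Z) (Hdel : (0 <= del)%Z) (Hyp : hyp T del).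
Context (tf : torsion_free (G := G)).
Local Open Scope Z_scope.
Notation d := (dist T).

Lemma dist_zpow_orbit (h x : G) i j : d (zpow h i ∙ x) (zpow h j ∙ x) = d x (zpow h (j - i) ∙ x).
Proof.
  rewrite <- (dist_left T (zpow h i) x). f_equal. rewrite mul_assoc, <- zpow_add. do 2 f_equal; lia.
Qed.

(** The four-point condition for x, hx, h^2 x, h^(n+2) x propagates the gain: by induction the
    pairing of x, hx with h^2 x, h^(n+2) x is too small to dominate. *)
Lemma loxodromic_step (h x : G) :
  d x (zpow h 1 ∙ x) + 2 * del + 1 <= d x (zpow h 2 ∙ x) ->
  forall n, 0 <= n -> d x (zpow h n ∙ x) + 1 <= d x (zpow h (n + 1) ∙ x).
Proof.
  intros H. refine (natlike_ind _ _ _).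
  - pose proof (dist_tri T HT x (zpow h 1 ∙ x) (zpow h 2 ∙ x)) as H1.
    rewrite dist_zpow_orbit in H1. cbn [Z.sub] in H1. replace (2 - 1) with 1 in H1 by lia.
    rewrite zpow_0, mul_1l, dist_refl by auto. replace (0 + 1) with 1 by lia. lia.
  - intros n Hn IH. unfold Z.succ.
    pose proof (Hyp x (zpow h 1 ∙ x) (zpow h 2 ∙ x) (zpow h (n + 1 + 1) ∙ x)) as H1.
    rewrite !dist_zpow_orbit in H1.
    replace (n + 1 + 1 - 1) with (n + 1) in H1 by lia.
    replace (n + 1 + 1 - 2) with n in H1 by lia.
    replace (2 - 1) with 1 in H1 by lia. lia.
Qed.

Lemma len_zpow_le (g : G) i : 0 <= i -> len T (zpow g i) <= i * len T g.
Proof.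
  revert i. refine (natlike_ind _ _ _).
  - rewrite zpow_0, len_one by auto. lia.
  - intros i Hi IH. rewrite zpow_succ. pose proof (len_mul T HT g (zpow g i)). lia.
Qed.

Lemma zpow_orbit_unbounded (g : G) (gnt : g <> one) B : exists N, 0 <= N /\ B < len T (zpow g N).
Proof.
  apply NNPP. intros C. destruct (finite_ball T HT S HS (Z.to_nat B)) as [L HL].
  destruct (pigeonhole_list (fun i => zpow g (Z.of_nat i)) L) as [i [j [Hij E]]].
  - intros i Hi. apply HL. destruct (Z_le_dec (len T (zpow g (Z.of_nat i))) B) as [K|K].
    + pose proof (len_nonneg T (zpow g (Z.of_nat i))). lia.
    + exfalso. apply C. exists (Z.of_nat i). split; lia.
  - apply torsion_free_zpow_inj in E; auto. lia.
Qed.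

(* Far along a long geodesic [1, g^N] each small power of g acts almost as a translation.
   If all these translations are tiny, two powers agree on a finite ball; otherwise a power
   of g moves a point x so that |x - g^2k x| exceeds |x - g^k x| by more than 2 del. *)
Lemma infinite_order_loxodromic (g : G) (gnt : g <> one) :
  exists k x, 0 < k /\ d x (zpow g k ∙ x) + 2 * del + 1 <= d x (zpow g (2 * k) ∙ x).
Proof.
  apply NNPP. intros C.
  assert (C' : forall k x, 0 < k -> d x (zpow g (2 * k) ∙ x) <= d x (zpow g k ∙ x) + 2 * del).
  { intros k x Hk. destruct (Z_le_dec (d x (zpow g (2 * k) ∙ x)) (d x (zpow g k ∙ x) + 2 * del)); auto.
    exfalso. apply C. exists k, x. lia. }
  clear C. destruct (finite_ball T HT S HS (Z.to_nat (16 * del))) as [L HL].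
  set (A := Z.of_nat (length L) * len T g).
  assert (A0 : 0 <= A) by (pose proof (len_nonneg T g); unfold A; nia).
  set (t := 4 * A + 20 * del + 20).
  destruct (zpow_orbit_unbounded g gnt (10 * A + 100 * del + 100)) as [N [HN LN]].
  (* The powers g^i used below move both 1 and g^N by at most A, since they commute with g^N. The
     point y at depth t is far from both ends compared with A. *)
  destruct (dist_split T HT one (zpow g N) t) as [y [Hy1 Hy2]].
  { rewrite dist_one_l by auto. lia. }
  rewrite dist_one_l in Hy1, Hy2 by auto.
  assert (K : forall i, 0 < i <= Z.of_nat (length L) -> d y (zpow g i ∙ y) <= 16 * del).
  { intros i Hi.
    assert (Ai : len T (zpow g i) <= A).
    { pose proof (len_zpow_le g i). pose proof (len_nonneg T g). unfold A. nia. }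
    set (p' := zpow g i). set (q := zpow g N). set (q' := zpow g i ∙ q).
    set (y' := zpow g i ∙ y). set (y'' := zpow g i ∙ y').
    assert (E1 : d p' y' = t) by (unfold p', y'; rewrite <- (mul_1r _ (zpow g i)) at 1;
        now rewrite dist_left, dist_one_l).
    assert (E2 : d y' q' = len T q - t) by (unfold y', q'; now rewrite dist_left).
    assert (E3 : d one p' <= A) by (rewrite dist_one_l; auto).
    assert (E4 : d q q' <= A).
    { unfold q', q, dist. rewrite <- !zpow_add, zpow_opp, <- zpow_add.
      now replace (- N + (i + N)) with i by lia. }
    assert (E5 : d p' y'' = d one y').
    { unfold p', y''. rewrite <- (mul_1r _ (zpow g i)) at 1. now rewrite dist_left. }
    assert (E6 : d y' y'' = d y y') by (unfold y'', y'; now rewrite dist_left).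
    assert (E7 : d y y'' <= d y y' + 2 * del).
    { unfold y'', y'. rewrite mul_assoc, <- zpow_add. replace (i + i) with (2 * i) by lia.
      apply C'. lia. }
    assert (E8 : d p' q' = len T q).
    { unfold p', q'. rewrite <- (mul_1r _ (zpow g i)) at 1. now rewrite dist_left, dist_one_l. }
    pose proof (dist_one_l T y) as Y1. pose proof (dist_one_l T q) as Q1.
    fold q in Hy2, LN.
    pose proof (Hyp y' p' one q). pose proof (Hyp y' p' q q').
    pose proof (Hyp one y q y'). pose proof (Hyp one p' y'' y').
    pose proof (dist_nonneg T one y''). pose proof (dist_nonneg T y y'). pose proof (Hyp one p' y' y'').
    pose proof (dist_tri T HT one p' y'). pose proof (dist_tri T HT p' one y').
    pose proof (dist_tri T HT y' q' q). pose proof (dist_tri T HT y' q q').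
    pose proof (dist_tri T HT one p' q'). pose proof (dist_tri T HT one q q').
    pose proof (dist_tri T HT one y y''). pose proof (dist_tri T HT one y'' y).
    change (d y y' <= 16 * del). clearbody p' q q' y' y''. clear C'.
    symd HT (@one G, p', y, y', y'', q, q').
    unfold t in *.
    assert (P1 : d one y' + d y' q <= len T q + 4 * del) by lia.
    lia. }
  destruct (pigeonhole_list (fun i => y⁻¹ ∙ (zpow g (Z.of_nat i) ∙ y)) L) as [i [j [Hij E]]].
  - intros i Hi. apply HL. rewrite Z2Nat.id by lia. change (d y (zpow g (Z.of_nat i) ∙ y) <= 16 * del).
    destruct i as [|i]; [cbn [Z.of_nat]; rewrite zpow_0, mul_1l, dist_refl by auto; lia|]. apply K. lia.
  - apply mul_cancel_l, mul_cancel_r, torsion_free_zpow_inj in E; auto. lia.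
Qed.

(** For j = del + 1 <= n, linear growth excludes one pairing in the four-point condition for x, h^m
    x, h^(m+j) x, h^(m+n) x; the other pairing is the claim up to the displacement of h^j. *)
Lemma loxodromic_orbit_superadditive (h x : G) :
  (forall n, 0 <= n -> d x (zpow h n ∙ x) + 1 <= d x (zpow h (n + 1) ∙ x)) ->
  exists E, 0 <= E /\ forall m n, 0 <= m -> 0 <= n ->
    d x (zpow h m ∙ x) + d x (zpow h n ∙ x) <= d x (zpow h (m + n) ∙ x) + E.
Proof.
  intros Hs. set (a := fun n => d x (zpow h n ∙ x)).
  assert (Hj : forall j m, 0 <= j -> 0 <= m -> a m + j <= a (m + j)).
  { intros j m Hj Hm. revert j Hj. refine (natlike_ind _ _ _).
    - rewrite !Z.add_0_r. lia.
    - intros j Hj IH. change (forall n, 0 <= n -> a n + 1 <= a (n + 1)) in Hs.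
      specialize (Hs (m + j) ltac:(lia)). replace (m + Z.succ j) with (m + j + 1) by lia. lia. }
  set (j := del + 1). exists (2 * a j + 2 * del). split.
  { unfold a. pose proof (dist_nonneg T x (zpow h j ∙ x)). lia. }
  intros m n Hm Hn. change (a m + a n <= a (m + n) + (2 * a j + 2 * del)).
  destruct (Z_le_dec j n) as [K|K].
  - pose proof (Hyp x (zpow h m ∙ x) (zpow h (m + j) ∙ x) (zpow h (m + n) ∙ x)) as H.
    rewrite !dist_zpow_orbit in H.
    replace (m + n - m) with n in H by lia. replace (m + j - m) with j in H by lia.
    replace (m + n - (m + j)) with (n - j) in H by lia.
    change (a (m + j) + a n <= Z.max (a m + a (n - j)) (a (m + n) + a j) + 2 * del) in H.
    assert (0 <= j) by (unfold j; lia). assert (2 * del < 2 * j) by (unfold j; lia).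
    pose proof (Hj j m ltac:(auto) ltac:(auto)) as H2. pose proof (Hj j (n - j) ltac:(auto) ltac:(lia)) as H3.
    replace (n - j + j) with n in H3 by lia.
    assert (0 <= a j) by apply dist_nonneg. clearbody a j. lia.
  - pose proof (Hj n m Hn Hm). pose proof (Hj (j - n) n ltac:(lia) Hn) as H3.
    replace (n + (j - n)) with j in H3 by lia.
    assert (0 <= a j) by apply dist_nonneg. clearbody a j. lia.
Qed.

(** The two estimates say that <g> is a quasi-geodesic without backtracking. They are carried over
    from the orbit of x under h = g^k0 by division with remainder. *)
Lemma cyclic_subgroup_quasi_line (g : G) (gnt : g <> one) :
  exists E k0 c, 0 <= E /\ 0 < k0 /\ 0 <= c /\
    (forall i j, 0 <= i -> 0 <= j ->
       len T (zpow g i) + len T (zpow g j) <= len T (zpow g (i + j)) + E) /\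
    (forall i, 0 <= i -> i <= k0 * (len T (zpow g i) + c)).
Proof.
  destruct (infinite_order_loxodromic g gnt) as [k0 [x [Hk Hx]]].
  set (h := zpow g k0).
  pose proof (loxodromic_step h x) as Hs. unfold h in Hs at 1 2. rewrite !zpow_mul in Hs.
  rewrite Z.mul_1_r in Hs. replace (k0 * 2) with (2 * k0) in Hs by lia. specialize (Hs Hx).
  destruct (loxodromic_orbit_superadditive h x Hs) as [E0 [HE0 HE]].
  set (f := fun i => len T (zpow g i)). set (a := fun n => d x (zpow h n ∙ x)).
  set (lx := len T x). set (lg := len T g).
  assert (lx0 : 0 <= lx) by apply len_nonneg. assert (lg0 : 0 <= lg) by apply len_nonneg.
  (* The range of r extends to 2 k0 because the remainders of i and j are added without
     reduction. *)
  assert (Hfa : forall m r, 0 <= m -> 0 <= r < 2 * k0 ->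
    a m - 2 * lx - 2 * k0 * lg <= f (k0 * m + r) <= a m + 2 * lx + 2 * k0 * lg).
  { intros m r Hm Hr. unfold f, a.
    assert (Er : len T (zpow g r) <= 2 * k0 * lg).
    { pose proof (len_zpow_le g r). unfold lg in *. nia. }
    rewrite zpow_add, <- zpow_mul. fold h.
    pose proof (len_mul T HT (zpow h m) (zpow g r)).
    pose proof (len_mul T HT (zpow h m ∙ zpow g r) (zpow g r)⁻¹) as H1.
    rewrite mulA_r, mul_Vr, mul_1r, (len_inv T HT) in H1.
    unfold dist. pose proof (len_mul T HT x⁻¹ (zpow h m ∙ x)).
    pose proof (len_mul T HT (zpow h m) x). rewrite (len_inv T HT) in *.
    pose proof (len_mul T HT (x ∙ (x⁻¹ ∙ (zpow h m ∙ x))) x⁻¹) as H4.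
    pose proof (len_mul T HT x (x⁻¹ ∙ (zpow h m ∙ x))).
    rewrite (len_inv T HT) in *. rewrite mul_Vr_r, mulA_r, mul_Vr, mul_1r in H4.
    rewrite mul_Vr_r in *. unfold lx. lia. }
  assert (Ha : forall m, 0 <= m -> m <= a m).
  { refine (natlike_ind _ _ _). { apply dist_nonneg. }
    intros m Hm IH. specialize (Hs m Hm). change (a m + 1 <= a (m + 1)) in Hs.
    replace (Z.succ m) with (m + 1) by lia. lia. }
  exists (E0 + 6 * lx + 6 * k0 * lg), k0, (2 * lx + 2 * k0 * lg + 1).
  split; [nia|]. split; [lia|]. split; [nia|]. split.
  - intros i j Hi Hj. change (f i + f j <= f (i + j) + (E0 + 6 * lx + 6 * k0 * lg)).
    pose proof (Z.div_mod i k0 ltac:(lia)) as Di. pose proof (Z.mod_pos_bound i k0 Hk) as Mi.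
    pose proof (Z.div_mod j k0 ltac:(lia)) as Dj. pose proof (Z.mod_pos_bound j k0 Hk) as Mj.
    assert (0 <= i / k0) by (apply Z.div_pos; lia). assert (0 <= j / k0) by (apply Z.div_pos; lia).
    pose proof (Hfa (i / k0) (i mod k0)). pose proof (Hfa (j / k0) (j mod k0)).
    pose proof (Hfa (i / k0 + j / k0) (i mod k0 + j mod k0)).
    pose proof (HE (i / k0) (j / k0)) as HH.
    change (0 <= i / k0 -> 0 <= j / k0 -> a (i / k0) + a (j / k0) <= a (i / k0 + j / k0) + E0) in HH.
    rewrite <- Di in *. rewrite <- Dj in *.
    replace (k0 * (i / k0 + j / k0) + (i mod k0 + j mod k0)) with (i + j) in * by lia.
    lia.
  - intros i Hi. change (i <= k0 * (f i + (2 * lx + 2 * k0 * lg + 1))).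
    pose proof (Z.div_mod i k0 ltac:(lia)) as Di. pose proof (Z.mod_pos_bound i k0 Hk) as Mi.
    assert (0 <= i / k0) by (apply Z.div_pos; lia).
    pose proof (Hfa (i / k0) (i mod k0)) as H1. rewrite <- Di in H1. pose proof (Ha (i / k0)). nia.
Qed.

End Loxodromic.

Lemma exists_argmin {A : Type} (a0 : A) (P : A -> Prop) (f : A -> Z) :
  P a0 -> (forall a, 0 <= f a)%Z -> exists a, P a /\ forall b, P b -> (f a <= f b)%Z.
Proof.
  intros H0 Hf. remember (Z.to_nat (f a0)) as n eqn:En. revert a0 H0 En.
  induction n as [n IH] using (well_founded_induction lt_wf). intros a0 H0 En.
  destruct (classic (forall b, P b -> (f a0 <= f b)%Z)) as [K|K]; [now exists a0|].
  apply not_all_ex_not in K. destruct K as [b K]. apply imply_to_and in K. destruct K as [Hb K].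
  apply (IH (Z.to_nat (f b))) with b; auto. pose proof (Hf a0). pose proof (Hf b). lia.
Qed.

(** The last alternative covers i = j, where nothing forces J to be nonnegative. *)
Lemma discrete_ivt (u : Z -> Z) (J c i j : Z) :
  (i <= j)%Z -> (forall t, i <= t < j -> Z.abs (u (t + 1) - u t) <= J)%Z ->
  (Z.min (u i) (u j) <= c <= Z.max (u i) (u j))%Z ->
  exists t, (i <= t <= j)%Z /\ (Z.abs (u t - c) <= J)%Z \/ (t = i /\ u t = c).
Proof.
  intros Hij. replace j with (i + (j - i))%Z by lia.
  assert (Hn : (0 <= j - i)%Z) by lia. revert Hn. generalize (j - i)%Z as n. clear Hij j.
  refine (natlike_ind _ _ _).
  - intros _ Hc. rewrite Z.add_0_r in Hc. exists i. right. lia.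
  - intros n Hn IH HJ Hc.
    destruct (Z_le_dec (Z.min (u i) (u (i + n))) c) as [K1|K1];
    [destruct (Z_le_dec c (Z.max (u i) (u (i + n)))) as [K2|K2]|].
    1: destruct IH as [t [[Ht Ht']|Ht]]; [intros; apply HJ; lia|lia| |];
       [exists t; left; split; auto; lia|exists t; right; auto].
    all: exists (i + Z.succ n)%Z; left; split; [lia|];
      specialize (HJ (i + n)%Z ltac:(lia)); replace (i + n + 1)%Z with (i + Z.succ n)%Z in HJ by lia; lia.
Qed.

(** * Nearest-point projection to an infinite cyclic subgroup *)

Section Line.
Context {G : Group} (T : G -> Prop) (HT : symgen T) (S : list G) (HS : forall x, T x -> In x S)
  (del : Z) (Hdel : (0 <= del)%Z) (Hyp : hyp T del).
Context (g : G) (E k0 c0 : Z) (HE : (0 <= E)%Z) (Hk0 : (0 < k0)%Z) (Hc0 : (0 <= c0)%Z).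
Local Open Scope Z_scope.
Notation d := (dist T).
Let f (i : Z) := len T (zpow g i).
Hypothesis HQ : forall i j, 0 <= i -> 0 <= j -> f i + f j <= f (i + j) + E.
Hypothesis Hgrow : forall i, 0 <= i -> i <= k0 * (f i + c0).

Lemma f_abs i : f (Z.abs i) = f i.
Proof.
  destruct (Z.abs_eq_or_opp i) as [->| ->]; auto.
  unfold f. now rewrite <- zpow_opp, (len_inv T HT).
Qed.

Lemma f_opp i : f (- i) = f i.
Proof. now rewrite <- f_abs, Z.abs_opp, f_abs. Qed.

Lemma dist_zpow i j : d (zpow g i) (zpow g j) = f (j - i).
Proof. unfold dist, f. f_equal. rewrite zpow_opp, <- zpow_add. f_equal. lia. Qed.

Lemma f_add i j : f (i + j) <= f i + f j.
Proof. unfold f. rewrite zpow_add. now apply len_mul. Qed.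

Lemma f_grow i : Z.abs i <= k0 * (f i + c0).
Proof. rewrite <- f_abs. apply Hgrow. lia. Qed.

Definition near (x : G) (k : Z) : Prop := forall j, d x (zpow g k) <= d x (zpow g j).

Lemma near_ex x : exists k, near x k.
Proof.
  destruct (exists_argmin 0 (fun _ => True) (fun k => d x (zpow g k))) as [k [_ H]]; auto.
  { intros; apply dist_nonneg. }
  exists k. intros j. auto.
Qed.

Definition proj (x : G) : Z := epsilon (inhabits 0) (near x).

Lemma proj_near x : near x (proj x).
Proof. exact (epsilon_spec (inhabits 0) (near x) (near_ex x)). Qed.

Lemma proj_zpow k : zpow g (proj (zpow g k)) = zpow g k.
Proof.
  pose proof (proj_near (zpow g k) k) as H. rewrite (dist_refl T HT) in H.
  symmetry. apply (dist_zero T HT). pose proof (dist_nonneg T (zpow g k) (zpow g (proj (zpow g k)))). lia.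
Qed.

Let lg := len T g.

Lemma f_first_exceed B m : 0 <= m -> 0 <= B ->
  f m <= B \/ exists j, 0 <= j <= m /\ B < f j <= B + lg.
Proof.
  intros Hm HB. revert m Hm. refine (natlike_ind _ _ _).
  - left. unfold f. rewrite zpow_0, (len_one T HT). auto.
  - intros m Hm [IH|[j [Hj H]]].
    + destruct (Z_le_dec (f (Z.succ m)) B) as [K|K]; [now left|right].
      exists (Z.succ m). split; [lia|]. pose proof (f_add m 1) as H.
      replace (f 1) with lg in H by (unfold f, lg; now rewrite zpow_1).
      replace (m + 1) with (Z.succ m) in H by lia. lia.
    + right. exists j. split; [lia|auto].
Qed.

Let E1 := E + 4 * del + lg.

(** Take a point q of <g> between g^p and g^k, just more than E + 2 del from g^p. As g^p is nearest
    to x and <g> is almost additive, the four-point condition leaves only the pairing that bounds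
    the distance from x to g^k from below. *)
Lemma reverse_triangle x p k : near x p -> d x (zpow g p) + f (k - p) - E1 <= d x (zpow g k).
Proof.
  intros Hp. assert (Lg : 0 <= lg) by apply len_nonneg.
  destruct (f_first_exceed (E + 2 * del) (Z.abs (k - p))) as [K|[j [Hj Kj]]]; try lia.
  { rewrite f_abs in K. specialize (Hp k). unfold E1. lia. }
  set (s := Z.sgn (k - p)). assert (Es : k - p = s * Z.abs (k - p)) by (unfold s; nia).
  set (m := Z.abs (k - p)) in *.
  assert (Hs : s = 1 \/ s = -1 \/ m = 0) by (unfold s, m; lia).
  set (q := zpow g (p + s * j)).
  assert (F1 : d (zpow g p) q = f j).
  { unfold q. rewrite dist_zpow, <- (f_abs (_ - _)), <- (f_abs j). f_equal. nia. }
  assert (F2 : d q (zpow g k) = f (m - j)).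
  { unfold q. rewrite dist_zpow, <- (f_abs (_ - _)), <- (f_abs (m - j)). f_equal. nia. }
  pose proof (dist_zpow p k) as F3. rewrite <- f_abs in F3. fold m in F3.
  rewrite <- (f_abs (k - p)). fold m.
  pose proof (HQ j (m - j) ltac:(lia) ltac:(lia)) as H1. replace (j + (m - j)) with m in H1 by lia.
  pose proof (Hyp x (zpow g p) q (zpow g k)) as H2.
  pose proof (Hp (p + s * j)) as H3. fold q in H3. unfold E1. clearbody q. lia.
Qed.

Let C1 := 2 * E1 + 2 * del.

Lemma contraction x x' p p' : near x p -> near x' p' ->
  f (p' - p) <= C1 \/
  d x (zpow g p) + f (p' - p) + d x' (zpow g p') - C1 <= d x x'.
Proof.
  intros Hp Hp'. pose proof (reverse_triangle x p p' Hp). pose proof (reverse_triangle x' p' p Hp').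
  pose proof (dist_zpow p p') as F. pose proof (f_opp (p' - p)) as F'.
  replace (- (p' - p)) with (p - p') in F' by lia.
  pose proof (Hyp x x' (zpow g p') (zpow g p)) as H1.
  symd HT (x, x', zpow g p, zpow g p').
  unfold C1 in *. pose proof (len_nonneg T (zpow g (p' - p))). change (0 <= f (p' - p)) in H2.
  assert (0 <= E1) by (unfold E1, lg; pose proof (len_nonneg T g); lia).
  lia.
Qed.

Lemma proj_lipschitz x x' : Z.abs (proj x' - proj x) <= k0 * (d x x' + C1 + c0).
Proof.
  pose proof (f_grow (proj x' - proj x)). pose proof (dist_nonneg T x x').
  destruct (contraction x x' _ _ (proj_near x) (proj_near x')) as [K|K].
  - nia.
  - pose proof (dist_nonneg T x (zpow g (proj x))). pose proof (dist_nonneg T x' (zpow g (proj x'))).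
    nia.
Qed.

Let J := k0 * (lg + C1 + c0).
Let K1 := E + 2 * C1.
(** J bounds the jump of the projection between consecutive points of a coset y<g>. [lineK] adds the
    distance K1 of a point from its projection and the length of a jump; [lineM] leaves more than C1
    of <g> on either side of a value, even after a jump. *)
Definition lineK := K1 + J * lg.
Definition lineM := J + k0 * (C1 + c0) + 1.

Lemma C1_nonneg : 0 <= C1.
Proof. unfold C1, E1. pose proof (len_nonneg T g). fold lg in H. lia. Qed.

(** Some y g^t projects to within J of c. By [contraction] on both sides of it, passing through y
    g^t includes a detour of twice its distance to <g>; as y<g> is itself almost additive, the
    detour is short. *)
Lemma parallel_line y i j c : i <= j ->
  let a := proj (y ∙ zpow g i) in let b := proj (y ∙ zpow g j) in
  Z.min a b + lineM < c < Z.max a b - lineM ->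
  exists t, d (y ∙ zpow g t) (zpow g c) <= lineK.
Proof.
  intros Hij a b Hc. pose proof C1_nonneg as C10. pose proof (len_nonneg T g) as Lg. fold lg in Lg.
  assert (HJ0 : 0 <= J) by (unfold J; nia).
  assert (Hst : forall t, i <= t < j -> Z.abs (proj (y ∙ zpow g (t + 1)) - proj (y ∙ zpow g t)) <= J).
  { intros t _. pose proof (proj_lipschitz (y ∙ zpow g t) (y ∙ zpow g (t + 1))) as H.
    rewrite dist_left, dist_zpow in H. replace (t + 1 - t) with 1 in H by lia.
    unfold f in H. rewrite zpow_1 in H. exact H. }
  assert (HM : 0 <= lineM) by (unfold lineM; nia).
  destruct (discrete_ivt (fun t => proj (y ∙ zpow g t)) J c i j Hij Hst) as [t [[Ht Htc]|[Ht Htc]]].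
  { fold a b. lia. }
  2: { exfalso. subst t. fold a in Htc. lia. }
  exists t. set (q := proj (y ∙ zpow g t)) in *.
  assert (Fa : C1 < f (q - a)).
  { pose proof (f_grow (q - a)). unfold lineM in *. nia. }
  assert (Fb : C1 < f (b - q)).
  { pose proof (f_grow (b - q)). unfold lineM in *. nia. }
  destruct (contraction _ _ _ _ (proj_near (y ∙ zpow g i)) (proj_near (y ∙ zpow g t))) as [K|Ka].
  { fold a q in K. lia. }
  destruct (contraction _ _ _ _ (proj_near (y ∙ zpow g t)) (proj_near (y ∙ zpow g j))) as [K|Kb].
  { fold b q in K. lia. }
  fold a b q in Ka, Kb. rewrite !dist_left, !dist_zpow in Ka, Kb.
  pose proof (HQ (t - i) (j - t) ltac:(lia) ltac:(lia)) as H1.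
  replace (t - i + (j - t)) with (j - i) in H1 by lia.
  pose proof (dist_tri T HT (y ∙ zpow g i) (zpow g a) (zpow g b)) as H2.
  pose proof (dist_tri T HT (y ∙ zpow g i) (zpow g b) (y ∙ zpow g j)) as H3.
  rewrite dist_left, !dist_zpow in H3. rewrite dist_zpow in H2.
  rewrite (dist_sym T HT (zpow g b)) in H3.
  pose proof (f_add (q - a) (b - q)) as H4. replace (q - a + (b - q)) with (b - a) in H4 by lia.
  pose proof (dist_tri T HT (y ∙ zpow g t) (zpow g q) (zpow g c)) as H5. rewrite dist_zpow in H5.
  assert (H6 : f (c - q) <= J * lg).
  { rewrite <- f_abs. pose proof (len_zpow_le T HT g (Z.abs (c - q)) ltac:(lia)) as H6.
    fold lg in H6. fold (f (Z.abs (c - q))) in H6. nia. }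
  pose proof (dist_nonneg T (y ∙ zpow g t) (zpow g q)). unfold lineK, K1. lia.
Qed.

(* A long stretch along which y<g> follows <g> repeats one of finitely many relative positions. *)
Lemma coset_proj_dichotomy : exists B, forall y,
  (exists m l, l <> 0 /\ y ∙ zpow g m ∙ y⁻¹ = zpow g l) \/
  forall i j, Z.abs (proj (y ∙ zpow g i) - proj (y ∙ zpow g j)) <= B.
Proof.
  destruct (finite_ball T HT S HS (Z.to_nat lineK)) as [L HL].
  exists (2 * lineM + Z.of_nat (length L) + 2). intros y.
  destruct (classic (forall i j, Z.abs (proj (y ∙ zpow g i) - proj (y ∙ zpow g j))
     <= 2 * lineM + Z.of_nat (length L) + 2)) as [K|K]; [now right|left].
  assert (X : exists i j, i <= j /\ 2 * lineM + Z.of_nat (length L) + 2 <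
      Z.abs (proj (y ∙ zpow g i) - proj (y ∙ zpow g j))).
  { apply NNPP. intros N. apply K. intros i j. apply Z.le_ngt. intros N'. apply N.
    destruct (Z_le_dec i j); [now exists i, j|]. exists j, i. split; lia. }
  destruct X as [i [j [Hij X]]].
  set (a := proj (y ∙ zpow g i)) in *. set (b := proj (y ∙ zpow g j)) in *.
  set (cc := fun r : nat => Z.min a b + lineM + 1 + Z.of_nat r).
  assert (Hr : forall r, (r <= length L)%nat -> exists t, In ((zpow g (cc r))⁻¹ ∙ (y ∙ zpow g t)) L).
  { intros r Hr. destruct (parallel_line y i j (cc r) Hij) as [t Ht].
    { fold a b. unfold cc. lia. }
    exists t. apply HL. rewrite (dist_sym T HT) in Ht. unfold dist in Ht.
    pose proof (len_nonneg T ((zpow g (cc r))⁻¹ ∙ (y ∙ zpow g t))). lia. }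
  assert (X' : exists tt : nat -> Z, forall r, (r <= length L)%nat ->
      In ((zpow g (cc r))⁻¹ ∙ (y ∙ zpow g (tt r))) L).
  { exists (fun r => epsilon (inhabits 0) (fun t => In ((zpow g (cc r))⁻¹ ∙ (y ∙ zpow g t)) L)).
    intros r H. exact (epsilon_spec (inhabits 0) (fun t => In ((zpow g (cc r))⁻¹ ∙ (y ∙ zpow g t)) L) (Hr r H)). }
  destruct X' as [tt Htt].
  destruct (pigeonhole_list (fun r => (zpow g (cc r))⁻¹ ∙ (y ∙ zpow g (tt r))) L Htt) as [r1 [r2 [Hr12 Er]]].
  exists (tt r1 - tt r2), (cc r1 - cc r2). split; [unfold cc; lia|].
  unfold Z.sub. rewrite !zpow_add, <- !zpow_opp.
  apply (f_equal (fun u => zpow g (cc r1) ∙ u ∙ (zpow g (tt r2))⁻¹ ∙ y⁻¹)) in Er.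
  revert Er. grp. auto.
Qed.

End Line.

(** * The transfer to a central cyclic subgroup of finite index *)

Section Transfer.
Context {G : Group} (tf : torsion_free (G := G)).
Context (H : G -> Prop) (HH : is_subgroup H) (a : G) (Ha : H a) (a1 : a <> one)
  (central : forall z, H z -> z ∙ a = a ∙ z).
Local Open Scope Z_scope.

Let eqv (u v : G) := exists q, u = v ∙ zpow a q.

Lemma eqv_unique (u : G) q q' : u ∙ zpow a q = u ∙ zpow a q' -> q = q'.
Proof. intros E. apply mul_cancel_l in E. now apply (torsion_free_zpow_inj tf a). Qed.

Lemma transversal_ex (F : list G) : (forall z, H z -> exists u, In u F /\ eqv z u) ->
  exists F', (forall u, In u F' -> H u) /\ NoDup F' /\
    (forall u v, In u F' -> In v F' -> eqv u v -> u = v) /\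
    forall z, H z -> exists u, In u F' /\ eqv z u.
Proof.
  intros HF.
  assert (X : exists F', (forall u, In u F' -> H u) /\ NoDup F' /\
    (forall u v, In u F' -> In v F' -> eqv u v -> u = v) /\
    forall z, H z -> (exists u, In u F /\ eqv z u) -> exists u, In u F' /\ eqv z u).
  { clear HF. induction F as [|w F [F' [I1 [I2 [I3 I4]]]]].
    - exists []. split; [intros u []|split; [constructor|split; [intros u v []|]]]. intros z _ [u [[] _]].
    - assert (Hcov : forall z u, H z -> eqv z u -> H u).
      { intros z u Hz [q ->]. replace u with ((u ∙ zpow a q) ∙ zpow a (- q)) by grpz.
        apply HH; auto. clear - HH Ha. induction (- q) using Z.peano_ind.
        - apply HH.
        - rewrite zpow_succ. now apply HH.
        - replace (zpow a (Z.pred z)) with (a⁻¹ ∙ zpow a z); [apply HH; auto; now apply HH|].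
          rewrite <- (Z.succ_pred z) at 1. now rewrite zpow_succ, mul_Vl_r. }
      destruct (classic (H w /\ ~ exists u, In u F' /\ eqv w u)) as [[Kw K]|K].
      + exists (w :: F'). split; [|split; [|split]].
        * intros u [<-|Hu]; auto.
        * constructor; auto. intros Hw. apply K. exists w. split; auto. exists 0. grp.
        * intros u v [<-|Hu] [<-|Hv] Euv; auto.
          -- exfalso. apply K. now exists v.
          -- exfalso. apply K. exists u. split; auto. destruct Euv as [q ->]. exists (- q). grpz.
        * intros z Hz [u [[<-|Hu] Eu]]; [exists w; split; auto; now left|].
          destruct (I4 z Hz) as [v [Hv Ev]]; [now exists u|]. exists v. split; auto. now right.
      + exists F'. repeat split; auto. intros z Hz [u [[<-|Hu] Eu]]; [|apply I4; auto; now exists u].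
        apply NNPP. intros N. apply K. split; [eapply Hcov; eauto|].
        intros [v [Hv [q' Ev]]]. apply N. exists v. split; auto.
        destruct Eu as [q ->]. rewrite Ev. exists (q' + q). grpz. }
  destruct X as [F' [I1 [I2 [I3 I4]]]]. exists F'. repeat split; auto.
Qed.

Fixpoint sumZ {A} (h : A -> Z) (l : list A) : Z := match l with [] => 0 | u :: l' => h u + sumZ h l' end.

Lemma sumZ_perm {A} (h : A -> Z) l l' : Permutation l l' -> sumZ h l = sumZ h l'.
Proof. induction 1; cbn; try lia. Qed.

Lemma sumZ_map {A B} (h : B -> Z) (k : A -> B) l : sumZ h (map k l) = sumZ (fun u => h (k u)) l.
Proof. induction l; cbn; try lia. Qed.

Lemma sumZ_add {A} (h k : A -> Z) l : sumZ (fun u => h u + k u) l = sumZ h l + sumZ k l.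
Proof. induction l; cbn; try lia. Qed.

Lemma sumZ_ext {A} (h k : A -> Z) l : (forall u, In u l -> h u = k u) -> sumZ h l = sumZ k l.
Proof. intros E. induction l; cbn; auto. rewrite E, IHl; cbn; auto. intros; apply E; now right. Qed.

(* The transfer to the central subgroup <a> is injective because G has no torsion. *)
Lemma central_finite_index_cyclic (F : list G) :
  (forall z, H z -> exists u q, In u F /\ z = u ∙ zpow a q) ->
  exists t, H t /\ forall z, H z -> exists k, z = zpow t k.
Proof.
  intros HF. destruct (transversal_ex F) as [F' [I1 [I2 [I3 I4]]]].
  { intros z Hz. destruct (HF z Hz) as [u [q [Hu ->]]]. exists u. split; auto. now exists q. }
  set (P := fun (z : G) (uq : G * Z) => In (fst uq) F' /\ z = fst uq ∙ zpow a (snd uq)).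
  set (R := fun z => epsilon (inhabits (one, 0)) (P z)).
  assert (HR : forall z, H z -> P z (R z)).
  { intros z Hz. apply epsilon_spec. destruct (I4 z Hz) as [u [Hu [q E]]]. now exists (u, q). }
  set (rep := fun z => fst (R z)). set (q := fun z => snd (R z)).
  assert (Hrep : forall z, H z -> In (rep z) F' /\ z = rep z ∙ zpow a (q z)) by exact HR.
  assert (Runiq : forall z u k, H z -> In u F' -> z = u ∙ zpow a k -> rep z = u /\ q z = k).
  { intros z u k Hz Hu E. destruct (Hrep z Hz) as [Hr Er].
    assert (rep z = u).
    { apply I3; auto. exists (k - q z). apply (mul_cancel_r (zpow a (q z))).
      transitivity z; [now symmetry|]. transitivity (u ∙ zpow a k); [exact E|grpz]. }
    split; auto. rewrite H0 in Er. apply (eqv_unique u). congruence. }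
  (* The transfer homomorphism from H to <a>, written as an exponent: z permutes the cosets of <a>,
     and V z adds up the exponents by which the products miss the representatives. *)
  set (V := fun z => sumZ (fun u => q (z ∙ u)) F').
  destruct HH as [H1 [Hm Hi]].
  assert (VM : forall z w, H z -> H w -> V (z ∙ w) = V z + V w).
  { intros z w Hz Hw. unfold V.
    assert (Pm : Permutation F' (map (fun u => rep (w ∙ u)) F')).
    { apply NoDup_Permutation_bis.
      - exact I2.
      - now rewrite length_map.
      - assert (ND : NoDup (map (fun u => rep (w ∙ u)) F')).
        { apply NoDup_map_NoDup_ForallPairs; auto. intros u v Hu Hv E.
          apply I3; auto. destruct (Hrep (w ∙ u)) as [_ Eu]; [apply Hm; auto|].
          destruct (Hrep (w ∙ v)) as [_ Ev]; [apply Hm; auto|]. rewrite E in Eu.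
          exists (q (w ∙ u) - q (w ∙ v)). apply (mul_cancel_l w). rewrite mul_assoc.
          transitivity (rep (w ∙ v) ∙ zpow a (q (w ∙ u))); [exact Eu|].
          transitivity (rep (w ∙ v) ∙ zpow a (q (w ∙ v)) ∙ zpow a (q (w ∙ u) - q (w ∙ v))); [grpz|].
          f_equal. now symmetry. }
        assert (I : incl (map (fun u => rep (w ∙ u)) F') F').
        { intros u Hu. apply in_map_iff in Hu. destruct Hu as [v [<- Hv]]. apply Hrep. apply Hm; auto. }
        apply (NoDup_length_incl ND); auto. now rewrite length_map. }
    rewrite (sumZ_perm (fun u => q (z ∙ u)) _ _ Pm), sumZ_map, <- sumZ_add.
    apply sumZ_ext. intros u Hu. destruct (Hrep (w ∙ u)) as [Hr Er]; [apply Hm; auto|].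
    set (r := rep (w ∙ u)) in *. destruct (Hrep (z ∙ r)) as [Hr' Er']; [apply Hm; auto|].
    apply (Runiq (z ∙ w ∙ u) (rep (z ∙ r))); auto.
    transitivity (z ∙ (r ∙ zpow a (q (w ∙ u)))); [rewrite mulA_r; f_equal; exact Er|].
    transitivity (rep (z ∙ r) ∙ zpow a (q (z ∙ r)) ∙ zpow a (q (w ∙ u))); [|grpz].
    rewrite mul_assoc. f_equal. exact Er'. }
  assert (Vcard : forall k, V (zpow a k) = Z.of_nat (length F') * k).
  { intros k. unfold V. rewrite (sumZ_ext _ (fun _ => k)).
    - clear. induction F'; cbn -[Z.of_nat]; lia.
    - intros u Hu. apply (Runiq _ u k); auto.
      + apply Hm; auto. clear - Hm Hi H1 Ha. induction k using Z.peano_ind; auto.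
        * rewrite zpow_succ; auto.
        * replace (zpow a (Z.pred k)) with (a⁻¹ ∙ zpow a k); [auto|].
          rewrite <- (Z.succ_pred k) at 1. now rewrite zpow_succ, mul_Vl_r.
      + symmetry. apply zpow_commute. apply central; auto. }
  assert (F0 : 0 < Z.of_nat (length F')).
  { destruct (Hrep one H1) as [Hr _]. destruct F'; cbn in *; [tauto|lia]. }
  assert (Hpow : forall z k, H z -> H (zpow z k)).
  { intros z k Hz. induction k using Z.peano_ind; auto.
    - rewrite zpow_succ; auto.
    - replace (zpow z (Z.pred k)) with (z⁻¹ ∙ zpow z k); [auto|].
      rewrite <- (Z.succ_pred k) at 1. now rewrite zpow_succ, mul_Vl_r. }
  assert (V1 : V one = 0).
  { rewrite <- (zpow_0 a), Vcard. lia. }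
  assert (Vpow : forall z k, H z -> V (zpow z k) = k * V z).
  { intros z k Hz. induction k using Z.peano_ind.
    - cbn. exact V1.
    - rewrite zpow_succ, VM; auto. lia.
    - pose proof (VM z (zpow z (Z.pred k)) Hz (Hpow _ _ Hz)) as X.
      rewrite <- zpow_succ, Z.succ_pred in X. lia. }
  (* If V z = 0, two powers of z share a representative, so a nonzero power of z is some a^k with V
     (a^k) = 0. Then k = 0, and z is torsion, hence trivial. *)
  assert (Vinj : forall z, H z -> V z = 0 -> z = one).
  { intros z Hz E. apply NNPP. intros z1.
    destruct (pigeonhole_list (fun i => rep (zpow z (Z.of_nat i))) F') as [i [j [Hij Er]]].
    { intros i _. apply Hrep. auto. }
    destruct (Hrep (zpow z (Z.of_nat i))) as [_ Ei]; auto.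
    destruct (Hrep (zpow z (Z.of_nat j))) as [_ Ej]; auto. rewrite <- Er in Ej.
    assert (X : zpow z (Z.of_nat j - Z.of_nat i) =
       zpow a (q (zpow z (Z.of_nat j)) - q (zpow z (Z.of_nat i)))).
    { replace (Z.of_nat j - Z.of_nat i) with (- Z.of_nat i + Z.of_nat j) by lia.
      rewrite zpow_add, <- zpow_opp. revert Ei Ej.
      generalize (q (zpow z (Z.of_nat i))) (q (zpow z (Z.of_nat j))).
      intros qi qj Ei Ej. rewrite Ei, Ej. grpz. }
    assert (Y := Vcard (q (zpow z (Z.of_nat j)) - q (zpow z (Z.of_nat i)))).
    rewrite <- X, Vpow, E in Y by auto.
    assert (Z0 : q (zpow z (Z.of_nat j)) - q (zpow z (Z.of_nat i)) = 0) by nia.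
    rewrite Z0, zpow_0 in X. apply torsion_free_zpow in X; auto. lia. }
  destruct (exists_argmin a (fun z => H z /\ 0 < V z) (fun z => Z.abs (V z))) as [t [[Ht Vt] Hmin]].
  { split; auto. rewrite <- (zpow_1 a), Vcard. lia. }
  { intros; lia. }
  exists t. split; auto. intros z Hz. exists (V z / V t).
  apply (mul_cancel_r (zpow t (- (V z / V t)))). rewrite <- zpow_add, Z.add_opp_diag_r.
  apply Vinj; [now apply Hm; auto|]. rewrite VM, Vpow by auto.
  pose proof (Z.div_mod (V z) (V t) ltac:(lia)) as D. pose proof (Z.mod_pos_bound (V z) (V t) Vt) as B.
  destruct (Z.eq_dec (V z mod V t) 0) as [K|K]; [lia|].
  specialize (Hmin (z ∙ zpow t (- (V z / V t)))). rewrite VM, Vpow in Hmin by auto.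
  assert (H (z ∙ zpow t (- (V z / V t)))) by auto. exfalso.
  specialize (Hmin ltac:(split; [auto|lia])). lia.
Qed.

End Transfer.

(** * Centralizers and commensurators of powers of g *)

Section Elementary.
Context {G : Group} (T : G -> Prop) (HT : symgen T) (S : list G) (HS : forall x, T x -> In x S)
  (del : Z) (Hdel : (0 <= del)%Z) (Hyp : hyp T del) (tf : torsion_free (G := G)).
Context (g : G) (gnt : g <> one) (gnpp : ~ proper_power g).
Context (E k0 c0 : Z) (HE : (0 <= E)%Z) (Hk0 : (0 < k0)%Z) (Hc0 : (0 <= c0)%Z).
Local Open Scope Z_scope.
Notation d := (dist T).
Let f (i : Z) := len T (zpow g i).
Hypothesis HQ : forall i j, 0 <= i -> 0 <= j -> f i + f j <= f (i + j) + E.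
Hypothesis Hgrow : forall i, 0 <= i -> i <= k0 * (f i + c0).

(** Conjugation by y changes lengths by at most 2|y|, while the lengths of g^(mN) and g^(lN) drift
    apart with N unless |m| = |l|. *)
Lemma conj_zpow_abs y m l : y ∙ zpow g m ∙ y⁻¹ = zpow g l -> Z.abs m = Z.abs l.
Proof.
  intros H.
  assert (Hc : forall N, Z.abs (f (l * N) - f (m * N)) <= 2 * len T y).
  { intros N. unfold f. rewrite <- !zpow_mul, <- H, zpow_conj, zpow_mul.
    pose proof (len_mul T HT (y ∙ zpow g (m * N)) y⁻¹).
    pose proof (len_mul T HT y (zpow g (m * N))).
    pose proof (len_mul T HT (y⁻¹ ∙ (y ∙ zpow g (m * N) ∙ y⁻¹)) y) as H3.
    pose proof (len_mul T HT y⁻¹ (y ∙ zpow g (m * N) ∙ y⁻¹)).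
    rewrite (len_inv T HT) in *. autorewrite with grp in H3. autorewrite with grp in *. lia. }
  assert (Fa : forall i, f (Z.abs i) = f i) by apply (f_abs T HT g).
  assert (Fo : forall i, f (- i) = f i) by apply (f_opp T HT g).
  set (c := E + 2 * len T y).
  assert (Hk : forall p q, 0 <= p < q -> (forall N, Z.abs (f (q * N) - f (p * N)) <= 2 * len T y) -> False).
  { intros p q Hpq HN. set (N := k0 * (c + c0) + 1).
    assert (0 <= len T y) by apply len_nonneg.
    assert (HN0 : 0 <= N) by (unfold N, c; nia). specialize (HN N).
    pose proof (HQ (p * N) ((q - p) * N) ltac:(nia) ltac:(nia)) as H1.
    replace (p * N + (q - p) * N) with (q * N) in H1 by lia.
    pose proof (Hgrow ((q - p) * N) ltac:(nia)) as H2. unfold c in *. nia. }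
  assert (Hc' : forall N, 0 <= N -> Z.abs (f (Z.abs l * N) - f (Z.abs m * N)) <= 2 * len T y).
  { intros N HN. specialize (Hc N). rewrite <- (Fa (l * N)), <- (Fa (m * N)), !Z.abs_mul in Hc.
    now rewrite (Z.abs_eq N) in Hc. }
  assert (Hc2 : forall N, Z.abs (f (Z.abs l * N) - f (Z.abs m * N)) <= 2 * len T y).
  { intros N. destruct (Z_le_dec 0 N); auto. specialize (Hc' (- N) ltac:(lia)).
    rewrite !Z.mul_opp_r, !Fo in Hc'. exact Hc'. }
  destruct (Z.lt_trichotomy (Z.abs m) (Z.abs l)) as [K|[K|K]]; auto; exfalso.
  - apply (Hk (Z.abs m) (Z.abs l)); auto. lia.
  - apply (Hk (Z.abs l) (Z.abs m)); [lia|]. intros N. specialize (Hc2 N). lia.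
Qed.

Let K := lineK T del g E k0 c0.

(** The points z g^(mN) = g^(mN) z stay at distance at most |z| from <g> for N of either sign. So
    the projection of z<g> covers a large interval around 0, and [parallel_line] at c = 0 gives a
    bound independent of z. *)
Lemma centralizer_near_line m z : 0 < m -> z ∙ zpow g m = zpow g m ∙ z ->
  exists t, len T (z ∙ zpow g t) <= K.
Proof.
  intros Hm Hz. set (p := proj T g).
  assert (HzN : forall N, z ∙ zpow g (m * N) = zpow g (m * N) ∙ z).
  { intros N. rewrite <- zpow_mul. now apply zpow_commute. }
  assert (Hp : forall N, Z.abs (p (z ∙ zpow g (m * N)) - m * N) <= k0 * (2 * len T z + c0)).
  { intros N. pose proof (f_grow T HT g k0 c0 Hgrow (p (z ∙ zpow g (m * N)) - m * N)) as H1.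
    pose proof (proj_near T g (z ∙ zpow g (m * N)) (m * N)) as H2. fold p in H2.
    assert (H3 : d (z ∙ zpow g (m * N)) (zpow g (m * N)) = len T z).
    { rewrite (dist_sym T HT). unfold dist. rewrite HzN. grp. }
    pose proof (dist_tri T HT (zpow g (m * N)) (z ∙ zpow g (m * N)) (zpow g (p (z ∙ zpow g (m * N))))) as H4.
    rewrite (dist_zpow T g), (dist_sym T HT (zpow g (m * N))), H3 in H4. rewrite H3 in H2.
    cbv beta in H1. clearbody p. assert (len T (zpow g (p (z ∙ zpow g (m * N)) - m * N)) <= 2 * len T z) by lia. nia. }
  set (M := lineM T del g E k0 c0).
  set (N := Z.abs (k0 * (2 * len T z + c0)) + Z.abs M + 1).
  pose proof (Hp N) as H1. pose proof (Hp (- N)) as H2.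
  destruct (parallel_line T HT del Hdel Hyp g E k0 c0 HE Hk0 Hc0 HQ Hgrow z (m * - N) (m * N) 0) as [t Ht].
  - unfold N; nia.
  - fold p M. assert (m * N >= N) by (unfold N; nia). lia.
  - exists t. fold K in Ht. now rewrite zpow_0, (dist_sym T HT), dist_one_l in Ht.
Qed.

(** By [centralizer_near_line] the central subgroup <g^m> has finite index in the centralizer of
    g^m, which is therefore cyclic by transfer; g, not being a proper power, generates it. *)
Lemma centralizer_cyclic m z : 0 < m -> z ∙ zpow g m = zpow g m ∙ z -> exists k, z = zpow g k.
Proof.
  intros Hm Hz. set (H := fun z => z ∙ zpow g m = zpow g m ∙ z).
  assert (HH : is_subgroup H).
  { unfold H. split; [grp|]. split.
    - intros x y Hx Hy. now rewrite mulA_r, Hy, !mul_assoc, Hx.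
    - intros x Hx. apply (mul_cancel_l x), (mul_cancel_r x). now grp. }
  assert (Hg : forall k, H (zpow g k)) by (intros k; unfold H; grpz).
  destruct (finite_ball T HT S HS (Z.to_nat K)) as [L HL].
  assert (gm1 : zpow g m <> one).
  { intros E1. apply torsion_free_zpow in E1; auto. lia. }
  destruct (central_finite_index_cyclic tf H HH (zpow g m) (Hg m) gm1)
    with (F := flat_map (fun u => map (fun i => u ∙ zpow g (Z.of_nat i)) (seq 0 (Z.to_nat m))) L)
    as [t [Ht Hcyc]]; [auto| |].
  - intros x Hx. destruct (centralizer_near_line m x Hm Hx) as [s Hs].
    exists ((x ∙ zpow g s) ∙ zpow g ((- s) mod m)), ((- s) / m). split.
    + apply in_flat_map. exists (x ∙ zpow g s). split.
      { apply HL. pose proof (len_nonneg T (x ∙ zpow g s)). lia. }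
      apply in_map_iff. pose proof (Z.mod_pos_bound (- s) m Hm).
      exists (Z.to_nat ((- s) mod m)). rewrite Z2Nat.id by lia. split; auto. apply in_seq. lia.
    + rewrite zpow_mul. pose proof (Z.div_mod (- s) m ltac:(lia)).
      rewrite !mulA_r, <- !zpow_add. replace (s + ((- s) mod m + m * (- s / m))) with 0 by lia. grp.
  - destruct (Hcyc g) as [j Hj]. { rewrite <- (zpow_1 g). apply Hg. }
    destruct (Hcyc z Hz) as [k Hk].
    assert (Hj1 : j = 1 \/ j = -1).
    { destruct (Z_le_dec 2 (Z.abs j)) as [J|J].
      - exfalso. apply gnpp. destruct (Z_le_dec 0 j).
        + exists t, (Z.to_nat j). split; [lia|]. rewrite <- zpow_nat, Z2Nat.id by lia. auto.
        + exists t⁻¹, (Z.to_nat (- j)). split; [lia|]. rewrite <- zpow_nat, Z2Nat.id by lia.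
          replace (t⁻¹) with (zpow t (-1)) by (rewrite <- (zpow_1 t) at 2; rewrite zpow_opp; reflexivity).
          rewrite zpow_mul, Hj. f_equal. lia.
      - assert (j <> 0) by (intros ->; now rewrite zpow_0 in Hj). lia. }
    destruct Hj1 as [-> | ->].
    + exists k. now rewrite Hj, zpow_mul, Z.mul_1_l.
    + exists (- k). rewrite Hj, zpow_mul, Hk. f_equal. lia.
Qed.

(** Either y centralizes a power of g or it inverts one. In the second case y^2 is a power of g, a
    power of which y both fixes and inverts; so y^2 = 1 and y = 1. *)
Lemma commensurator_cyclic y m l : l <> 0 -> y ∙ zpow g m ∙ y⁻¹ = zpow g l -> exists k, y = zpow g k.
Proof.
  intros Hl H. pose proof (conj_zpow_abs _ _ _ H) as Ha.
  assert (Hy : forall r, y ∙ zpow g (m * r) = zpow g (l * r) ∙ y).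
  { intros r. rewrite <- !zpow_mul, <- H, zpow_conj. grp. }
  destruct (Z.eq_dec m l) as [<-|Hml].
  - apply (centralizer_cyclic (Z.abs m)); [lia|]. replace (Z.abs m) with (m * Z.sgn m) by nia. apply Hy.
  - assert (l = - m) by lia. subst l.
    destruct (centralizer_cyclic (Z.abs m) (y ∙ y)) as [j Hj]; [lia| |].
    { replace (Z.abs m) with (m * Z.sgn m) by nia. rewrite mulA_r, Hy, mul_assoc.
      replace (- m * Z.sgn m) with (m * (- Z.sgn m)) by lia. rewrite Hy, mulA_r. do 2 f_equal. lia. }
    assert (E1 : zpow g (j * m) = zpow g (- (j * m))).
    { apply (mul_cancel_r y). replace (- (j * m)) with (- m * j) by lia. rewrite <- Hy.
      assert (E0 : zpow g (j * m) = zpow (y ∙ y) m) by (rewrite Hj, zpow_mul; auto).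
      rewrite (Z.mul_comm m j), E0. symmetry. apply zpow_commute. grp. }
    apply torsion_free_zpow_inj in E1; auto. assert (j = 0) by nia. subst j.
    exists 0. apply NNPP. intros y1. assert (X : 2 = 0); [|lia].
    apply (torsion_free_zpow tf y); auto. change 2 with (Z.succ (Z.succ 0)).
    rewrite !zpow_succ, zpow_0, mul_1r. exact Hj.
Qed.

End Elementary.

(* All that is used of the word metric later on: a coarse Lipschitz projection to <g> which is
   coarsely constant on every other coset of <g>. *)
Lemma line_projection_ex {G : Group} (T : G -> Prop) (HT : symgen T) (S : list G)
  (HS : forall x, T x -> In x S) (del : Z) (Hdel : (0 <= del)%Z) (Hyp : hyp T del)
  (tf : torsion_free (G := G)) (g : G) (gnt : g <> one) (gnpp : ~ proper_power g) :
  exists (B : Z) (p : G -> Z), (0 <= B /\ (forall k, p (zpow g k) = k) /\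
    (forall x s, T s -> Z.abs (p (x ∙ s) - p x) <= B) /\
    (forall x k, (forall j, x <> zpow g j) -> Z.abs (p (x ∙ zpow g k) - p x) <= B))%Z.
Proof.
  destruct (cyclic_subgroup_quasi_line T HT S HS del Hdel Hyp tf g gnt) as
    [E [k0 [c0 [HE [Hk0 [Hc0 [HQ Hgrow]]]]]]].
  destruct (coset_proj_dichotomy T HT S HS del Hdel Hyp g E k0 c0 HE Hk0 Hc0 HQ Hgrow) as [B HB].
  set (p := proj T g).
  set (C1 := (2 * (E + 4 * del + len T g) + 2 * del)%Z).
  assert (C10 : (0 <= C1)%Z) by (unfold C1; pose proof (len_nonneg T g); lia).
  set (B1 := (k0 * (1 + C1 + c0))%Z). assert (0 <= B1)%Z by (unfold B1; nia).
  exists (Z.max B1 (Z.abs B)), p. split; [lia|]. split; [|split].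
  - intros k. pose proof (proj_zpow T HT g k) as K.
    now apply (torsion_free_zpow_inj tf g) in K.
  - intros x s Hs.
    pose proof (proj_lipschitz T HT del Hdel Hyp g E k0 c0 HE Hk0 HQ Hgrow x (x ∙ s)) as L.
    fold p C1 in L. pose proof (dist_gen T HT x s Hs). unfold B1. nia.
  - intros x k Hx. destruct (HB x) as [[m [l [Hl Hc]]]|K].
    + exfalso. destruct (commensurator_cyclic T HT S HS del Hdel Hyp tf g gnt gnpp E k0 c0
        HE Hk0 Hc0 HQ Hgrow x m l Hl Hc) as [j Hj]. now apply (Hx j).
    + specialize (K k 0%Z). rewrite zpow_0, mul_1r in K. unfold p. lia.
Qed.

(** * The coned-off metric *)

Lemma pow2_dominates (A B : Z) : (0 <= A -> 0 <= B ->
  exists k0, 0 <= k0 /\ forall k, k0 <= k -> A + B * k < 2 ^ k)%Z.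
Proof.
  intros HA HB. assert (H1 : forall m, (0 <= m -> m + 1 <= 2 ^ m)%Z).
  { refine (natlike_ind _ _ _); [cbn; lia|]. intros m Hm IH. rewrite Z.pow_succ_r by lia. lia. }
  exists (2 * (A + 2 * B + 2))%Z. split; [lia|]. intros k Hk.
  set (m := (k / 2)%Z). assert (Hm : (2 * m <= k <= 2 * m + 1)%Z).
  { unfold m. pose proof (Z.div_mod k 2 ltac:(lia)). pose proof (Z.mod_pos_bound k 2 ltac:(lia)). lia. }
  assert (H2 : (2 ^ (2 * m) <= 2 ^ k)%Z) by (apply Z.pow_le_mono_r; lia).
  replace (2 * m)%Z with (m + m)%Z in H2 by lia. rewrite Z.pow_add_r in H2 by lia.
  pose proof (H1 m ltac:(lia)). nia.
Qed.

Lemma hits_value (h : nat -> Z) (V : Z) (n : nat) : (h O = 0 -> 0 < V ->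
  (forall t, Z.abs (h (S t) - h t) <= 1) ->
  (exists t, (t <= n)%nat /\ h t = V) \/ h n < V)%Z.
Proof.
  intros H0 HV Hs. induction n as [|n [[t [Ht E]]|IH]].
  - right. lia.
  - left. exists t. split; auto.
  - specialize (Hs n). destruct (Z.eq_dec (h (S n)) V); [left; exists (S n); split; auto|right; lia].
Qed.

Lemma geodesic_subword {G : Group} (T : G -> Prop) (HT : symgen T) (w : list G) (a : G) :
  Forall T w -> Z.of_nat (length w) = dist T a (a ∙ prod w) ->
  forall i j, (i <= j <= length w)%nat ->
  exists u, Forall T u /\ length u = (j - i)%nat /\
    a ∙ prod (firstn j w) = a ∙ prod (firstn i w) ∙ prod u /\
    dist T (a ∙ prod (firstn i w)) (a ∙ prod (firstn j w)) = Z.of_nat (j - i) /\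
    forall u1 u2, u = u1 ++ u2 -> exists m, (m <= length w)%nat /\
      a ∙ prod (firstn i w) ∙ prod u1 = a ∙ prod (firstn m w).
Proof.
  intros Hw Lw i j Hij.
  set (u := firstn (j - i) (skipn i w)).
  assert (Ej : firstn j w = firstn i w ++ u).
  { unfold u. replace j with (i + (j - i))%nat at 1 by lia.
    rewrite <- (firstn_skipn i w) at 1. rewrite firstn_app, firstn_firstn, length_firstn.
    f_equal; f_equal; lia. }
  assert (Hu : Forall T u).
  { unfold u. apply Forall_forall. intros t Ht. rewrite Forall_forall in Hw. apply Hw.
    rewrite <- (firstn_skipn i w), <- (firstn_skipn (j - i) (skipn i w)).
    apply in_or_app. right. apply in_or_app. now left. }
  assert (Lu : length u = (j - i)%nat) by (unfold u; rewrite length_firstn, length_skipn; lia).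
  assert (E1 : a ∙ prod (firstn j w) = a ∙ prod (firstn i w) ∙ prod u) by (now rewrite Ej, prod_app, mul_assoc).
  exists u. split; [auto|split; [auto|split; [auto|split]]].
  - set (p := a ∙ prod (firstn i w)) in *. set (q := a ∙ prod (firstn j w)) in *.
    assert (H1 : (dist T a p <= Z.of_nat i)%Z).
    { unfold dist, p. rewrite mul_Vl_r. etransitivity.
      { apply (len_le T HT). apply Forall_forall. intros t Ht. rewrite Forall_forall in Hw. apply Hw.
        rewrite <- (firstn_skipn i w). apply in_or_app. now left. }
      rewrite length_firstn. lia. }
    assert (H2 : (dist T p q <= Z.of_nat (j - i))%Z).
    { unfold dist. rewrite E1. rewrite mul_Vl_r, <- Lu. now apply (len_le T HT). }
    assert (H3 : (dist T q (a ∙ prod w) <= Z.of_nat (length w - j))%Z).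
    { unfold dist, q. rewrite <- (firstn_skipn j w) at 2. rewrite prod_app. autorewrite with grp.
      rewrite <- length_skipn. apply (len_le T HT). apply Forall_forall. intros t Ht.
      rewrite Forall_forall in Hw. apply Hw. rewrite <- (firstn_skipn j w). apply in_or_app. now right. }
    pose proof (dist_tri T HT a p q). pose proof (dist_tri T HT a q (a ∙ prod w)). lia.
  - intros u1 u2 Eu. exists (i + length u1)%nat. split.
    { apply (f_equal (@length _)) in Eu. rewrite length_app in Eu. lia. }
    rewrite mulA_r, <- prod_app. do 2 f_equal.
    assert (Em : firstn j w = (firstn i w ++ u1) ++ u2) by (rewrite Ej, Eu, app_assoc; auto).
    assert (L : length (firstn i w ++ u1) = (i + length u1)%nat).
    { rewrite length_app, length_firstn. lia. }
    set (v := firstn i w ++ u1) in *.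
    transitivity (firstn (length v) (v ++ (u2 ++ skipn j w))).
    + rewrite firstn_app, Nat.sub_diag, firstn_all. cbn. now rewrite app_nil_r.
    + rewrite L. f_equal. rewrite app_assoc, <- Em. apply firstn_skipn.
Qed.

Definition coned {G : Group} (T : G -> Prop) (g : G) (x : G) : Prop := T x \/ exists k, x = zpow g k.

Section Cone.
Context {G : Group} (T : G -> Prop) (HT : symgen T)
  (del : Z) (Hdel : (0 <= del)%Z) (Hyp : hyp T del).
Context (g : G) (E : Z) (HE : (0 <= E)%Z).
Local Open Scope Z_scope.
Notation d := (dist T).
Notation U := (coned T g).
Notation dh := (dist U).
Hypothesis HQ : forall i j, 0 <= i -> 0 <= j ->
  len T (zpow g i) + len T (zpow g j) <= len T (zpow g (i + j)) + E.

Lemma coned_symgen : symgen U.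
Proof.
  split.
  - intros x [H|[k ->]]; [left; now apply HT|right]. exists (- k). now rewrite zpow_opp.
  - intros x. destruct (proj2 HT x) as [w [Hw Ew]]. exists w. split; auto.
    eapply Forall_impl; [|exact Hw]. now left.
Qed.
Let HU := coned_symgen.

Lemma coned_dist_le x y : dh x y <= d x y.
Proof.
  unfold dist. destruct (len_word T HT (x⁻¹ ∙ y)) as [w [Hw [Lw Ew]]].
  rewrite <- Lw, <- Ew. apply (len_le U HU). eapply Forall_impl; [|exact Hw]. now left.
Qed.

Lemma coned_dist_coset x k : dh x (x ∙ zpow g k) <= 1.
Proof. apply (dist_gen U HU). right. now exists k. Qed.

Let lg := len T g.
Let Kc := E + lg + 2 * del + 1.

(** An edge g^k of the coned-off graph spans a stretch of a coset in the old metric. The stretch is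
    almost additive, so a point close to a geodesic between its ends is close to some v g^j, one new
    edge away from v. *)
Lemma near_edge x v t kap : U t -> 0 <= kap ->
  d x v + d x (v ∙ t) <= d v (v ∙ t) + 2 * kap -> dh x v <= 2 * kap + Kc.
Proof.
  intros Ht Hk H. assert (Lg : 0 <= lg) by apply len_nonneg.
  destruct Ht as [Ht|[k ->]].
  - pose proof (dist_gen T HT v t Ht). pose proof (dist_tri T HT v (v ∙ t) x).
    pose proof (coned_dist_le x v). symd HT (x, v, v ∙ t). unfold Kc. lia.
  - assert (X : exists j, d x (v ∙ zpow g j) <= E + 2 * kap + lg + 2 * del).
    { assert (Hv : forall i j, d (v ∙ zpow g i) (v ∙ zpow g j) = len T (zpow g (j - i))).
      { intros i j. rewrite dist_left. apply dist_zpow. }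
      pose proof (Hv 0 k) as H0. rewrite zpow_0, mul_1r, Z.sub_0_r in H0.
      assert (Fa : forall i, len T (zpow g (Z.abs i)) = len T (zpow g i)) by apply (f_abs T HT g).
      destruct (f_first_exceed T HT g (d x v) (Z.abs k)) as [K|[j [Hj Kj]]]; try lia.
      { apply dist_nonneg. }
      { exists k. rewrite Fa in K. lia. }
      set (s := Z.sgn k). exists (s * j).
      assert (Es : k = s * Z.abs k) by (unfold s; lia).
      pose proof (Hv 0 (s * j)) as H1. rewrite zpow_0, mul_1r, Z.sub_0_r in H1.
      pose proof (Hv (s * j) k) as H2.
      assert (Hs : s = 1 \/ s = -1 \/ k = 0) by (unfold s; lia).
      rewrite <- Fa in H0, H1, H2.
      replace (Z.abs (s * j)) with j in H1 by nia.
      replace (Z.abs (k - s * j)) with (Z.abs k - j) in H2 by nia.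
      pose proof (HQ j (Z.abs k - j) ltac:(lia) ltac:(lia)) as H3.
      replace (j + (Z.abs k - j)) with (Z.abs k) in H3 by lia.
      pose proof (Hyp x v (v ∙ zpow g (s * j)) (v ∙ zpow g k)) as H4. fold lg in Kj. lia. }
    destruct X as [j Hj]. pose proof (coned_dist_le x (v ∙ zpow g j)).
    pose proof (dist_tri U HU x (v ∙ zpow g j) v). pose proof (coned_dist_coset v j).
    symd HU (x, v, v ∙ zpow g j). unfold Kc. lia.
Qed.

(* Bisection: a path with at most 2^k edges comes within O(k) of each point of a geodesic joining its ends. *)
Lemma near_path k : forall w v x kap, Forall U w -> (length w <= 2 ^ k)%nat -> 0 <= kap ->
  d x v + d x (v ∙ prod w) <= d v (v ∙ prod w) + 2 * kap ->
  exists w1 w2, w = w1 ++ w2 /\ dh x (v ∙ prod w1) <= 2 * kap + 2 * Z.of_nat k * del + Kc.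
Proof.
  assert (Lg : 0 <= lg) by apply len_nonneg.
  induction k as [|k IH]; intros w v x kap Hw Lw Hk H.
  - exists [], w. split; auto. cbn [prod]. rewrite mul_1r.
    destruct w as [|t [|t' w]]; cbn in Lw; [| |lia].
    + cbn [prod] in H. rewrite mul_1r, (dist_refl T HT) in H. pose proof (coned_dist_le x v).
      unfold Kc. lia.
    + cbn [prod] in H. rewrite mul_1r in H. inversion Hw; subst.
      pose proof (near_edge x v t kap ltac:(assumption) Hk H). lia.
  - set (h := (length w / 2)%nat).
    assert (Hh : (h <= 2 ^ k /\ length w - h <= 2 ^ k)%nat).
    { rewrite Nat.pow_succ_r' in Lw. unfold h. revert Lw. generalize (2 ^ k)%nat as p.
      intros p Lw. pose proof (Nat.div_mod (length w) 2 ltac:(lia)).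
      pose proof (Nat.mod_upper_bound (length w) 2 ltac:(lia)). lia. }
    rewrite <- (firstn_skipn h w) in Hw, H |- *.
    assert (L1 : (length (firstn h w) <= 2 ^ k)%nat) by (rewrite length_firstn; lia).
    assert (L2 : (length (skipn h w) <= 2 ^ k)%nat) by (rewrite length_skipn; lia).
    revert Hw H L1 L2. generalize (firstn h w) as u1, (skipn h w) as u2. intros u1 u2 Hw H L1 L2.
    apply Forall_app in Hw. destruct Hw as [Hu1 Hu2]. rewrite prod_app, mul_assoc in H.
    set (m := v ∙ prod u1) in *. set (e := m ∙ prod u2) in *.
    pose proof (Hyp x v m e) as H1.
    destruct (Z_le_dec (d x m + d v e) (d x v + d m e + 2 * del)) as [K|K].
    + destruct (IH u2 m x (kap + del)) as [w1 [w2 [-> Hd]]]; auto; try lia.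
      { fold e. symd HT (x, v, m, e). lia. }
      exists (u1 ++ w1), w2. split; [now rewrite app_assoc|]. rewrite prod_app, mul_assoc. fold m. lia.
    + destruct (IH u1 v x (kap + del)) as [w1 [w2 [-> Hd]]]; auto; try lia.
      { fold m. symd HT (x, v, m, e). lia. }
      exists w1, (w2 ++ u2). split; [now rewrite app_assoc|]. lia.
Qed.

(** The divergence argument of the Morse lemma. If x0 on an old geodesic is at maximal distance M
    from the new one, a detour around x0 with O(M) edges keeps distance M from it, whereas
    [near_path] finds a point of the detour within O(log M). *)
Lemma between_near_geodesic : exists D0, 0 <= D0 /\ forall a b x, d a x + d x b = d a b ->
  dh a x + dh x b <= dh a b + 2 * D0.
Proof.
  assert (Lg : 0 <= lg) by apply len_nonneg.
  assert (HKc : 0 <= Kc) by (unfold Kc; lia).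
  destruct (pow2_dominates (12 * (4 * del + Kc)) (24 * del)) as [k0 [Hk0 Hpow]]; try lia.
  set (D0 := 4 * del + Kc + 2 * k0 * del). assert (HD0 : 0 <= D0) by (unfold D0; nia).
  exists D0. split; auto. intros a b x Hx.
  destruct (len_word U HU (a⁻¹ ∙ b)) as [gam [Hgam [Lgam Egam]]].
  assert (Eb : a ∙ prod gam = b) by (rewrite Egam; grp).
  pose proof (geodesic_subword U HU gam a Hgam) as Ggam. rewrite Eb in Ggam. specialize (Ggam Lgam).
  set (gp := fun m => a ∙ prod (firstn m gam)) in *.
  destruct (len_word T HT (a⁻¹ ∙ x)) as [s1 [Hs1 [Ls1 Es1]]].
  destruct (len_word T HT (x⁻¹ ∙ b)) as [s2 [Hs2 [Ls2 Es2]]].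
  set (s := s1 ++ s2).
  assert (Es : a ∙ prod s = b) by (unfold s; rewrite prod_app, Es1, Es2; grp).
  assert (Hs : Forall T s) by (apply Forall_app; auto).
  assert (Ls : Z.of_nat (length s) = d a b).
  { unfold s. rewrite length_app. unfold dist in Hx |- *. lia. }
  pose proof (geodesic_subword T HT s a Hs) as Gs. rewrite Es in Gs. specialize (Gs Ls).
  set (xp := fun i => a ∙ prod (firstn i s)) in *.
  assert (Hxp : forall i j, (i <= j <= length s)%nat -> d (xp i) (xp j) = Z.of_nat (j - i)).
  { intros i j Hij. destruct (Gs i j Hij) as [_ [_ [_ [_ [K _]]]]]. exact K. }
  assert (Hgp : forall i j, (i <= j <= length gam)%nat -> dh (gp i) (gp j) = Z.of_nat (j - i)).
  { intros i j Hij. destruct (Ggam i j Hij) as [_ [_ [_ [_ [K _]]]]]. exact K. }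
  assert (gp0 : gp O = a) by (unfold gp; cbn; apply mul_1r).
  assert (gpn : gp (length gam) = b) by (unfold gp; now rewrite firstn_all).
  assert (xp0 : xp O = a) by (unfold xp; cbn; apply mul_1r).
  assert (xpn : xp (length s) = b) by (unfold xp; now rewrite firstn_all).
  assert (Hng : forall z, exists m, (m <= length gam)%nat /\ forall m', (m' <= length gam)%nat ->
      dh z (gp m) <= dh z (gp m')).
  { intros z. apply (exists_argmin O (fun m => (m <= length gam)%nat) (fun m => dh z (gp m))); [lia|].
    intros; apply dist_nonneg. }
  set (ng := fun z => epsilon (inhabits O) (fun m => (m <= length gam)%nat /\ forall m',
    (m' <= length gam)%nat -> dh z (gp m) <= dh z (gp m'))).
  assert (Hn : forall z, (ng z <= length gam)%nat /\ forall m', (m' <= length gam)%nat ->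
      dh z (gp (ng z)) <= dh z (gp m')) by (intros z; exact (epsilon_spec (inhabits O) _ (Hng z))).
  clearbody ng. clear Hng.
  (* A maximum, found by minimizing the complement to d a b, which dominates all these distances;
     [Z.max 0] provides the nonnegativity asked for by [exists_argmin]. *)
  destruct (exists_argmin O (fun i => (i <= length s)%nat)
    (fun i => Z.max 0 (d a b - dh (xp i) (gp (ng (xp i)))))) as [i0 [Hi0 Hmax]]; [lia|lia|].
  assert (Hle : forall i, (i <= length s)%nat -> dh (xp i) (gp (ng (xp i))) <= d a b).
  { intros i Hi. destruct (Hn (xp i)) as [_ K]. specialize (K O ltac:(lia)). rewrite gp0 in K.
    pose proof (coned_dist_le (xp i) a) as K2. rewrite <- xp0, (dist_sym T HT), Hxp in K2 by lia.
    rewrite xp0 in K2. lia. }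
  set (M := dh (xp i0) (gp (ng (xp i0)))) in *.
  assert (Hmax' : forall i, (i <= length s)%nat -> dh (xp i) (gp (ng (xp i))) <= M).
  { intros i Hi. pose proof (Hmax i Hi). pose proof (Hle i Hi). pose proof (Hle i0 Hi0). lia. }
  assert (HM : M <= D0).
  { destruct (Z_le_dec M 0) as [M0|M0]; [lia|].
    (* The three pieces of the detour have at most M, 6M and M edges, all at most 2^k. *)
    set (k := Z.log2 (6 * M) + 1).
    assert (Hk : 6 * M <= 2 ^ k <= 12 * M /\ 0 <= k).
    { unfold k. pose proof (Z.log2_spec (6 * M) ltac:(lia)) as K. pose proof (Z.log2_nonneg (6 * M)).
      rewrite <- Z.add_1_r in K. rewrite Z.pow_add_r in * by lia. lia. }
    assert (Hkn : 2 ^ k = Z.of_nat (2 ^ Z.to_nat k)).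
    { rewrite Nat2Z.inj_pow, Z2Nat.id by lia. reflexivity. }
    assert (HMk : M <= 4 * del + 2 * k * del + Kc).
    2:{ destruct (Z_le_dec k0 k) as [K|K]; [|unfold D0; nia]. specialize (Hpow k K). lia. }
    set (x0 := xp i0).
    assert (Hvert : forall m, (m <= length gam)%nat -> M <= dh x0 (gp m)) by (intros; now apply Hn).
    set (h1 := fun t => dh (xp (i0 - t)%nat) x0). set (h2 := fun t => dh (xp (Nat.min (length s) (i0 + t))) x0).
    assert (Hstep : forall i j, (i <= length s)%nat -> (j <= length s)%nat -> (i <= j <= i + 1)%nat ->
       Z.abs (dh (xp i) x0 - dh (xp j) x0) <= 1).
    { intros i j Hi Hj Hij. pose proof (coned_dist_le (xp i) (xp j)) as K. rewrite Hxp in K by lia.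
      pose proof (dist_tri U HU (xp i) (xp j) x0). pose proof (dist_tri U HU (xp j) (xp i) x0).
      symd HU (xp i, xp j). lia. }
    (* Walk back from x0 along the old geodesic until the new distance from x0 is 2M, or else to the
       end a, and drop from there to the new geodesic. *)
    assert (X1 : exists y p mp, d y x0 = d a x0 - d a y /\ d a y <= d a x0 /\ (mp <= length gam)%nat /\ p = gp mp /\
       dh y p <= M /\ dh y x0 <= 2 * M /\ (y = p \/ dh y x0 = 2 * M)).
    { destruct (hits_value h1 (2 * M) i0) as [[t [Ht E1]]|E1]; try lia.
      - unfold h1. rewrite Nat.sub_0_r. apply (dist_refl U HU).
      - intros t. unfold h1.
        destruct (le_lt_dec i0 t). { replace (i0 - S t)%nat with (i0 - t)%nat by lia. lia. }
        pose proof (Hstep (i0 - S t)%nat (i0 - t)%nat ltac:(lia) ltac:(lia) ltac:(lia)). lia.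
      - set (y := xp (i0 - t)%nat). exists y, (gp (ng y)), (ng y). unfold y, x0.
        rewrite <- xp0, !Hxp by lia. destruct (Hn (xp (i0 - t)%nat)) as [K _].
        pose proof (Hmax' (i0 - t)%nat ltac:(lia)). unfold h1, x0 in E1. rewrite ?xp0.
        repeat split; auto; try lia.
      - exists a, (gp O), O. rewrite gp0, (dist_refl U HU), (dist_refl T HT). unfold x0.
        unfold h1, x0 in E1. rewrite Nat.sub_diag, xp0 in E1.
        repeat split; auto; try lia. pose proof (dist_nonneg T a (xp i0)). lia. }
    assert (X2 : exists z q mq, d x0 z = d x0 b - d z b /\ d z b <= d x0 b /\ (mq <= length gam)%nat /\ q = gp mq /\
       dh z q <= M /\ dh z x0 <= 2 * M /\ (z = q \/ dh z x0 = 2 * M)).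
    { destruct (hits_value h2 (2 * M) (length s - i0)) as [[t [Ht E1]]|E1]; try lia.
      - unfold h2. rewrite Nat.add_0_r, Nat.min_r by lia. apply (dist_refl U HU).
      - intros t. unfold h2.
        destruct (le_lt_dec (length s) (i0 + t)).
        { rewrite !Nat.min_l by lia. lia. } rewrite !Nat.min_r by lia.
        pose proof (Hstep (i0 + t)%nat (i0 + S t)%nat ltac:(lia) ltac:(lia) ltac:(lia)). lia.
      - unfold h2 in E1. rewrite Nat.min_r in E1 by lia.
        set (z := xp (i0 + t)%nat). exists z, (gp (ng z)), (ng z). unfold z, x0.
        rewrite <- xpn, !Hxp by lia. destruct (Hn (xp (i0 + t)%nat)) as [K _].
        pose proof (Hmax' (i0 + t)%nat ltac:(lia)). unfold x0 in E1.
        repeat split; auto; try lia.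
      - exists b, (gp (length gam)), (length gam). rewrite gpn, (dist_refl U HU), (dist_refl T HT). unfold x0.
        unfold h2, x0 in E1. rewrite Nat.min_l, xpn in E1 by lia.
        repeat split; auto; try lia. pose proof (dist_nonneg T (xp i0) b). lia. }
    destruct X1 as [y [p [mp [Y1 [Y2 [Y3 [Y4 [Y5 [Y6 Y7]]]]]]]]].
    destruct X2 as [z [q [mq [Z1 [Z2 [Z3 [Z4 [Z5 [Z6 Z7]]]]]]]]].
    assert (Hyz : d y x0 + d x0 z <= d y z).
    { assert (d a x0 + d x0 b = d a b).
      { unfold x0. rewrite <- xp0, <- xpn, !Hxp by lia. lia. }
      pose proof (dist_tri T HT a y b). pose proof (dist_tri T HT y z b). lia. }
    (* A drop has at most M edges and starts at distance 2M from x0, so it stays at distance at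
       least M. *)
    assert (Hside : forall v u, dh v u <= M -> (v = u \/ dh v x0 = 2 * M) -> (exists m, (m <= length gam)%nat /\ u = gp m) ->
      d x0 v + d x0 u <= d v u + 2 * (2 * del) -> M <= 4 * del + 2 * k * del + Kc).
    { intros v u Hvu Hc [m [Hm Eu]] Hgp'. destruct Hc as [->|Hc].
      - rewrite (dist_refl T HT) in Hgp'. pose proof (Hvert m Hm). rewrite <- Eu in *.
        pose proof (coned_dist_le x0 u). nia.
      - destruct (len_word U HU (v⁻¹ ∙ u)) as [w [Hw [Lw Ew]]].
        assert (Eu' : v ∙ prod w = u) by (rewrite Ew; grp).
        destruct (near_path (Z.to_nat k) w v x0 (2 * del)) as [w1 [w2 [-> Hd]]]; auto; try lia.
        { apply Nat2Z.inj_le. rewrite <- Hkn, Lw. unfold dist in Hvu. lia. }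
        { rewrite Eu'. lia. }
        apply Forall_app in Hw. destruct Hw as [Hw1 _].
        assert (dh v (v ∙ prod w1) <= M).
        { unfold dist at 1. rewrite mul_Vl_r. pose proof (len_le U HU w1 Hw1).
          rewrite length_app in Lw. unfold dist in Hvu. lia. }
        pose proof (dist_tri U HU v (v ∙ prod w1) x0) as H1. rewrite (dist_sym U HU (v ∙ prod w1)) in H1.
        rewrite Z2Nat.id in Hd by lia. lia. }
    assert (Hmid : forall m1 m2, (m1 <= m2 <= length gam)%nat -> dh (gp m1) (gp m2) <= 6 * M ->
      d x0 (gp m1) + d x0 (gp m2) <= d (gp m1) (gp m2) + 2 * (2 * del) -> M <= 4 * del + 2 * k * del + Kc).
    { intros m1 m2 Hm Hd6 Hgp'. destruct (Ggam m1 m2 Hm) as [u [Hu [Lu [Eu [Du Pu]]]]].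
      rewrite Hgp in Hd6 by auto. change (gp m2 = gp m1 ∙ prod u) in Eu.
      destruct (near_path (Z.to_nat k) u (gp m1) x0 (2 * del)) as [w1 [w2 [Ew Hd]]]; auto; try lia.
      { rewrite <- Eu. exact Hgp'. }
      destruct (Pu w1 w2 Ew) as [m [Hm' Em]]. pose proof (Hvert m Hm') as H1.
      change (gp m1 ∙ prod w1 = gp m) in Em. rewrite <- Em in H1. rewrite Z2Nat.id in Hd by lia. lia. }
    assert (Hpq : dh p q <= 6 * M).
    { pose proof (dist_tri U HU p y q). pose proof (dist_tri U HU y x0 q). pose proof (dist_tri U HU x0 z q).
      symd HU (y, p, x0, z, q). lia. }
    pose proof (Hyp x0 y p z) as H1. pose proof (Hyp x0 p q z) as H2.
    destruct (Z_le_dec (d x0 y + d x0 p) (d y p + 2 * (2 * del))) as [K|K].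
    { apply (Hside y p); auto. now exists mp. }
    destruct (Z_le_dec (d x0 z + d x0 q) (d z q + 2 * (2 * del))) as [K'|K'].
    { apply (Hside z q); auto. now exists mq. }
    assert (K2 : d x0 p + d x0 q <= d p q + 2 * (2 * del)).
    { clear - H1 H2 K K' Hyz HT Hdel. symd HT (x0, y, p, q, z). lia. }
    subst p q. destruct (le_lt_dec mp mq) as [Hm|Hm].
    - apply (Hmid mp mq); auto.
    - apply (Hmid mq mp); [lia| |].
      + now rewrite (dist_sym U HU).
      + rewrite (dist_sym T HT (gp mq)). lia. }
  assert (Ex : xp (length s1) = x).
  { unfold xp, s. rewrite firstn_app, Nat.sub_diag, firstn_all. cbn. rewrite app_nil_r, Es1. grp. }
  assert (Hl : (length s1 <= length s)%nat) by (unfold s; rewrite length_app; lia).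
  pose proof (Hmax' _ Hl) as H1. rewrite Ex in H1. destruct (Hn x) as [H2 _].
  pose proof (Hgp O (ng x) ltac:(lia)) as H3. pose proof (Hgp (ng x) (length gam) ltac:(lia)) as H4.
  rewrite gp0 in H3. rewrite gpn in H4. pose proof (Hgp O (length gam) ltac:(lia)) as H5. rewrite gp0, gpn in H5.
  pose proof (dist_tri U HU a (gp (ng x)) x). pose proof (dist_tri U HU x (gp (ng x)) b).
  symd HU (x, gp (ng x)). lia.
Qed.

(** The point m at the Gromov product on [a, c] is a coarse centre of the triangle a, o, c, and the
    four-point condition puts it close to [a, b] or [c, b] too. Being close to old geodesics it is
    close to new ones; adding distances through m gives the inequality. *)
Lemma coned_hyperbolic : exists delh, 0 <= delh /\ hyp U delh.
Proof.
  destruct between_near_geodesic as [D0 [HD0 HB]].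
  assert (HB' : forall kap a b m, 0 <= kap -> d a m + d m b <= d a b + kap ->
     dh a m + dh m b <= dh a b + 2 * D0 + 2 * (kap + 2 * del)).
  { intros kap a b m Hkap Hm. pose proof (dist_nonneg T a m). pose proof (dist_nonneg T a b).
    pose proof (dist_nonneg T m b).
    destruct (dist_split T HT a b (Z.min (d a m) (d a b))) as [m' [E1 E2]]; [lia|].
    pose proof (HB a b m' ltac:(lia)) as H3. pose proof (Hyp a m b m') as H4.
    pose proof (coned_dist_le m m'). pose proof (dist_tri U HU a m' m). pose proof (dist_tri U HU m m' b).
    symd HT (a, m, m', b). symd HU (a, m, m', b). lia. }
  exists (4 * D0 + 20 * (2 * del + 1)). split; [lia|].
  intros a o c b.
  set (t := (d a o + d a c - d o c) / 2).
  assert (Ht : d a o + d a c - d o c - 1 <= 2 * t <= d a o + d a c - d o c).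
  { unfold t. pose proof (Z.div_mod (d a o + d a c - d o c) 2 ltac:(lia)).
    pose proof (Z.mod_pos_bound (d a o + d a c - d o c) 2 ltac:(lia)). lia. }
  pose proof (dist_tri T HT o a c). pose proof (dist_tri T HT a o c). pose proof (dist_tri T HT a c o).
  pose proof (dist_sym T HT a o). pose proof (dist_sym T HT c o).
  destruct (dist_split T HT a c t) as [m [E1 E2]]; [lia|].
  pose proof (Hyp o a m c) as Q1.
  assert (K1 : d o m + d m a <= d o a + (2 * del + 1)).
  { clear - Q1 E1 E2 Ht HT Hdel. symd HT (a, o, c, m). lia. }
  assert (K2 : d o m + d m c <= d o c + (2 * del + 1)).
  { clear - Q1 E1 E2 Ht HT Hdel. symd HT (a, o, c, m). lia. }
  pose proof (HB' (2 * del + 1) o a m ltac:(lia) K1) as L1.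
  pose proof (HB' (2 * del + 1) o c m ltac:(lia) K2) as L2.
  pose proof (Hyp m a b c) as Q2.
  pose proof (dist_tri U HU a m c) as T1. pose proof (dist_tri U HU o m a). pose proof (dist_tri U HU o m c).
  destruct (Z_le_dec (d a m + d m b) (d a b + 2 * del)) as [K|K].
  - pose proof (HB' (2 * del) a b m ltac:(lia) K) as L3. pose proof (dist_tri U HU o m b) as T2.
    clear - L1 L2 L3 T1 T2 HU HD0 Hdel. symd HU (a, o, c, b, m). lia.
  - assert (K' : d c m + d m b <= d c b + 2 * del).
    { clear - Q2 K E1 E2 HT Hdel. symd HT (a, c, b, m). lia. }
    pose proof (HB' (2 * del) c b m ltac:(lia) K') as L3. pose proof (dist_tri U HU o m b) as T2.
    clear - L1 L2 L3 T1 T2 HU HD0 Hdel. symd HU (a, o, c, b, m). lia.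
Qed.

End Cone.

(** * Bounded projections along coned-off geodesics *)

Section Projection.
Context {G : Group} (T : G -> Prop) (HT : symgen T) (g : G).
Notation U := (coned T g).
Context (del : Z) (Hdel : (0 <= del)%Z) (Hyp : hyp U del).
Context (Hinj : forall k l, zpow g k = zpow g l -> k = l).
Context (B : Z) (p : G -> Z) (HB : (0 <= B)%Z) (pg : forall k, p (zpow g k) = k)
  (pT : forall x s, T s -> (Z.abs (p (x ∙ s) - p x) <= B)%Z)
  (pC : forall x k, (forall j, x <> zpow g j) -> (Z.abs (p (x ∙ zpow g k) - p x) <= B)%Z).
Local Open Scope Z_scope.
Notation dh := (dist U).
Let HU : symgen U := coned_symgen T HT g.

Definition on_line (x : G) : Prop := exists k, x = zpow g k.

(** Only an edge with both ends on <g> can change p by more than B: edges along other cosets are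
    covered by [pC]. *)
Lemma path_off_line w x : Forall U w ->
  (forall w1 t w2, w = w1 ++ t :: w2 -> ~ (on_line (x ∙ prod w1) /\ on_line (x ∙ prod w1 ∙ t))) ->
  Z.abs (p (x ∙ prod w) - p x) <= B * Z.of_nat (length w).
Proof.
  revert x. induction w as [|t w IH]; intros x Hw H.
  - cbn [prod length]. rewrite mul_1r. lia.
  - inversion Hw as [|? ? Ht Hw']; subst.
    cbn [prod]. rewrite mul_assoc. specialize (IH (x ∙ t) Hw').
    assert (H1 : Z.abs (p (x ∙ t) - p x) <= B).
    { destruct Ht as [Ht|[k ->]]; [auto|]. apply pC. intros j ->.
      apply (H [] (zpow g k) w); auto. cbn. rewrite mul_1r. split; [now exists j|].
      exists (j + k). now rewrite zpow_add. }
    assert (H2 : Z.abs (p (x ∙ t ∙ prod w) - p (x ∙ t)) <= B * Z.of_nat (length w)).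
    { apply IH. intros w1 t' w2 -> K. apply (H (t :: w1) t' w2); auto. cbn [prod].
      now rewrite !mul_assoc. }
    cbn [length]. lia.
Qed.

Definition is_near (b : G) (k : Z) : Prop := forall j, dh b (zpow g k) <= dh b (zpow g j).

Definition gap (b : G) : Z := dh b (zpow g (epsilon (inhabits 0) (is_near b))).

Lemma gap_near b : is_near b (epsilon (inhabits 0) (is_near b)).
Proof.
  apply epsilon_spec. destruct (exists_argmin 0 (fun _ => True) (fun k => dh b (zpow g k))) as [k [_ H]]; auto.
  { intros; apply dist_nonneg. }
  exists k. intros j. auto.
Qed.

Lemma gap_le b k : gap b <= dh b (zpow g k).
Proof. apply gap_near. Qed.

Lemma gap_ex b : exists k, dh b (zpow g k) = gap b.
Proof. now eexists. Qed.

Lemma is_near_iff b k : is_near b k <-> dh b (zpow g k) = gap b.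
Proof.
  split; intros H.
  - pose proof (gap_le b k). destruct (gap_ex b) as [j Hj]. specialize (H j). lia.
  - intros j. rewrite H. apply gap_le.
Qed.

Lemma gap_nonneg b : 0 <= gap b.
Proof. apply dist_nonneg. Qed.

Lemma dist_line_le i j : dh (zpow g i) (zpow g j) <= 1.
Proof.
  unfold dist. apply (len_gen U HU). right. exists (- i + j). now rewrite zpow_opp, zpow_add.
Qed.

Lemma dist_via_line a b : dh a b <= gap a + 1 + gap b.
Proof.
  destruct (gap_ex a) as [i Hi], (gap_ex b) as [j Hj].
  pose proof (dist_tri U HU a (zpow g i) b). pose proof (dist_tri U HU (zpow g i) (zpow g j) b).
  pose proof (dist_line_le i j). rewrite (dist_sym U HU (zpow g j)) in *. lia.
Qed.

Lemma near_proj a k : is_near a k -> Z.abs (p a - k) <= B * gap a.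
Proof.
  intros Hk. apply is_near_iff in Hk.
  destruct (len_word U HU (a⁻¹ ∙ zpow g k)) as [w [Hw [Lw Ew]]].
  change (Z.of_nat (length w) = dh a (zpow g k)) in Lw.
  assert (Ek : a ∙ prod w = zpow g k) by (rewrite Ew; grp).
  rewrite <- (pg k) at 1. rewrite <- Ek, <- Hk, <- Lw.
  rewrite <- Z.abs_opp. replace (- (p a - p (a ∙ prod w))) with (p (a ∙ prod w) - p a) by lia.
  apply path_off_line; auto.
  intros w1 t w2 E [[j Hj] _]. subst w. apply Forall_app in Hw. destruct Hw as [Hw1 _].
  pose proof (gap_le a j) as H1. rewrite <- Hj in H1. unfold dist in H1 at 1. rewrite mul_Vl_r in H1.
  pose proof (len_le U HU w1 Hw1). rewrite length_app in Lw. cbn [length] in Lw. lia.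
Qed.

Lemma short_path_proj a b : dh a b < gap a -> Z.abs (p b - p a) <= B * dh a b.
Proof.
  intros H. destruct (len_word U HU (a⁻¹ ∙ b)) as [w [Hw [Lw Ew]]].
  change (Z.of_nat (length w) = dh a b) in Lw.
  assert (Ek : a ∙ prod w = b) by (rewrite Ew; grp).
  rewrite <- Ek at 1. rewrite <- Lw. apply path_off_line; auto.
  intros w1 t w2 E [[j Hj] _]. subst w. apply Forall_app in Hw. destruct Hw as [Hw1 _].
  pose proof (gap_le a j) as H1. rewrite <- Hj in H1. unfold dist in H1 at 1. rewrite mul_Vl_r in H1.
  pose proof (len_le U HU w1 Hw1). rewrite length_app in Lw. cbn [length] in Lw. lia.
Qed.

Let t0 := 20 * del + 20.
(** The height t0 exceeds the thinness errors, so short detours at that height stay off <g>. The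
    bound is B times t0 for each descent from a cut point, plus 2 t0 + 8 del + 10 for the path
    between the cut points, rounded up. *)
Definition angle_bound : Z := B * (4 * t0 + 8 * del + 20).

Lemma cut_near_line a k : is_near a k -> exists a0,
  dh a a0 + dh a0 (zpow g k) = gap a /\ dh a0 (zpow g k) <= t0 /\ (dh a0 (zpow g k) = t0 \/ a0 = a) /\
  is_near a0 k /\ gap a0 = dh a0 (zpow g k).
Proof.
  intros Hk. pose proof Hk as Hk'. apply is_near_iff in Hk'. pose proof (gap_nonneg a).
  destruct (Z_le_dec (gap a) t0) as [K|K].
  - exists a. rewrite (dist_refl U HU). repeat split; auto; lia.
  - destruct (dist_split U HU a (zpow g k) (gap a - t0)) as [a0 [E1 E2]]; [unfold t0 in *; lia|].
    exists a0. assert (is_near a0 k).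
    { intros j. pose proof (Hk j). pose proof (dist_tri U HU a a0 (zpow g j)). lia. }
    repeat split; auto; try lia. apply is_near_iff in H0. lia.
Qed.

(* Away from the coset a geodesic cannot change the projection much; near the coset it is
   replaced by a detour of bounded length at distance about t0 from the coset. *)
Lemma angle_bound_spec a b k l : is_near a k -> is_near b l ->
  dh a b <= gap a + gap b -> Z.abs (k - l) <= angle_bound.
Proof.
  intros Hk Hl Hab.
  destruct (cut_near_line a k Hk) as [a0 [A1 [A2 [A3 [A4 A5]]]]].
  destruct (cut_near_line b l Hl) as [b0 [B1 [B2 [B3 [B4 B5]]]]].
  pose proof (near_proj a0 k A4) as PA0. pose proof (near_proj b0 l B4) as PB0.
  rewrite A5 in PA0. rewrite B5 in PB0.
  set (u := zpow g k) in *. set (v := zpow g l) in *.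
  pose proof (dist_line_le k l) as Huv. fold u v in Huv.
  assert (Ea : dh a u = gap a) by (apply is_near_iff; auto).
  assert (Eb : dh b v = gap b) by (apply is_near_iff; auto).
  assert (Hbu : gap b <= dh b u) by apply gap_le.
  assert (Hav : gap a <= dh a v) by apply gap_le.
  pose proof (dist_nonneg U a0 u). pose proof (dist_nonneg U b0 v).
  assert (HX : Z.abs (p a0 - p b0) <= B * (2 * t0 + 8 * del + 10)).
  2:{ unfold angle_bound. nia. }
  destruct (Z_le_dec (2 * t0) (dh a u + dh u b - dh a b)) as [K|K].
  - assert (Ha0u : dh a0 u = t0).
    { destruct A3 as [A3|A3]; auto. rewrite A3 in A2 |- *. pose proof (dist_tri U HU u a b).
      symd HU (a, u, b). lia. }
    assert (Hb0v : dh b0 v = t0 \/ dh b0 v = gap b).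
    { destruct B3 as [B3|B3]; auto. right. now rewrite B3. }
    assert (Hd : dh a0 b0 <= 4 * del + 5).
    { pose proof (dist_tri U HU a u b). pose proof (dist_tri U HU u a b). pose proof (dist_tri U HU u b a).
      pose proof (dist_tri U HU b v u). pose proof (dist_tri U HU b0 v u). pose proof (dist_tri U HU b0 u v).
      pose proof (dist_tri U HU b b0 u). pose proof (dist_tri U HU b b0 v).
      pose proof (Hyp u a0 a b) as Q1. pose proof (Hyp u a0 b b0) as Q2.
      pose proof (dist_nonneg U a a0). pose proof (dist_nonneg U b b0).
      symd HU (u, v, a, b, a0, b0). unfold t0 in *. lia. }
    pose proof (short_path_proj a0 b0) as Q. pose proof (dist_nonneg U a0 b0).
    rewrite A5 in Q. unfold t0 in *. specialize (Q ltac:(lia)). nia.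
  - destruct (len_word U HU (a⁻¹ ∙ b)) as [w [Hw [Lw Ew]]].
    change (Z.of_nat (length w) = dh a b) in Lw.
    assert (Ek : a ∙ prod w = b) by (rewrite Ew; grp).
    assert (Lw' : Z.of_nat (length w) = dh a (a ∙ prod w)) by (rewrite Ek; auto).
    pose proof (geodesic_subword U HU w a Hw Lw') as Gw.
    set (q := fun i => a ∙ prod (firstn i w)) in *.
    assert (q0 : q O = a) by (unfold q; cbn; apply mul_1r).
    assert (qn : q (length w) = b) by (unfold q; rewrite firstn_all; auto).
    assert (Hq : forall i, (i <= length w)%nat -> dh a (q i) = Z.of_nat i /\ dh (q i) b = dh a b - Z.of_nat i).
    { intros i Hi. destruct (Gw O i ltac:(lia)) as [_ [_ [_ [_ [K1 _]]]]].
      destruct (Gw i (length w) ltac:(lia)) as [_ [_ [_ [_ [K2 _]]]]].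
      fold (q O) (q i) in K1. fold (q i) (q (length w)) in K2.
      change (dh (q O) (q i) = Z.of_nat (i - 0)) in K1. change (dh (q i) (q (length w)) = Z.of_nat (length w - i)) in K2.
      rewrite q0 in K1. rewrite qn in K2. lia. }
    (* An edge of the geodesic with both ends on <g> would force dh a b >= gap a + 1 + gap b. *)
    assert (Hpq : forall i j, (i <= j <= length w)%nat -> Z.abs (p (q j) - p (q i)) <= B * (Z.of_nat j - Z.of_nat i)).
    { intros i j Hij. destruct (Gw i j Hij) as [x [Hx [Lx [Ex [_ Px]]]]].
      change (q j = q i ∙ prod x) in Ex. rewrite Ex.
      replace (Z.of_nat j - Z.of_nat i) with (Z.of_nat (length x)) by lia.
      apply path_off_line; auto. intros w1 t w2 E [[r Hr] [s Hs]].
      destruct (Px w1 (t :: w2) E) as [m [Hm Em]]. change (q i ∙ prod w1 = q m) in Em.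
      assert (Hm' : exists m', (m' <= length w)%nat /\ q i ∙ prod w1 ∙ t = q m').
      { destruct (Px (w1 ++ [t]) w2) as [m' [Hm' Em']]; [rewrite <- app_assoc; auto|].
        exists m'. split; auto. change (q i ∙ prod (w1 ++ [t]) = q m') in Em'. rewrite <- Em'.
          rewrite prod_app. cbn. now rewrite mul_1r, mul_assoc. }
      destruct Hm' as [m' [Hm' Em']]. rewrite Em' in Hs. rewrite Em in Hr.
      destruct (Hq m Hm) as [R1 R2]. destruct (Hq m' Hm') as [R1' R2'].
      pose proof (gap_le a r) as W1. pose proof (gap_le b s) as W2.
      pose proof (gap_le b r) as W3. pose proof (gap_le a s) as W4.
      rewrite <- Hr in W1, W3. rewrite <- Hs in W2, W4.
      rewrite (dist_sym U HU b) in W2, W3.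
      assert (Hmm : q m <> q m' -> m <> m') by congruence.
      assert (q m <> q m').
      { intros Heq. assert (Ht : t = one).
        { rewrite <- Em, <- Em' in Heq. rewrite <- (mul_1r _ (q i ∙ prod w1)) in Heq at 1.
          now apply mul_cancel_l in Heq. }
        subst t. assert (Lx1 : len U (prod x) <= Z.of_nat (length (w1 ++ w2))).
        { rewrite E, prod_app. cbn [prod]. rewrite mul_1l, <- prod_app. apply (len_le U HU).
          rewrite E in Hx. apply Forall_app in Hx. destruct Hx as [X1 X2]. apply Forall_cons_iff in X2. destruct X2 as [_ X2].
          now apply Forall_app. }
        destruct (Gw i j Hij) as [_ [_ [_ [_ [Dx _]]]]]. change (dh (q i) (q j) = Z.of_nat (j - i)) in Dx.
        rewrite Ex in Dx. unfold dist in Dx. rewrite mul_Vl_r in Dx.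
        rewrite E, length_app in Lx. rewrite length_app in Lx1. cbn [length] in Lx, Lx1. lia. }
      specialize (Hmm H1). lia. }
    assert (Xa : exists i, (i <= length w)%nat /\ Z.of_nat i = dh a a0 /\ Z.abs (p (q i) - p a0) <= B * (4 * del)).
    { destruct A3 as [A3|A3].
      - assert (Ha0 : dh a a0 <= dh a b).
        { pose proof (dist_tri U HU u b a) as Q. symd HU (a, u, b, a0). lia. }
        pose proof (dist_nonneg U a a0).
        exists (Z.to_nat (dh a a0)). split; [lia|]. split; [lia|].
        destruct (Hq (Z.to_nat (dh a a0))) as [R1 R2]; [lia|]. rewrite Z2Nat.id in R1, R2 by lia.
        set (a1 := q (Z.to_nat (dh a a0))) in *.
        assert (Hd : dh a0 a1 <= 4 * del).
        { pose proof (Hyp a a0 u b) as Q1. pose proof (Hyp a a0 b a1) as Q2.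
          clear - Q1 Q2 R1 R2 K A1 A3 Ea HU Hdel. symd HU (a, u, b, a0, a1). lia. }
        pose proof (short_path_proj a0 a1) as Q. pose proof (dist_nonneg U a0 a1).
        rewrite A5 in Q. unfold t0 in *. specialize (Q ltac:(lia)). nia.
      - exists O. rewrite q0, A3, (dist_refl U HU). lia. }
    assert (Xb : exists i, (i <= length w)%nat /\ dh a b - Z.of_nat i = dh b b0 /\ Z.abs (p (q i) - p b0) <= B * (4 * del + 4)).
    { destruct B3 as [B3|B3].
      - assert (Hb0 : dh b b0 <= dh a b).
        { pose proof (dist_tri U HU u a b) as Q. pose proof (dist_tri U HU v u b) as Q'.
          pose proof (dist_tri U HU u v b) as Q''.
          assert (dh a u + dh u b - dh a b < 2 * t0) by lia.
          symd HU (a, u, v, b, b0). lia. }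
        pose proof (dist_nonneg U b b0).
        exists (Z.to_nat (dh a b - dh b b0)). split; [lia|]. split; [lia|].
        destruct (Hq (Z.to_nat (dh a b - dh b b0))) as [R1 R2]; [lia|]. rewrite Z2Nat.id in R1, R2 by lia.
        set (b1 := q (Z.to_nat (dh a b - dh b b0))) in *.
        assert (Hd : dh b0 b1 <= 4 * del + 4).
        { pose proof (Hyp b b0 v a) as Q1. pose proof (Hyp b b0 a b1) as Q2.
          pose proof (dist_tri U HU a u v). pose proof (dist_tri U HU a v u). pose proof (dist_tri U HU u v b).
          pose proof (dist_tri U HU v u b).
          symd HU (a, u, v, b, b0, b1). lia. }
        pose proof (short_path_proj b0 b1) as Q. pose proof (dist_nonneg U b0 b1).
        rewrite B5 in Q. unfold t0 in *. specialize (Q ltac:(lia)). nia.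
      - exists (length w). rewrite qn, B3, (dist_refl U HU). lia. }
    destruct Xa as [i [Hi [Ei Pi]]]. destruct Xb as [j [Hj [Ej Pj]]].
    pose proof (dist_tri U HU u v b) as Q.
    assert (Hij : Z.abs (Z.of_nat i - Z.of_nat j) <= 2 * t0 + 2).
    { pose proof (dist_nonneg U a a0). symd HU (a, u, v, b, b0, a0). lia. }
    destruct (le_lt_dec i j) as [L|L].
    + pose proof (Hpq i j ltac:(lia)) as R.
      assert (B * (Z.of_nat j - Z.of_nat i) <= B * (2 * t0 + 2)) by (apply Z.mul_le_mono_nonneg_l; lia).
      clear - HB R Pi Pj H1. clearbody t0. lia.
    + pose proof (Hpq j i ltac:(lia)) as R.
      assert (B * (Z.of_nat i - Z.of_nat j) <= B * (2 * t0 + 2)) by (apply Z.mul_le_mono_nonneg_l; lia).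
      clear - HB R Pi Pj H1. clearbody t0. lia.
Qed.

End Projection.

(** * Angles at the cosets of the cyclic subgroup *)

(* [e b] is the distance from b to the coset <g> in the coned-off metric and [c b] the least
   exponent k such that g^k realizes it. *)
Record cone_geom {G : Group} (T : G -> Prop) (g : G) (del D : Z) (e c : G -> Z) : Prop := {
  cg_gen : symgen T;
  cg_del : (0 <= del)%Z;
  cg_hyp : hyp (coned T g) del;
  cg_inj : forall k l, zpow g k = zpow g l -> k = l;
  cg_D : (0 <= D)%Z;
  cg_e_le : forall b k, (e b <= dist (coned T g) b (zpow g k))%Z;
  cg_c_near : forall b, dist (coned T g) b (zpow g (c b)) = e b;
  cg_c_min : forall b k, dist (coned T g) b (zpow g k) = e b -> (c b <= k)%Z;
  cg_angle : forall a b, (D < Z.abs (c b - c a) -> dist (coned T g) a b = e a + 1 + e b)%Z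
}.

(** * From the stated form of hyperbolicity to [cone_geom] *)

Section Bridge.
Context {G : Group} (S : list G).
Definition sym_list (x : G) : Prop := In x S \/ In x⁻¹ S.
Local Open Scope Z_scope.

Lemma sym_list_symgen : (forall x, exists n, word_len_le S x n) -> symgen sym_list.
Proof.
  intros H. split.
  - intros x [K|K]; [right; now rewrite inv_inv|now left].
  - intros x. destruct (H x) as [n [w [Hw [_ Ew]]]]. exists w. split; auto.
Qed.

Lemma wdist_iff : symgen sym_list -> forall x y n, wdist S x y n <-> Z.of_nat n = dist sym_list x y.
Proof.
  intros HT x y n. unfold wdist, dist.
  assert (H : forall z m, word_len_le S z m <-> len sym_list z <= Z.of_nat m).
  { intros z m. split.
    - intros [w [Hw [Lw <-]]]. rewrite <- prod_fold_right.
      pose proof (len_le sym_list HT w Hw). lia.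
    - intros Hm. destruct (len_word sym_list HT z) as [w [Hw [Lw Ew]]].
      exists w. split; [auto|split; [lia|now rewrite <- prod_fold_right]]. }
  set (z := x⁻¹ ∙ y). pose proof (len_nonneg sym_list z) as H0. split.
  - intros [H1 H2]. apply H in H1.
    assert (H3 : word_len_le S z (Z.to_nat (len sym_list z))) by (apply H; lia).
    apply H2 in H3. lia.
  - intros E. split; [apply H; lia|]. intros m Hm. apply H in Hm. lia.
Qed.

Lemma sym_list_finite x : sym_list x -> In x (S ++ map inv S).
Proof.
  intros [H|H]; apply in_or_app; [now left|right].
  apply in_map_iff. exists x⁻¹. split; auto. apply inv_inv.
Qed.
End Bridge.

Lemma hyperbolic_hyp {G : Group} : hyperbolic (G := G) ->
  exists S : list G, symgen (sym_list S) /\ exists del, (0 <= del)%Z /\ hyp (sym_list S) del.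
Proof.
  intros [S [HS [delta Hd]]]. exists S. pose proof (sym_list_symgen S HS) as HT. split; auto.
  exists (Z.of_nat delta). split; [lia|]. intros x y z w.
  assert (H : forall a b, exists n, wdist S a b n /\ Z.of_nat n = dist (sym_list S) a b).
  { intros a b. exists (Z.to_nat (dist (sym_list S) a b)).
    pose proof (dist_nonneg (sym_list S) a b). rewrite (wdist_iff S HT). lia. }
  destruct (H x y) as [a [Ha <-]], (H z w) as [b [Hb <-]], (H x z) as [c [Hc <-]],
    (H y w) as [d [Hd' <-]], (H x w) as [e [He <-]], (H y z) as [f [Hf <-]].
  specialize (Hd x y z w a b c d e f Ha Hb Hc Hd' He Hf). lia.
Qed.

Lemma cone_geom_ex {G : Group} (hG : hyperbolic (G := G)) (tf : torsion_free (G := G))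
  (g : G) (gnt : g <> one) (gnpp : ~ proper_power g) :
  exists S del D e c, cone_geom (sym_list S) g del D e c.
Proof.
  destruct (hyperbolic_hyp hG) as [S [HT [del [Hdel Hyp]]]]. set (T := sym_list S) in *.
  pose proof (sym_list_finite S) as HS. fold T in HS.
  destruct (line_projection_ex T HT _ HS del Hdel Hyp tf g gnt gnpp) as [B [p [HB [pg [pT pC]]]]].
  destruct (cyclic_subgroup_quasi_line T HT _ HS del Hdel Hyp tf g gnt) as [E [_ [_ [HE [_ [_ [HQ _]]]]]]].
  destruct (coned_hyperbolic T HT del Hdel Hyp g E HE HQ) as [delh [Hdelh Hyph]].
  assert (Hinj : forall k l, zpow g k = zpow g l -> k = l).
  { intros k l. now apply torsion_free_zpow_inj. }
  set (e := gap T g).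
  (* The nearest exponents are bounded below by [near_proj], so there is a least one; the shift
     makes the minimized value nonnegative. *)
  assert (Hc : forall b, exists k, dist (coned T g) b (zpow g k) = e b /\
     forall l, dist (coned T g) b (zpow g l) = e b -> (k <= l)%Z).
  { intros b. destruct (gap_ex T g b) as [k0 Hk0].
    destruct (exists_argmin k0 (fun k => dist (coned T g) b (zpow g k) = e b)
      (fun k => Z.max 0 (k - (p b - B * e b)))) as [k [Hk Hmin]]; auto; [lia|].
    exists k. split; auto. intros l Hl. specialize (Hmin l Hl).
    assert (Hn : is_near T g b l) by (now apply (is_near_iff T g)).
    assert (Hn' : is_near T g b k) by (now apply (is_near_iff T g)).
    apply (near_proj T HT g B p HB pg pT pC) in Hn. apply (near_proj T HT g B p HB pg pT pC) in Hn'.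
    fold e in Hn, Hn'. lia. }
  set (c := fun b => epsilon (inhabits 0%Z) (fun k => dist (coned T g) b (zpow g k) = e b /\
     forall l, dist (coned T g) b (zpow g l) = e b -> (k <= l)%Z)).
  assert (Hc' : forall b, dist (coned T g) b (zpow g (c b)) = e b /\
     forall l, dist (coned T g) b (zpow g l) = e b -> (c b <= l)%Z).
  { intros b. exact (epsilon_spec (inhabits 0%Z) _ (Hc b)). }
  exists S, delh, (angle_bound delh B), e, c. constructor; auto.
  - unfold angle_bound. nia.
  - intros b k. apply (gap_le T g).
  - intros b. apply Hc'.
  - intros b. apply Hc'.
  - intros a b H. pose proof (dist_via_line T HT g a b) as H1.
    change (dist (coned T g) a b = gap T g a + 1 + gap T g b)%Z.
    destruct (Z_le_dec (dist (coned T g) a b) (gap T g a + gap T g b)) as [K|K].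
    2: { clear - H1 K. lia. }
    exfalso.
    pose proof (angle_bound_spec T HT g delh Hdelh Hyph B p HB pg pT pC a b (c a) (c b)
      ltac:(apply (is_near_iff T g), Hc') ltac:(apply (is_near_iff T g), Hc') K) as H2.
    clearbody c. lia.
Qed.

Section Angles.
Context {G : Group} {T : G -> Prop} {g : G} {del D : Z} {e c : G -> Z}
  (CG : cone_geom T g del D e c).
Local Open Scope Z_scope.
Notation dh := (dist (coned T g)).
(** One D to apply [angle_dist], another to move an end point within its coset ([ang_same_pt]). *)
Notation theta := (2 * D).
Let HU : symgen (coned T g) := coned_symgen T (cg_gen _ _ _ _ _ _ CG) g.

(* The displacement, counted in powers of g, from the point of y<g> nearest to a to the one nearest to b. *)
Definition angle (y a b : G) : Z := c (y⁻¹ ∙ b) - c (y⁻¹ ∙ a).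
Definition coset_gap (y a : G) : Z := e (y⁻¹ ∙ a).
Notation ang := angle.
Notation gapy := coset_gap.
Definition same (y z : G) : Prop := exists k, z = y ∙ zpow g k.

Lemma same_refl y : same y y.
Proof. exists 0. grp. Qed.

Lemma same_sym y z : same y z -> same z y.
Proof. intros [k ->]. exists (- k). grpz. Qed.

Lemma same_trans x y z : same x y -> same y z -> same x z.
Proof. intros [k ->] [l ->]. exists (k + l). grpz. Qed.

Lemma same_left h y z : same (h ∙ y) (h ∙ z) <-> same y z.
Proof.
  split; intros [k E]; exists k.
  - rewrite mulA_r in E. now apply mul_cancel_l in E.
  - now rewrite E, mulA_r.
Qed.

Lemma same_zpow y k : same y (y ∙ zpow g k).
Proof. now exists k. Qed.

Lemma e_shift k b : e (zpow g k ∙ b) = e b.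
Proof.
  assert (H : forall k b, e (zpow g k ∙ b) <= e b).
  { clear k b. intros k b. pose proof (cg_e_le _ _ _ _ _ _ CG (zpow g k ∙ b) (k + c b)) as H.
    rewrite zpow_add, dist_left in H. now rewrite (cg_c_near _ _ _ _ _ _ CG) in H. }
  pose proof (H k b). pose proof (H (- k) (zpow g k ∙ b)) as H1.
  rewrite mul_assoc, <- zpow_add in H1. replace (- k + k) with 0 in H1 by lia.
  rewrite zpow_0, mul_1l in H1. lia.
Qed.

Lemma c_shift k b : c (zpow g k ∙ b) = c b + k.
Proof.
  assert (H : forall k b, c (zpow g k ∙ b) <= c b + k).
  { clear k b. intros k b. apply (cg_c_min _ _ _ _ _ _ CG).
    rewrite e_shift, Z.add_comm, zpow_add, dist_left. apply (cg_c_near _ _ _ _ _ _ CG). }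
  pose proof (H k b). pose proof (H (- k) (zpow g k ∙ b)) as H1.
  rewrite mul_assoc, <- zpow_add in H1. replace (- k + k) with 0 in H1 by lia.
  rewrite zpow_0, mul_1l in H1. lia.
Qed.

Lemma e_nonneg b : 0 <= e b.
Proof. rewrite <- (cg_c_near _ _ _ _ _ _ CG). apply dist_nonneg. Qed.

Lemma c_zpow k : c (zpow g k) = k.
Proof.
  pose proof (cg_c_near _ _ _ _ _ _ CG (zpow g k)) as H.
  pose proof (cg_e_le _ _ _ _ _ _ CG (zpow g k) k) as H1. rewrite (dist_refl _ HU) in H1.
  pose proof (e_nonneg (zpow g k)).
  symmetry. apply (cg_inj _ _ _ _ _ _ CG), (dist_zero _ HU). lia.
Qed.

Lemma ang_left h y a b : ang (h ∙ y) (h ∙ a) (h ∙ b) = ang y a b.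
Proof. unfold ang. grp. Qed.

Lemma gapy_left h y a : gapy (h ∙ y) (h ∙ a) = gapy y a.
Proof. unfold gapy. grp. Qed.

Lemma ang_add y a b x : ang y a b + ang y b x = ang y a x.
Proof. unfold ang. lia. Qed.

Lemma ang_opp y a b : ang y a b = - ang y b a.
Proof. unfold ang. lia. Qed.

Lemma ang_refl y a : ang y a a = 0.
Proof. unfold ang. lia. Qed.

Lemma ang_same y z a b : same y z -> ang z a b = ang y a b.
Proof.
  intros [k ->]. unfold ang. rewrite inv_mul, !mulA_r, zpow_opp, !c_shift. lia.
Qed.

Lemma gapy_same y z a : same y z -> gapy z a = gapy y a.
Proof. intros [k ->]. unfold gapy. now rewrite inv_mul, !mulA_r, zpow_opp, e_shift. Qed.

Lemma gapy_nonneg y a : 0 <= gapy y a.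
Proof. apply e_nonneg. Qed.

Lemma gapy_le y a k : gapy y a <= dh a (y ∙ zpow g k).
Proof.
  unfold gapy. rewrite <- (dist_left _ y⁻¹ a), mul_Vl_r. apply (cg_e_le _ _ _ _ _ _ CG).
Qed.

Lemma gapy_le_same y a z : same y z -> gapy y a <= dh a z.
Proof. intros [k ->]. apply gapy_le. Qed.

Lemma gapy_ex y a : exists z, same y z /\ dh a z = gapy y a /\ z = y ∙ zpow g (c (y⁻¹ ∙ a)).
Proof.
  exists (y ∙ zpow g (c (y⁻¹ ∙ a))). split; [apply same_zpow|]. split; auto. unfold gapy.
  rewrite <- (dist_left _ y⁻¹ a), mul_Vl_r. apply (cg_c_near _ _ _ _ _ _ CG).
Qed.

Lemma gapy_zero y a : gapy y a = 0 <-> same y a.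
Proof.
  split.
  - intros H. destruct (gapy_ex y a) as [z [Hz [E _]]]. rewrite H in E.
    apply (dist_zero _ HU) in E. now subst.
  - intros H. pose proof (gapy_le_same y a a H) as H1. rewrite (dist_refl _ HU) in H1.
    pose proof (gapy_nonneg y a). lia.
Qed.

Lemma gapy_pos y a : ~ same y a -> 1 <= gapy y a.
Proof. intros H. rewrite <- gapy_zero in H. pose proof (gapy_nonneg y a). lia. Qed.

Lemma gapy_lip y a b : gapy y a <= dh a b + gapy y b.
Proof.
  destruct (gapy_ex y b) as [z [Hz [E _]]]. pose proof (gapy_le_same y a z Hz).
  pose proof (dist_tri _ HU a b z). lia.
Qed.

Lemma dist_same_le y z : same y z -> dh y z <= 1.
Proof. intros [k ->]. apply (dist_gen _ HU). right. now exists k. Qed.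

Lemma dist_via y a b : dh a b <= gapy y a + 1 + gapy y b.
Proof.
  destruct (gapy_ex y a) as [u [Hu [Eu _]]], (gapy_ex y b) as [v [Hv [Ev _]]].
  pose proof (dist_same_le u v ltac:(eapply same_trans; [apply same_sym|]; eauto)).
  pose proof (dist_tri _ HU a u b). pose proof (dist_tri _ HU u v b).
  rewrite (dist_sym _ HU v b) in *. lia.
Qed.

Lemma angle_dist y a b : D < Z.abs (ang y a b) -> dh a b = gapy y a + 1 + gapy y b.
Proof.
  intros H. unfold gapy. rewrite <- (dist_left _ y⁻¹ a b). apply (cg_angle _ _ _ _ _ _ CG). exact H.
Qed.

Lemma ang_coset y x k : ~ same y x -> Z.abs (ang y x (x ∙ zpow g k)) <= D.
Proof.
  intros H. apply Z.le_ngt. intros K. apply angle_dist in K.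
  pose proof (gapy_pos y x H). pose proof (dist_same_le x (x ∙ zpow g k) (same_zpow _ _)).
  pose proof (gapy_nonneg y (x ∙ zpow g k)). lia.
Qed.

Lemma ang_same_pt y x z a : ~ same y x -> same x z -> Z.abs (ang y a z - ang y a x) <= D.
Proof.
  intros H [k ->]. pose proof (ang_coset y x k H). pose proof (ang_add y a x (x ∙ zpow g k)). lia.
Qed.

(** A large angle at y<g> puts that coset on the way from a to every point of z<g>, at the cost of
    one edge along y<g> and at least one more to leave it. *)
Lemma angle_order y z a : ~ same y z -> theta < Z.abs (ang y a z) -> gapy y a + 2 <= gapy z a.
Proof.
  intros H K. destruct (gapy_ex z a) as [z' [Hz' [E _]]].
  pose proof (ang_same_pt y z z' a H Hz').
  pose proof (cg_D _ _ _ _ _ _ CG).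
  rewrite (angle_dist y a z') in E by lia.
  assert (~ same y z') by (intros H2; apply H; eapply same_trans; [eauto|now apply same_sym]).
  pose proof (gapy_pos y z' H2). lia.
Qed.

(** If both angles were large, each coset would be strictly closer to s than the other. The factor
    g^k allows for a point of z<g> displaced by a rotation. *)
Lemma behrstock y z s k : ~ same y z -> theta < Z.abs (ang z s y) -> Z.abs (ang y s (z ∙ zpow g k)) <= theta.
Proof.
  intros H K. apply Z.le_ngt. intros N.
  assert (H' : ~ same z y) by (intros X; apply H; now apply same_sym).
  pose proof (angle_order z y s H' K).
  assert (H2 : ~ same y (z ∙ zpow g k)).
  { intros X. apply H. eapply same_trans; [exact X|]. apply same_sym, same_zpow. }
  pose proof (angle_order y (z ∙ zpow g k) s H2 N) as H3.
  rewrite (gapy_same z (z ∙ zpow g k)) in H3 by apply same_zpow. lia.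
Qed.

Lemma behrstock0 y z s : ~ same y z -> theta < Z.abs (ang z s y) -> Z.abs (ang y s z) <= theta.
Proof. intros H K. pose proof (behrstock y z s 0 H K) as R. now rewrite zpow_0, mul_1r in R. Qed.

(* When z separates both b and b' from the coset of y, the nearest points of that coset to b and
   to b' are the ones nearest to z, so the coordinates agree exactly. *)
Lemma coordinate_exact z y b b' : ~ same z y -> theta < Z.abs (ang z y b) -> theta < Z.abs (ang z y b') ->
  c (y⁻¹ ∙ b) = c (y⁻¹ ∙ b').
Proof.
  intros H.
  destruct (exists_argmin 0 (fun _ => True) (fun k => gapy z (y ∙ zpow g k))) as [k0 [_ Hk0]]; auto.
  { intros; apply gapy_nonneg. }
  assert (Hnear : forall x, theta < Z.abs (ang z y x) -> forall k,
     dh x (y ∙ zpow g k) = gapy y x <-> gapy z (y ∙ zpow g k) = gapy z (y ∙ zpow g k0)).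
  { intros x Hx.
    assert (Hk : forall k, dh x (y ∙ zpow g k) = gapy z x + 1 + gapy z (y ∙ zpow g k)).
    { intros k. apply angle_dist. pose proof (ang_coset z y k H).
      pose proof (ang_add z y (y ∙ zpow g k) x). rewrite ang_opp. pose proof (cg_D _ _ _ _ _ _ CG). lia. }
    assert (Hg : gapy y x = gapy z x + 1 + gapy z (y ∙ zpow g k0)).
    { pose proof (gapy_le y x k0) as H1. rewrite Hk in H1.
      destruct (gapy_ex y x) as [z' [_ [E Ez]]]. rewrite Ez, Hk in E.
      specialize (Hk0 (c (y⁻¹ ∙ x)) I). lia. }
    intros k. rewrite Hk, Hg. lia. }
  assert (Hle : forall x x', theta < Z.abs (ang z y x) -> theta < Z.abs (ang z y x') ->
     c (y⁻¹ ∙ x) <= c (y⁻¹ ∙ x')).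
  { intros x x' Hx Hx'. apply (cg_c_min _ _ _ _ _ _ CG).
    destruct (gapy_ex y x') as [z' [_ [E Ez]]]. rewrite Ez in E.
    apply (Hnear x' Hx'), (Hnear x Hx) in E. unfold gapy in E. rewrite <- E.
    rewrite <- (dist_left _ y). now rewrite mul_Vr_r. }
  intros Hb Hb'. pose proof (Hle b b' Hb Hb'). pose proof (Hle b' b Hb' Hb). lia.
Qed.

Definition rotation (y : G) (m : Z) : G := y ∙ zpow g m ∙ y⁻¹.
Notation rot := rotation.

Lemma ang_rot y m a b : ang y a (rot y m ∙ b) = ang y a b + m.
Proof.
  unfold ang, rot. replace (y⁻¹ ∙ (y ∙ zpow g m ∙ y⁻¹ ∙ b)) with (zpow g m ∙ (y⁻¹ ∙ b)) by grp.
  rewrite c_shift. lia.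
Qed.

Lemma gapy_rot y m b : gapy y (rot y m ∙ b) = gapy y b.
Proof.
  unfold gapy, rot. replace (y⁻¹ ∙ (y ∙ zpow g m ∙ y⁻¹ ∙ b)) with (zpow g m ∙ (y⁻¹ ∙ b)) by grp.
  apply e_shift.
Qed.

Lemma rot_same y z m : same y z -> rot z m = rot y m.
Proof. intros [k ->]. unfold rot. grpz. Qed.

Lemma rot_conj h y m : rot (h ∙ y) m = h ∙ rot y m ∙ h⁻¹.
Proof. unfold rot. grp. Qed.

Lemma rot_add y m m' : rot y (m + m') = rot y m ∙ rot y m'.
Proof. unfold rot. rewrite zpow_add. grp. Qed.

Lemma rot_0 y : rot y 0 = one.
Proof. unfold rot. grp. Qed.

Lemma rot_opp y m : (rot y m)⁻¹ = rot y (- m).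
Proof. unfold rot. rewrite <- zpow_opp. grp. Qed.

Lemma rot_fix y m : same y (rot y m ∙ y).
Proof. exists m. unfold rot. grp. Qed.

End Angles.

(** * Products of rotations *)

Section RotationGroup.
Context {G : Group} {T : G -> Prop} {g : G} {del D : Z} {e c : G -> Z}
  (CG : cone_geom T g del D e c).
Local Open Scope Z_scope.
Notation dh := (dist (coned T g)).
Notation theta := (2 * D).
Notation ang := (angle (c := c)).
Notation gapy := (coset_gap (e := e)).
Notation same := (same (g := g)).
Notation rot := (rotation (g := g)).
Let HU : symgen (coned T g) := coned_symgen T (cg_gen _ _ _ _ _ _ CG) g.
Let D0 : 0 <= D := cg_D _ _ _ _ _ _ CG.
Let del0 : 0 <= del := cg_del _ _ _ _ _ _ CG.

(** D for the levels below R - (2 del + 1), then 4 theta = 8 D for each of the 2 del + 1 remaining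
    ones; see [orbit_thin_step]. *)
Definition orbit_bound (del D : Z) : Z := D + 8 * D * (2 * del + 1).
Notation th0 := (orbit_bound del D).
(** One th0 for the factor before the first rotation, and th0 + 2 theta ([nform_angle]) for what
    follows it. *)
Definition turn_defect (del D : Z) : Z := 2 * orbit_bound del D + 4 * D.
Notation kap := (turn_defect del D).

Context (n : Z) (Hn : 100 * (orbit_bound del D + D + 1) <= n).
(* [wt] counts rotations about the cosets of a fixed family; it makes exponent sums available. *)
Context (wt : G -> Z) (wt_same : forall y z, same y z -> wt z = wt y)
  (wt_rot : forall y z k, wt (rot z (k * n) ∙ y) = wt y).

Lemma th0_ge : D <= th0.
Proof. unfold orbit_bound. nia. Qed.

Lemma turn_ge j : j <> 0 -> n <= Z.abs (j * n).
Proof.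
  intros Hj. pose proof th0_ge. rewrite Z.abs_mul, (Z.abs_eq n) by lia.
  pose proof (Z.mul_le_mono_nonneg_r 1 (Z.abs j) n ltac:(lia) ltac:(lia)). lia.
Qed.

(* [below R h k]: h is a product of rotations by n or -n about cosets at distance less than R from
   the identity, of total weight k. *)
Inductive below (R : Z) : G -> Z -> Prop :=
| below_one : below R one 0
| below_step y eps h k : gapy y one < R -> (eps = 1 \/ eps = -1) -> below R h k ->
    below R (rot y (eps * n) ∙ h) (eps * wt y + k).

Lemma below_gen R y eps : gapy y one < R -> (eps = 1 \/ eps = -1) -> below R (rot y (eps * n)) (eps * wt y).
Proof.
  intros Hy He. rewrite <- (mul_1r _ (rot y (eps * n))), <- (Z.add_0_r (eps * wt y)).
  apply below_step; auto. constructor.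
Qed.

Lemma below_mul R h k h' k' : below R h k -> below R h' k' -> below R (h ∙ h') (k + k').
Proof.
  intros H H'. induction H as [|y eps h k Hy He H IH].
  - rewrite mul_1l. exact H'.
  - rewrite mulA_r, <- Z.add_assoc. now apply below_step.
Qed.

Lemma below_inv R h k : below R h k -> below R h⁻¹ (- k).
Proof.
  induction 1 as [|y eps h k Hy He H IH].
  - rewrite inv_one. constructor.
  - rewrite inv_mul. replace (- (eps * wt y + k)) with (- k + - eps * wt y) by lia.
    apply below_mul; auto. rewrite rot_opp. replace (- (eps * n)) with (- eps * n) by lia.
    apply below_gen; auto. lia.
Qed.

Lemma below_mono R R' h k : R <= R' -> below R h k -> below R' h k.
Proof. intros HR. induction 1; constructor; auto. lia. Qed.

Lemma below_nonpos R h k : R <= 0 -> below R h k -> h = one /\ k = 0.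
Proof.
  intros HR H. destruct H as [|y eps h k Hy]; auto. exfalso.
  pose proof (gapy_nonneg CG y one). lia.
Qed.

Lemma wt_below R h k y : below R h k -> wt (h ∙ y) = wt y.
Proof.
  induction 1 as [|z eps h k Hz He H IH]; [now rewrite mul_1l|]. now rewrite mulA_r, wt_rot.
Qed.

Definition far (R L : Z) (y : G) : Prop := forall m k, below R m k -> L <= gapy (m ∙ y) one.

Lemma far_level R L y : far R L y -> L <= gapy y one.
Proof. intros H. rewrite <- (mul_1l _ y). exact (H one 0 (below_one R)). Qed.

Lemma far_mul R L y m k : far R L y -> below R m k -> far R L (m ∙ y).
Proof. intros H Hm m' k' Hm'. rewrite mul_assoc. eapply H. eapply below_mul; eauto. Qed.

Lemma far_not_same R L x y : far R L y -> gapy x one < L -> ~ same y x.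
Proof.
  intros H Hx K. apply far_level in H. rewrite (gapy_same CG y x) in Hx by auto. lia.
Qed.

Lemma level_angle x y : ~ same y x -> gapy x one <= gapy y one -> Z.abs (ang y one x) <= theta.
Proof.
  intros H K. apply Z.le_ngt. intros N. pose proof (angle_order CG y x one H N). lia.
Qed.

Lemma translated_level_angle m x y : ~ same y (m ∙ x) -> gapy x one <= gapy (m⁻¹ ∙ y) one ->
  Z.abs (ang y m (m ∙ x)) <= theta.
Proof.
  intros H K. rewrite <- (ang_left m⁻¹), mul_Vl, mul_Vl_r. apply level_angle; auto.
  intros X. apply H. apply (same_left m⁻¹). now rewrite mul_Vl_r.
Qed.

(* Normal forms m_0 r_1 m_1 r_2 ... of products of rotations at distance at most R: the r_i are
   rotations about cosets at distance exactly R; [o] is the last coset already passed, which the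
   next one must avoid. *)
Inductive nform (R : Z) : option G -> G -> Z -> nat -> Prop :=
| nform_base o h k : below R h k -> nform R o h k 0
| nform_cons o m k y j h' k' s : below R m k -> gapy y one = R -> far R R y -> j <> 0 ->
    match o with Some x => ~ same x (m ∙ y) | None => True end ->
    nform R (Some y) h' k' s ->
    nform R o (m ∙ rot y (j * n) ∙ h') (k + j * wt y + k') (Z.to_nat (Z.abs j) + s).

Lemma nform_weaken R o h k s : nform R o h k s -> nform R None h k s.
Proof. destruct 1; [now constructor|]. now constructor. Qed.

Lemma nform_left R m k h l s : below R m k -> nform R None h l s -> nform R None (m ∙ h) (k + l) s.
Proof.
  intros Hm H. inversion H as [? ? ? H1|? m' k' y j h' l' s' H1 H2 H3 H4 H5 H6]; subst.
  - constructor. now apply below_mul.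
  - replace (m ∙ (m' ∙ rot y (j * n) ∙ h')) with ((m ∙ m') ∙ rot y (j * n) ∙ h') by grp.
    replace (k + (k' + j * wt y + l')) with ((k + k') + j * wt y + l') by lia.
    constructor; auto. now apply below_mul.
Qed.

(** The new rotation merges with the first one of the form when their cosets agree, and disappears
    if the exponents cancel; this keeps consecutive cosets distinct. *)
Lemma nform_rot R y eps h k s : gapy y one = R -> far R R y -> (eps = 1 \/ eps = -1) ->
  nform R None h k s -> exists s', nform R None (rot y (eps * n) ∙ h) (eps * wt y + k) s'.
Proof.
  intros Hy Hf He H. pose proof H as H0.
  inversion H as [? ? ? H1|? m' k' y' j h' l' s' H1 H2 H3 H4 H5 H6]; subst o h k s.
  - eexists. replace (rot y (eps * n) ∙ h0) with (one ∙ rot y (eps * n) ∙ h0) by grp.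
    replace (eps * wt y + k0) with (0 + eps * wt y + k0) by lia.
    eapply nform_cons; eauto; [constructor|lia|now apply nform_base].
  - destruct (classic (same (m' ∙ y') y)) as [K|K].
    + assert (E1 : rot y (eps * n) ∙ (m' ∙ rot y' (j * n) ∙ h') = m' ∙ rot y' ((eps + j) * n) ∙ h').
      { rewrite (rot_same (m' ∙ y') y _ K), rot_conj.
        replace ((eps + j) * n) with (eps * n + j * n) by lia. rewrite rot_add. grp. }
      assert (E2 : wt y = wt y').
      { rewrite (wt_same _ _ K). eapply wt_below; eauto. }
      rewrite E1, E2. destruct (Z.eq_dec (eps + j) 0) as [E3|E3].
      * rewrite E3. cbn [Z.mul]. rewrite rot_0, mul_1r.
        replace (eps * wt y' + (k' + j * wt y' + l')) with (k' + l') by nia.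
        exists s'. apply nform_left; auto. eapply nform_weaken; eauto.
      * replace (eps * wt y' + (k' + j * wt y' + l')) with (k' + (eps + j) * wt y' + l') by lia.
        eexists. eapply nform_cons; eauto.
    + eexists.
      replace (rot y (eps * n) ∙ (m' ∙ rot y' (j * n) ∙ h')) with
        (one ∙ rot y (eps * n) ∙ (m' ∙ rot y' (j * n) ∙ h')) by grp.
      replace (eps * wt y + (k' + j * wt y' + l')) with (0 + eps * wt y + (k' + j * wt y' + l')) by lia.
      eapply nform_cons; eauto; [constructor|lia|]. eapply nform_cons; eauto.
      intros X. apply K. now apply same_sym.
Qed.

(** A rotation about a coset that [below R] brings closer than R is conjugate, by an element of
    [below R], to a rotation of lower level, and is absorbed. What remains are rotations about [far]
    cosets. *)
Lemma nform_ex R h k : below (R + 1) h k -> exists s, nform R None h k s.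
Proof.
  induction 1 as [|y eps h k Hy He H [s IH]].
  - exists O. constructor. constructor.
  - destruct (classic (far R R y)) as [Hf|Hf].
    + pose proof (far_level R R y Hf). eapply nform_rot; eauto. lia.
    + apply not_all_ex_not in Hf. destruct Hf as [m Hf]. apply not_all_ex_not in Hf. destruct Hf as [l Hf].
      apply imply_to_and in Hf. destruct Hf as [Hm Hl].
      exists s. apply nform_left; auto.
      replace (rot y (eps * n)) with (m⁻¹ ∙ (rot (m ∙ y) (eps * n) ∙ m)) by (rewrite rot_conj; grp).
      replace (eps * wt y) with (- l + (eps * wt (m ∙ y) + l)) by (rewrite (wt_below R m l); auto; lia).
      apply below_mul; [now apply below_inv|]. apply below_mul; auto.
      apply below_gen; auto. lia.
Qed.

(* [orbit_thin] and [geodesic_near] are established by a simultaneous induction on R. *)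
Definition orbit_thin (R : Z) : Prop := forall y, far R R y -> forall m k, below R m k ->
  Z.abs (ang y one m) <= th0.

Lemma below_turn L m k y j : below L m k -> gapy y one < L -> exists l, below L (m ∙ rot y (j * n)) l.
Proof.
  intros Hm Hy.
  assert (H0 : forall i, exists l, below L (rot y (i * n)) l).
  { induction i as [|i [l Hl]|i [l Hl]] using Z.peano_ind.
    - exists 0. cbn. rewrite rot_0. constructor.
    - exists (1 * wt y + l). replace (Z.succ i * n) with (1 * n + i * n) by lia.
      rewrite rot_add. apply below_step; auto.
    - exists (-1 * wt y + l). replace (Z.pred i * n) with (-1 * n + i * n) by lia.
      rewrite rot_add. apply below_step; auto. }
  destruct (H0 j) as [l Hl]. exists (k + l). now apply below_mul.
Qed.

(** * Passing from level R to level R + 1 *)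

Section Level.
Context (R : Z) (HI : orbit_thin R).

Lemma next_coset_angle x m k y : gapy y one = R -> far R R x -> below R m k -> ~ same x (m ∙ y) ->
  Z.abs (ang x one (m ∙ y)) <= th0 + theta.
Proof.
  intros Hy Hf Hm Hs. pose proof (HI x Hf m k Hm).
  pose proof (translated_level_angle m y x Hs) as H1. rewrite Hy in H1.
  specialize (H1 (Hf m⁻¹ (- k) (below_inv _ _ _ Hm))). pose proof (ang_add (c := c) x one m (m ∙ y)). lia.
Qed.

Lemma prev_coset_angle x m k y : gapy x one = R -> far R R y -> below R m k -> ~ same x (m ∙ y) ->
  Z.abs (ang y one (m⁻¹ ∙ x)) <= th0 + theta.
Proof.
  intros Hx Hf Hm Hs. apply (next_coset_angle y m⁻¹ (- k)); auto.
  - now apply below_inv.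
  - intros K. apply Hs. apply same_sym. apply (same_left m⁻¹). now rewrite mul_Vl_r.
Qed.

(** At the next coset z the form turns by about jn, so z separates x from h. By Behrstock h looks
    from x as z does, whatever comes after z, and z is controlled by [next_coset_angle]. *)
Lemma nform_angle x h k s : gapy x one = R -> far R R x -> nform R (Some x) h k s ->
  Z.abs (ang x one h) <= th0 + 2 * theta.
Proof.
  intros Hx Hf H. remember (Some x) as o eqn:Eo. revert x Hx Hf Eo.
  induction H as [o h k H|o m k y j h' k' s Hm Hy Hfy Hj Ho H IH]; intros x Hx Hf ->.
  - pose proof (HI x Hf h k H). lia.
  - specialize (IH y Hy Hfy eq_refl).
    pose proof (next_coset_angle x m k y Hy Hf Hm Ho) as H1.
    pose proof (prev_coset_angle x m k y Hx Hfy Hm Ho) as H2.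
    set (h := m ∙ rot y (j * n) ∙ h').
    assert (H3 : ang (m ∙ y) x h = ang y (m⁻¹ ∙ x) one + ang y one h' + j * n).
    { rewrite <- (ang_left m⁻¹), mul_Vl_r. unfold h. rewrite mulA_r, mul_Vl_r.
      rewrite (ang_rot CG). pose proof (ang_add (c := c) y (m⁻¹ ∙ x) one h'). lia. }
    pose proof (ang_opp (c := c) y (m⁻¹ ∙ x) one).
    assert (H4 : theta < Z.abs (ang (m ∙ y) h x)) by (rewrite ang_opp; pose proof th0_ge; pose proof (turn_ge j Hj); lia).
    pose proof (behrstock0 CG x (m ∙ y) h Ho H4).
    pose proof (ang_opp (c := c) x h (m ∙ y)). pose proof (ang_add (c := c) x one (m ∙ y) h). lia.
Qed.

Lemma nform_first_angle m k y j h' k' s : below R m k -> gapy y one = R -> far R R y ->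
  nform R (Some y) h' k' s ->
  Z.abs (ang (m ∙ y) one (m ∙ rot y (j * n) ∙ h') - j * n) <= kap.
Proof.
  intros Hm Hy Hf H. pose proof (nform_angle y h' k' s Hy Hf H) as H1.
  pose proof (HI y Hf m⁻¹ (- k) (below_inv _ _ _ Hm)) as H2.
  rewrite <- (ang_left m⁻¹), mul_Vl_r, mulA_r, mul_Vl_r, mul_1r, (ang_rot CG).
  pose proof (ang_add (c := c) y m⁻¹ one h'). pose proof (ang_opp (c := c) y m⁻¹ one).
  unfold turn_defect. lia.
Qed.

(* Cosets already passed (x, seen from s) stay behind: the bound does not accumulate along the form. *)
Lemma nform_thin_aux L t x h k s : R + 1 <= L ->
  (forall y, far L L y -> forall m k, below R m k -> Z.abs (ang y one m) <= t) ->
  gapy x one = R -> far R R x -> nform R (Some x) h k s ->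
  forall y s0, far L L y -> Z.abs (ang y s0 x) <= theta -> n <= 2 * Z.abs (ang x s0 one) ->
  Z.abs (ang y s0 h) <= t + 4 * theta.
Proof.
  intros HL Ht Hx Hfx H. remember (Some x) as o eqn:Eo. revert x Hx Hfx Eo.
  induction H as [o h k H|o m k x' j h' k' s Hm Hx' Hfx' Hj Ho H IH]; intros x Hx Hfx -> y s0 Hfy H1 H2.
  - pose proof (Ht y Hfy h k H).
    pose proof (level_angle x y (far_not_same L L x y Hfy ltac:(lia)) ltac:(pose proof (far_level _ _ _ Hfy); lia)).
    pose proof (ang_add (c := c) y s0 x one). pose proof (ang_add (c := c) y s0 one h).
    pose proof (ang_opp (c := c) y x one). lia.
  - specialize (IH x' Hx' Hfx' eq_refl). set (z := m ∙ x') in *.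
    set (u := m ∙ rot x' (j * n)). set (h := u ∙ h').
    assert (HmL : below L m k) by (eapply below_mono; [|exact Hm]; lia).
    destruct (below_turn L m k x' j HmL ltac:(lia)) as [l Hu]. fold u in Hu.
    pose proof (next_coset_angle x m k x' Hx' Hfx Hm Ho) as A1.
    pose proof (prev_coset_angle x m k x' Hx Hfx' Hm Ho) as A2.
    pose proof (nform_angle x' h' k' s Hx' Hfx' H) as A3. fold z in A1, Ho.
    assert (A4 : Z.abs (ang z s0 x) <= theta).
    { apply (behrstock0 CG z x s0).
      - intros K. apply Ho. now apply same_sym.
      - pose proof (ang_add (c := c) x s0 one z). pose proof th0_ge. lia. }
    assert (A5 : ang z x u = ang x' (m⁻¹ ∙ x) one + j * n).
    { rewrite <- (ang_left m⁻¹). unfold z, u. rewrite !mul_Vl_r. rewrite <- (mul_1r _ (rot x' (j * n))).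
      now rewrite (ang_rot CG). }
    assert (A6 : ang z u h = ang x' one h').
    { assert (Es : same (u ∙ x') z).
      { apply same_sym. exists (j * n). unfold u, z, rotation. grp. }
      rewrite (ang_same CG _ _ _ _ Es). unfold h. rewrite <- (mul_1r _ u) at 2. now rewrite ang_left. }
    pose proof (ang_opp (c := c) x' (m⁻¹ ∙ x) one). pose proof (ang_add (c := c) z s0 x u) as A7.
    pose proof (ang_add (c := c) z s0 u h) as A8. pose proof (ang_add (c := c) z s0 y h) as A9.
    pose proof (ang_opp (c := c) z y h) as A10. pose proof th0_ge. pose proof (turn_ge j Hj).
    assert (Hyz : ~ same y z).
    { intros K. apply (same_left m⁻¹) in K. unfold z in K. rewrite mul_Vl_r in K.
      revert K. apply (far_not_same L L). eapply far_mul; [eauto|]. apply below_inv; eauto. lia. }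
    (* If y lies on the side of h at z, then z separates s0 from y, and the form is shortened by u
       with s0 carried along. Otherwise z separates y from h, and angles add up along s0, x, 1, m,
       z, h, where the piece from 1 to m costs t and each other piece theta. *)
    destruct (Z_le_dec (Z.abs (ang z h y)) theta) as [K|K].
    + assert (K2 : theta < Z.abs (ang z s0 y)) by lia.
      replace (ang y s0 h) with (ang (u⁻¹ ∙ y) (u⁻¹ ∙ s0) h').
      2:{ rewrite <- (ang_left u), !mul_Vr_r. reflexivity. }
      apply IH.
      * eapply far_mul; [eauto|]. apply below_inv; eauto.
      * rewrite <- (ang_left u), !mul_Vr_r. replace (u ∙ x') with (z ∙ zpow g (j * n)).
        { now apply (behrstock CG). } unfold u, z, rotation. grp.
      * rewrite <- (ang_left u), !mul_Vr_r, mul_1r.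
        assert (Es : same z (u ∙ x')).
        { exists (j * n). unfold u, z, rotation. grp. }
        rewrite (ang_same CG _ _ _ _ Es). lia.
    + assert (K2 : theta < Z.abs (ang z h y)) by lia.
      pose proof (behrstock0 CG y z h Hyz K2) as B1.
      pose proof (Ht y Hfy m k Hm) as B2.
      pose proof (level_angle x y (far_not_same L L x y Hfy ltac:(lia)) ltac:(pose proof (far_level _ _ _ Hfy); lia)) as B3.
      pose proof (translated_level_angle m x' y Hyz) as B4. fold z in B4.
      pose proof (Hfy m⁻¹ (- k) (below_inv _ _ _ HmL)) as B5. specialize (B4 ltac:(lia)).
      pose proof (ang_add (c := c) y s0 x one). pose proof (ang_add (c := c) y s0 one m).
      pose proof (ang_add (c := c) y s0 m z). pose proof (ang_add (c := c) y s0 z h).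
      pose proof (ang_opp (c := c) y x one). pose proof (ang_opp (c := c) y z h). lia.
Qed.

Lemma thin_step L t : R + 1 <= L ->
  (forall y, far L L y -> forall m k, below R m k -> Z.abs (ang y one m) <= t) ->
  forall y, far L L y -> forall h k, below (R + 1) h k -> Z.abs (ang y one h) <= t + 4 * theta.
Proof.
  intros HL Ht y Hfy h k H. apply nform_ex in H. destruct H as [s H].
  remember None as o eqn:Eo.
  destruct H as [o h k H|o m k x' j h' k' s Hm Hx' Hfx' Hj Ho H].
  - pose proof (Ht y Hfy h k H). lia.
  - clear o Ho Eo. set (z := m ∙ x') in *. set (u := m ∙ rot x' (j * n)). set (h := u ∙ h').
    assert (HmL : below L m k) by (eapply below_mono; [|exact Hm]; lia).
    destruct (below_turn L m k x' j HmL ltac:(lia)) as [l Hu]. fold u in Hu.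
    pose proof (nform_first_angle m k x' j h' k' s Hm Hx' Hfx' H) as A1. fold u h z in A1.
    pose proof (HI x' Hfx' m⁻¹ (- k) (below_inv _ _ _ Hm)) as A2.
    pose proof th0_ge. pose proof (turn_ge j Hj). unfold turn_defect in A1.
    assert (Hyz : ~ same y z).
    { intros K. apply (same_left m⁻¹) in K. unfold z in K. rewrite mul_Vl_r in K.
      revert K. apply (far_not_same L L). eapply far_mul; [eauto|]. apply below_inv; eauto. lia. }
    assert (Es : same (u ∙ x') z).
    { apply same_sym. exists (j * n). unfold u, z, rotation. grp. }
    pose proof (ang_add (c := c) z one y h) as A3. pose proof (ang_opp (c := c) z y h) as A4.
    destruct (Z_le_dec (Z.abs (ang z h y)) theta) as [K|K].
    + assert (K2 : theta < Z.abs (ang z one y)) by lia.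
      replace (ang y one h) with (ang (u⁻¹ ∙ y) u⁻¹ h').
      2:{ rewrite <- (ang_left u), !mul_Vr_r, mul_Vr. reflexivity. }
      apply (nform_thin_aux L t x' h' k' s); auto.
      * eapply far_mul; [eauto|]. apply below_inv; eauto.
      * rewrite <- (ang_left u), !mul_Vr_r, mul_Vr. replace (u ∙ x') with (z ∙ zpow g (j * n)).
        { now apply (behrstock CG). } unfold u, z, rotation. grp.
      * rewrite <- (ang_left u), mul_Vr, mul_1r, <- (ang_same CG _ _ _ _ Es).
        unfold z. rewrite <- (ang_left m⁻¹), mul_Vl_r, mul_1r. unfold u. rewrite mul_Vl_r.
        rewrite <- (mul_1r _ (rot x' (j * n))), (ang_rot CG). rewrite ang_opp. lia.
    + assert (K2 : theta < Z.abs (ang z h y)) by lia.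
      pose proof (behrstock0 CG y z h Hyz K2) as B1.
      pose proof (Ht y Hfy m k Hm) as B2.
      pose proof (translated_level_angle m x' y Hyz) as B4. fold z in B4.
      pose proof (Hfy m⁻¹ (- k) (below_inv _ _ _ HmL)) as B5. specialize (B4 ltac:(lia)).
      pose proof (ang_add (c := c) y one m z). pose proof (ang_add (c := c) y one z h).
      pose proof (ang_opp (c := c) y z h). lia.
Qed.

(** The next rotation separates x from h, so by [angle_order] the end h is farther from x than from
    that coset. *)
Lemma nform_far x h k s : gapy x one = R -> far R R x -> nform R (Some x) h k s -> R <= gapy x h.
Proof.
  intros Hx Hf H. remember (Some x) as o eqn:Eo. revert x Hx Hf Eo.
  induction H as [o h k H|o m k y j h' k' s Hm Hy Hfy Hj Ho H IH]; intros x Hx Hf ->.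
  - specialize (Hf h⁻¹ (- k) (below_inv _ _ _ H)). now rewrite <- (gapy_left h), mul_Vr_r, mul_1r in Hf.
  - specialize (IH y Hy Hfy eq_refl). set (h := m ∙ rot y (j * n) ∙ h').
    pose proof (prev_coset_angle x m k y Hx Hfy Hm Ho) as H2.
    pose proof (nform_angle y h' k' s Hy Hfy H) as H3.
    pose proof th0_ge. pose proof (turn_ge j Hj).
    assert (H4 : ang (m ∙ y) x h = ang y (m⁻¹ ∙ x) one + ang y one h' + j * n).
    { rewrite <- (ang_left m⁻¹), mul_Vl_r. unfold h. rewrite mulA_r, mul_Vl_r.
      rewrite (ang_rot CG). pose proof (ang_add (c := c) y (m⁻¹ ∙ x) one h'). lia. }
    pose proof (ang_opp (c := c) y (m⁻¹ ∙ x) one). pose proof (ang_opp (c := c) (m ∙ y) h x).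
    assert (Ho' : ~ same (m ∙ y) x) by (intros K; apply Ho; now apply same_sym).
    pose proof (angle_order CG (m ∙ y) x h Ho' ltac:(lia)) as B5.
    replace (gapy (m ∙ y) h) with (gapy y h') in B5; [lia|].
    unfold h. rewrite mulA_r, gapy_left. now rewrite (gapy_rot CG).
Qed.

(** Quasiconvexity of the union of the [below R] translates of the ball of radius r about 1, tested
    on geodesics from the ball to a translate. *)
Definition geodesic_near (R : Z) : Prop := forall r h k v u w, below R h k -> R <= r -> 0 <= r ->
  dh one v <= r -> dh one u <= r -> dh v w + dh w (h ∙ u) = dh v (h ∙ u) ->
  exists m k', below R m k' /\ dh one (m ∙ w) <= r + 2 * del.

Lemma dist_coset_le y z a : same y z -> dh a z <= gapy y a + 1.
Proof.
  intros H. destruct (gapy_ex CG y a) as [x [Hx [E _]]].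
  pose proof (dist_same_le CG x z (same_trans _ _ _ (same_sym _ _ Hx) H)).
  pose proof (dist_tri _ HU a x z). lia.
Qed.

Lemma nform_near o h k s r v u w : geodesic_near R -> 0 <= R -> R + 1 <= r -> nform R o h k s ->
  dh one v <= r -> dh one u <= r -> dh v w + dh w (h ∙ u) = dh v (h ∙ u) ->
  exists m k', below (R + 1) m k' /\ dh one (m ∙ w) <= r + 2 * del.
Proof.
  intros HK R0 Hr H. revert v u w.
  assert (Hmono : forall w, (exists m k', below R m k' /\ dh one (m ∙ w) <= r + 2 * del) ->
     exists m k', below (R + 1) m k' /\ dh one (m ∙ w) <= r + 2 * del).
  { intros w [m [k' [A B]]]. exists m, k'. split; auto. eapply below_mono; [|exact A]. lia. }
  induction H as [o h k H|o m k y j h' k' s Hm Hy Hfy Hj Ho H IH]; intros v u w Hv Hu Hw.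
  - apply Hmono. apply (HK r h k v u); auto; lia.
  - set (z := m ∙ y). set (q := m ∙ rot y (j * n)) in *.
    assert (Hq : exists l, below (R + 1) q l).
    { apply (below_turn (R + 1) m k y j); [|lia]. eapply below_mono; [|exact Hm]. lia. }
    destruct Hq as [l Hq].
    assert (Hpull : forall w, (exists m0 k0, below (R + 1) m0 k0 /\ dh one (m0 ∙ (q⁻¹ ∙ w)) <= r + 2 * del) ->
      exists m0 k0, below (R + 1) m0 k0 /\ dh one (m0 ∙ w) <= r + 2 * del).
    { intros w' [m0 [k0 [A B]]]. exists (m0 ∙ q⁻¹), (k0 + - l). rewrite mulA_r. split; auto.
      apply below_mul; auto. now apply below_inv. }
    assert (Hqi : forall x, h' ∙ x = q⁻¹ ∙ (q ∙ h' ∙ x)) by (intros; grp).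
    pose proof (dist_tri _ HU v w (q ∙ h' ∙ u)).
    (* If the geodesic hardly turns at z, the turn jn is compensated by the stretch leading to u or
       to v. That stretch has a large angle at the coset, so it can be turned while its end stays in
       the ball of radius r, which shortens the form. *)
    destruct (Z_le_dec (Z.abs (ang z v (q ∙ h' ∙ u))) theta) as [K|K].
    + assert (E1 : ang z v (q ∙ h' ∙ u) = ang y (m⁻¹ ∙ v) one + ang y one (h' ∙ u) + j * n).
      { unfold z, q. rewrite <- (ang_left m⁻¹), mul_Vl_r, !mulA_r, mul_Vl_r, (ang_rot CG).
        pose proof (ang_add (c := c) y (m⁻¹ ∙ v) one (h' ∙ u)). lia. }
      pose proof (turn_ge j Hj) as Hn1. pose proof th0_ge as Hth. pose proof D0 as HD.
      destruct (Z_le_dec n (4 * Z.abs (ang y one (h' ∙ u)))) as [K1|K1].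
      * apply Hmono. apply (HK r m k v (rot y (j * n) ∙ (h' ∙ u))); auto; try lia.
        2:{ unfold q in Hw. now rewrite !mulA_r in Hw. }
        pose proof (nform_angle y h' k' s Hy Hfy H) as A1.
        pose proof (ang_add (c := c) y one h' (h' ∙ u)) as A2.
        pose proof (angle_dist CG y h' (h' ∙ u) ltac:(lia)) as A3.
        pose proof (nform_far y h' k' s Hy Hfy H) as A4.
        pose proof (dist_via CG y one (rot y (j * n) ∙ (h' ∙ u))) as A5.
        rewrite (gapy_rot CG) in A5.
        replace (dh h' (h' ∙ u)) with (dh one u) in A3 by (rewrite <- (dist_left _ h'), mul_1r; auto).
        lia.
      * apply Hpull. apply (IH (q⁻¹ ∙ v) u); auto; [|now rewrite Hqi, !dist_left].
        pose proof (HI y Hfy m⁻¹ (- k) (below_inv _ _ _ Hm)) as A1.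
        pose proof (ang_opp (c := c) y (m⁻¹ ∙ v) one) as A6.
        pose proof (ang_add (c := c) y one m⁻¹ (m⁻¹ ∙ v)) as A2.
        pose proof (angle_dist CG y m⁻¹ (m⁻¹ ∙ v) ltac:(lia)) as A3.
        pose proof (Hfy m k Hm) as A4.
        replace (gapy (m ∙ y) one) with (gapy y m⁻¹) in A4.
        2:{ rewrite <- (gapy_left m), mul_Vr. auto. }
        pose proof (dist_via CG y one (q⁻¹ ∙ v)) as A5.
        replace (gapy y (q⁻¹ ∙ v)) with (gapy y (m⁻¹ ∙ v)) in A5.
        2:{ unfold q. rewrite inv_mul, rot_opp, mulA_r. now rewrite (gapy_rot CG). }
        replace (dh m⁻¹ (m⁻¹ ∙ v)) with (dh one v) in A3 by (rewrite <- (dist_left _ m⁻¹), mul_1r; auto).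
        lia.
    (* Otherwise a geodesic may pass through z<g>: it is cut at the point z' of the coset nearest to
       w, and w lies on one of the halves. *)
    + pose proof (angle_dist CG z v (q ∙ h' ∙ u) ltac:(pose proof D0; lia)) as A1.
      pose proof (ang_add (c := c) z v w (q ∙ h' ∙ u)) as A2.
      destruct (gapy_ex CG z w) as [z' [Hz' [E _]]].
      destruct (Z_le_dec (Z.abs (ang z v w)) D) as [K1|K1].
      * pose proof (angle_dist CG z w (q ∙ h' ∙ u) ltac:(lia)) as A3.
        apply Hmono. apply (HK r m k v (m⁻¹ ∙ z')); auto; try lia.
        { assert (same y (m⁻¹ ∙ z')) by (apply (same_left m); now rewrite mul_Vr_r).
          pose proof (dist_coset_le y _ one H1). lia. }
        rewrite mul_Vr_r. pose proof (dist_coset_le z z' v Hz'). pose proof (dist_tri _ HU v w z').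
        pose proof (dist_coset_le z z' (q ∙ h' ∙ u) Hz').
        pose proof (gapy_le_same CG z v z' Hz').
        pose proof (dist_tri _ HU v z' (q ∙ h' ∙ u)). pose proof (dist_sym _ HU z' (q ∙ h' ∙ u)).
        lia.
      * pose proof (angle_dist CG z v w ltac:(lia)) as A3.
        apply Hpull. apply (IH (q⁻¹ ∙ z') u); auto.
        { assert (same y (q⁻¹ ∙ z')).
          { apply (same_left q). rewrite mul_Vr_r. eapply same_trans; [|exact Hz'].
            apply same_sym. exists (j * n). unfold q, z, rotation. grp. }
          pose proof (dist_coset_le y _ one H1). lia. }
        rewrite Hqi, !dist_left.
        pose proof (dist_tri _ HU z' w (q ∙ h' ∙ u)).
        pose proof (dist_coset_le z z' v Hz').
        pose proof (dist_tri _ HU v z' (q ∙ h' ∙ u)). pose proof (dist_sym _ HU z' w). lia.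
Qed.

End Level.

Lemma orbit_thin_nonpos R : R <= 0 -> orbit_thin R.
Proof.
  intros HR y Hy m k Hm. apply below_nonpos in Hm as [-> _]; auto. rewrite ang_refl.
  pose proof th0_ge. lia.
Qed.

Lemma geodesic_near_nonpos R : R <= 0 -> geodesic_near R.
Proof.
  intros HR r h k v u w H Hr Hr0 Hv Hu Hw. apply below_nonpos in H as [-> _]; auto.
  rewrite mul_1l in Hw. exists one, 0. split; [constructor|]. rewrite mul_1l.
  pose proof (cg_hyp _ _ _ _ _ _ CG one v w u). pose proof (dist_nonneg (coned T g) v w).
  pose proof (dist_nonneg (coned T g) w u). lia.
Qed.

(** An angle above D at y for an element of [below R0], R0 = R - (2 del + 1), would put a point of
    y<g> on a geodesic from 1 to it; [geodesic_near] then moves that point to within R0 + 2 del < R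
    of 1, against [far]. The last 2 del + 1 levels are added by [thin_step]. *)
Lemma orbit_thin_step R : (forall R', R' < R -> orbit_thin R' /\ geodesic_near R') -> orbit_thin R.
Proof.
  intros HR. set (R0 := R - (2 * del + 1)).
  assert (H0 : forall y, far R R y -> forall m k, below R0 m k -> Z.abs (ang y one m) <= D).
  { intros y Hy m k Hm. destruct (Z_le_dec R0 0) as [K|K].
    { apply below_nonpos in Hm as [-> _]; auto. rewrite ang_refl. pose proof D0. lia. }
    apply Z.le_ngt. intros N. pose proof (angle_dist CG y one m N) as A1.
    destruct (gapy_ex CG y one) as [z [Hz [E _]]].
    destruct (HR R0 ltac:(unfold R0; lia)) as [_ HK].
    destruct (HK R0 m k one one z Hm) as [m' [k' [B1 B2]]]; try lia.
    - rewrite (dist_refl _ HU). lia.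
    - rewrite (dist_refl _ HU). lia.
    - rewrite mul_1r. pose proof (dist_tri _ HU one z m). rewrite (dist_sym _ HU z m) in *.
      assert (dh m z <= gapy y m + 1).
      { destruct (gapy_ex CG y m) as [x [Hx [E' _]]].
        pose proof (dist_same_le CG x z (same_trans _ _ _ (same_sym _ _ Hx) Hz)).
        pose proof (dist_tri _ HU m x z). lia. }
      lia.
    - pose proof (Hy m' k' (below_mono R0 R m' k' ltac:(unfold R0; lia) B1)) as B3.
      pose proof (gapy_le_same CG (m' ∙ y) one (m' ∙ z) ltac:(now apply same_left)).
      unfold R0 in *. lia. }
  assert (H1 : forall i : nat, Z.of_nat i <= 2 * del + 1 -> forall y, far R R y -> forall m k,
    below (R0 + Z.of_nat i) m k -> Z.abs (ang y one m) <= D + 8 * D * Z.of_nat i).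
  { induction i as [|i IH]; intros Hi y Hy m k Hm.
    - rewrite Z.add_0_r in Hm. pose proof (H0 y Hy m k Hm). lia.
    - replace (R0 + Z.of_nat (S i)) with ((R0 + Z.of_nat i) + 1) in Hm by lia.
      pose proof (thin_step (R0 + Z.of_nat i) ltac:(apply HR; unfold R0; lia) R (D + 8 * D * Z.of_nat i)
        ltac:(unfold R0; lia) ltac:(apply IH; lia) y Hy m k Hm). lia. }
  intros y Hy m k Hm. unfold orbit_bound.
  specialize (H1 (Z.to_nat (2 * del + 1)) ltac:(lia) y Hy m k). rewrite Z2Nat.id in H1 by lia.
  apply H1. replace (R0 + (2 * del + 1)) with R by (unfold R0; lia). exact Hm.
Qed.

Lemma orbit_thin_near R : orbit_thin R /\ geodesic_near R.
Proof.
  destruct (Z_le_dec R 0) as [K|K].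
  { split; [now apply orbit_thin_nonpos|now apply geodesic_near_nonpos]. }
  replace R with (Z.of_nat (Z.to_nat R)) by lia. generalize (Z.to_nat R) as i. clear R K.
  induction i as [i IH] using (well_founded_induction lt_wf).
  assert (HR : forall R', R' < Z.of_nat i -> orbit_thin R' /\ geodesic_near R').
  { intros R' H. destruct (Z_le_dec R' 0) as [K|K].
    - split; [now apply orbit_thin_nonpos|now apply geodesic_near_nonpos].
    - replace R' with (Z.of_nat (Z.to_nat R')) by lia. apply IH. lia. }
  split; [now apply orbit_thin_step|].
  destruct i as [|i]; [now apply geodesic_near_nonpos|].
  destruct (HR (Z.of_nat i) ltac:(lia)) as [HI HK].
  intros r h k v u w H Hr _ Hv Hu Hw. replace (Z.of_nat (S i)) with (Z.of_nat i + 1) in H, Hr |- * by lia.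
  apply nform_ex in H as [s H]. apply (nform_near (Z.of_nat i) HI None h k s r v u w); auto; lia.
Qed.

(* Turning at a coset where h makes an angle close to n or more, toward a smaller angle. *)
Inductive reducible : G -> Prop :=
| red_one : reducible one
| red_step h y eps : eps = 1 \/ eps = -1 -> n - kap <= eps * ang y one h ->
    reducible (rot y (- eps * n) ∙ h) -> reducible h.

(** Induction on s: the first rotation shows an angle within kap of jn, and turning by one unit
    towards 0 lowers s. *)
Lemma nform_reducible R (HR : forall h k, below R h k -> reducible h) o h k s :
  nform R o h k s -> reducible h.
Proof.
  intros H. apply nform_weaken in H. revert h k H.
  induction s as [s IH] using (well_founded_induction lt_wf). intros h k H.
  remember None as o1 eqn:Eo in H. revert IH.
  destruct H as [o1 h k H1|o1 m k1 y j h' k' s' H1 H2 H3 H4 H5 H6]; intros IH; [eapply HR; eauto|]. clear o1 Eo H5.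
  pose proof (nform_first_angle R (proj1 (orbit_thin_near R)) m k1 y j h' k' s' H1 H2 H3 H6) as A.
  pose (eps := if Z_le_dec j 0 then -1 else 1).
  assert (He : eps = 1 \/ eps = -1) by (unfold eps; destruct (Z_le_dec j 0); auto).
  assert (Hj : eps * (j * n) >= n /\ Z.abs j = 1 + Z.abs (j - eps)).
  { pose proof (turn_ge j H4). pose proof th0_ge. unfold eps. destruct (Z_le_dec j 0); nia. }
  apply (red_step _ (m ∙ y) eps He).
  { destruct He as [He|He]; rewrite He in *; lia. }
  replace (rot (m ∙ y) (- eps * n) ∙ (m ∙ rot y (j * n) ∙ h')) with (m ∙ rot y ((j - eps) * n) ∙ h').
  2:{ rewrite rot_conj. replace ((j - eps) * n) with (- eps * n + j * n) by lia. rewrite rot_add. grp. }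
  destruct (Z.eq_dec (j - eps) 0) as [E|E].
  - rewrite E. cbn [Z.mul]. rewrite rot_0, mul_1r.
    apply (IH s' ltac:(lia) (m ∙ h') (k1 + k')). apply nform_left; auto. eapply nform_weaken; eauto.
  - eapply (IH (Z.to_nat (Z.abs (j - eps)) + s')%nat); [lia|]. eapply nform_cons; eauto.
Qed.

Lemma below_reducible R h k : below R h k -> reducible h.
Proof.
  destruct (Z_le_dec R 0) as [K|K].
  { intros H. apply below_nonpos in H as [-> _]; auto. constructor. }
  replace R with (Z.of_nat (Z.to_nat R)) by lia. revert h k. generalize (Z.to_nat R) as i. clear R K.
  induction i as [|i IH]; intros h k H.
  - apply below_nonpos in H as [-> _]; [constructor|lia].
  - replace (Z.of_nat (S i)) with (Z.of_nat i + 1) in H by lia. apply nform_ex in H as [s H].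
    eapply nform_reducible; eauto.
Qed.

(** A form with a rotation has a nonzero angle at its first coset and cannot equal 1, so 1 comes
    from lower levels only. Hence weights depend on the element alone. *)
Lemma below_one_wt R k : below R one k -> k = 0.
Proof.
  destruct (Z_le_dec R 0) as [K|K].
  { intros H. now apply below_nonpos in H as [_ ->]. }
  replace R with (Z.of_nat (Z.to_nat R)) by lia. revert k. generalize (Z.to_nat R) as i. clear R K.
  induction i as [|i IH]; intros k H.
  - now apply below_nonpos in H as [_ ->].
  - replace (Z.of_nat (S i)) with (Z.of_nat i + 1) in H by lia. apply nform_ex in H as [s H].
    remember one as h eqn:Eh. remember None as o eqn:Eo.
    destruct H as [o h k H|o m k1 y j h' k' s' H1 H2 H3 H4 H5 H6]; [subst; eauto|]. exfalso.
    pose proof (nform_first_angle _ (proj1 (orbit_thin_near (Z.of_nat i))) m k1 y j h' k' s' H1 H2 H3 H6) as A.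
    rewrite Eh, ang_refl in A. pose proof (turn_ge j H4). pose proof th0_ge. unfold turn_defect in A. lia.
Qed.

End RotationGroup.

(** * The quotient is hyperbolic *)

Section Homomorphism.
Context {G H : Group} {f : G -> H} (Hf : is_hom f).

Lemma hom_one : f one = one.
Proof. apply (mul_cancel_l (f one)). now rewrite <- Hf, !mul_1r. Qed.

Lemma hom_inv x : f x⁻¹ = (f x)⁻¹.
Proof. symmetry. apply inv_unique. rewrite <- Hf, mul_Vr. apply hom_one. Qed.

Lemma hom_npow x k : f (npow x k) = npow (f x) k.
Proof. induction k as [|k IH]; cbn; [apply hom_one|now rewrite Hf, IH]. Qed.

Lemma hom_zpow x k : f (zpow x k) = zpow (f x) k.
Proof.
  destruct k; cbn; [apply hom_one|apply hom_npow|]. now rewrite hom_inv, hom_npow.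
Qed.

Lemma hom_prod l : f (prod l) = prod (map f l).
Proof. induction l as [|x l IH]; cbn; [apply hom_one|now rewrite Hf, IH]. Qed.
End Homomorphism.

Section Quotient.
Context {G : Group} {S : list G} {g : G} {del D : Z} {e c : G -> Z}
  (CG : cone_geom (sym_list S) g del D e c).
Local Open Scope Z_scope.
Notation dh := (dist (coned (sym_list S) g)).
Notation lh := (len (coned (sym_list S) g)).
Notation theta := (2 * D).
Notation kap := (turn_defect del D).
Notation ang := (angle (c := c)).
Notation gapy := (coset_gap (e := e)).
Notation same := (same (g := g)).
Notation rot := (rotation (g := g)).
Notation reducible := (reducible (g := g) (del := del) (D := D) (c := c)).
Notation below := (below (g := g) (e := e)).
Let HU : symgen (coned (sym_list S) g) := coned_symgen _ (cg_gen _ _ _ _ _ _ CG) g.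
Let D0 : 0 <= D := cg_D _ _ _ _ _ _ CG.
Context (n : nat) (Hn : 1000 * (orbit_bound del D + D + 1) <= Z.of_nat n).
Notation nz := (Z.of_nat n).

Lemma large_exponent : 100 * (orbit_bound del D + D + 1) <= nz.
Proof. pose proof (th0_ge CG). lia. Qed.

Lemma kap_small : 0 <= kap /\ 1000 * D + 1000 <= nz /\ 100 * kap <= nz.
Proof. pose proof (th0_ge CG). unfold turn_defect. lia. Qed.

Notation N := (nclosure (fun x : G => x = npow g n)).

Lemma nclosure_normal (P : G -> Prop) : is_normal (nclosure P).
Proof.
  split; [split; [|split]|].
  - intros K HK _. apply HK.
  - intros x y Hx Hy K HK HP. apply HK; [now apply Hx|now apply Hy].
  - intros x Hx K HK HP. apply HK. now apply Hx.
  - intros a x Hx K HK HP. apply HK. now apply Hx.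
Qed.

Lemma rot_in_N y k : N (rot y (k * nz)).
Proof.
  destruct (nclosure_normal (fun x : G => x = npow g n)) as [[H1 [H2 H3]] H4].
  apply H4. rewrite Z.mul_comm, <- zpow_mul, zpow_nat.
  assert (H : N (npow g n)) by (intros K HK HP; now apply HP).
  assert (H5 : forall m, N (npow (npow g n) m)) by (induction m; cbn; auto).
  destruct k; cbn; auto.
Qed.

Section Weight.
Context (wt : G -> Z) (wt_same : forall y z, same y z -> wt z = wt y)
  (wt_rot : forall y z k, wt (rot z (k * nz) ∙ y) = wt y).

Lemma below_N R h k : below nz wt R h k -> N h.
Proof.
  destruct (nclosure_normal (fun x : G => x = npow g n)) as [[H1 [H2 H3]] H4].
  induction 1; auto. apply H2; auto. apply rot_in_N.
Qed.

Lemma below_conj x R h k : below nz wt R h k -> exists R' k', below nz wt R' (x ∙ h ∙ x⁻¹) k'.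
Proof.
  induction 1 as [|y eps h k Hy He H [R' [k' IH]]].
  - exists 0, 0. replace (x ∙ one ∙ x⁻¹) with (one : G) by grp. constructor.
  - exists (Z.max R' (gapy (x ∙ y) one + 1)), (eps * wt (x ∙ y) + k').
    replace (x ∙ (rot y (eps * nz) ∙ h) ∙ x⁻¹) with (rot (x ∙ y) (eps * nz) ∙ (x ∙ h ∙ x⁻¹))
      by (rewrite rot_conj; grp).
    apply below_step; auto; [lia|]. eapply below_mono; [|exact IH]. lia.
Qed.

Lemma N_below h : N h <-> exists R k, below nz wt R h k.
Proof.
  split; [|intros [R [k H]]; eapply below_N; eauto].
  intros H. apply (H (fun h => exists R k, below nz wt R h k)).
  - split; [split; [|split]|].
    + exists 0, 0. constructor.
    + intros x y [R [k Hx]] [R' [k' Hy]]. exists (Z.max R R'), (k + k'). apply below_mul.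
      * eapply below_mono; [|exact Hx]. lia.
      * eapply below_mono; [|exact Hy]. lia.
    + intros x [R [k Hx]]. exists R, (- k). now apply below_inv.
    + intros x h' [R [k Hx]]. eapply below_conj; eauto.
  - intros s ->. exists 1, (1 * wt one).
    replace (npow g n) with (rot one (1 * nz)).
    2:{ unfold rotation. rewrite Z.mul_1_l, zpow_nat. grp. }
    apply below_gen; [|now left]. assert (E : gapy one one = 0) by (apply (gapy_zero CG), same_refl).
    lia.
Qed.
End Weight.

Lemma N_reducible h : N h -> reducible nz h.
Proof.
  rewrite (N_below (fun _ => 0)). intros [R [k H]].
  apply (below_reducible CG nz large_exponent (fun _ => 0) ltac:(auto) ltac:(auto) R h k H).
Qed.

(* Turning a segment at a coset that carries at least a 1/L share of the angle of an element of N. *)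
Definition bend (L : Z) (s s' : G) : Prop := exists y eps, (eps = 1 \/ eps = -1) /\
  nz - kap <= L * (eps * ang y one s) /\ s' = rot y (- eps * nz) ∙ s.
Notation bends L := (clos_refl_trans G (bend L)).

(** Angles at y add up along the polygon, so some side carries at least the average. *)
Lemma prod_side L y eps A l a : l <> nil -> A * Z.of_nat (length l) <= L * (eps * ang y a (a ∙ prod l)) ->
  exists l1 s l2, l = l1 ++ s :: l2 /\ A <= L * (eps * ang y (a ∙ prod l1) (a ∙ prod l1 ∙ s)).
Proof.
  revert a. induction l as [|s l IH]; intros a Hl H; [easy|].
  destruct (Z_le_dec A (L * (eps * ang y a (a ∙ s)))) as [K|K].
  { exists nil, s, l. split; auto. cbn. now rewrite mul_1r. }
  destruct l as [|s2 l].
  { exfalso. cbn [prod length] in H. rewrite mul_1r in H. lia. }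
  destruct (IH (a ∙ s)) as [l1 [s' [l2 [E H1]]]]; [easy| |].
  - cbn [length] in *. cbn [prod] in H. rewrite mul_assoc in H.
    rewrite <- (ang_add (c := c) y a (a ∙ s)) in H. cbn [prod]. lia.
  - exists (s :: l1), s', l2. split; [now rewrite E|]. cbn [prod]. now rewrite mul_assoc.
Qed.

(** Each turn in the reduction of the product is performed on one side: with p the product of the
    sides before s, rotating the whole product about y is the same as rotating s about p^-1 y. *)
Lemma polygon_bends L h : reducible nz h -> forall l, prod l = h -> Z.of_nat (length l) <= L ->
  exists l', Forall2 (bends L) l l' /\ prod l' = one.
Proof.
  destruct kap_small as [K1 [K2 K3]].
  induction 1 as [|h y eps He Ha H IH]; intros l El Hl.
  { exists l. split; auto. clear. induction l; constructor; auto. apply rt_refl. }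
  assert (Hne : l <> nil).
  { intros ->. cbn in El. subst h. rewrite ang_refl in Ha. lia. }
  destruct (prod_side L y eps (nz - kap) l one Hne) as [l1 [s [l2 [E HA]]]].
  { rewrite mul_1l, El. rewrite (Z.mul_comm (nz - kap)).
    pose proof (Z.mul_le_mono_nonneg (Z.of_nat (length l)) L (nz - kap) (eps * ang y one h)
      ltac:(lia) Hl ltac:(lia) Ha). exact H0. }
  rewrite !mul_1l in HA. set (p := prod l1) in *.
  pose (s' := rot (p⁻¹ ∙ y) (- eps * nz) ∙ s).
  destruct (IH (l1 ++ s' :: l2)) as [l' [F1 F2]].
  - rewrite <- El, E, !prod_app. cbn [prod]. fold p. unfold s'. rewrite rot_conj. grp.
  - rewrite <- Hl, E, !length_app. cbn. lia.
  - exists l'. split; auto. rewrite E. apply Forall2_app_inv_l in F1 as [a [b [F3 [F4 ->]]]].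
    apply Forall2_app; auto. inversion F4 as [|? t ? b' F5 F6]; subst. constructor; auto.
    eapply rt_trans; [|exact F5]. apply rt_step. exists (p⁻¹ ∙ y), eps. split; auto. split; auto.
    rewrite <- (ang_left p). now rewrite mul_Vr_r, mul_1r.
Qed.

(** A large angle makes the route through the coset a shortest one, and that route keeps its length
    under the rotation. *)
Lemma rot_len y m s : D < Z.abs (ang y one s) -> lh (rot y m ∙ s) <= lh s.
Proof.
  intros H. rewrite <- !dist_one_l. rewrite (angle_dist CG y one s H).
  pose proof (dist_via CG y one (rot y m ∙ s)) as K. now rewrite (gapy_rot CG) in K.
Qed.

Lemma bends_ind_inv L (P : G -> Prop) : (forall s s', bend L s s' -> P s -> P s') ->
  forall s s', bends L s s' -> P s -> P s'.
Proof. intros H. induction 1; eauto. Qed.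

Lemma bend_angle L s y eps : 0 < L <= 4 -> eps = 1 \/ eps = -1 -> nz - kap <= L * (eps * ang y one s) ->
  nz <= 5 * (eps * ang y one s).
Proof. destruct kap_small as [K1 [K2 K3]]. intros HL He H. nia. Qed.

Lemma bends_len L s s' : 0 < L <= 4 -> bends L s s' -> lh s' <= lh s.
Proof.
  intros HL H. apply (bends_ind_inv L (fun x => lh x <= lh s)) with s; auto; [|lia].
  intros a b [y [eps [He [HA ->]]]] Ha. etransitivity; [|exact Ha]. apply rot_len.
  pose proof (bend_angle L a y eps HL He HA). destruct kap_small as [K1 [K2 K3]].
  destruct He as [-> | ->]; lia.
Qed.

Context {Q : Group} {pi : G -> Q} (Hq : is_quotient N pi).

Lemma pi_hom : is_hom pi.
Proof. apply Hq. Qed.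

Lemma pi_eq a b : pi a = pi b <-> N (a⁻¹ ∙ b).
Proof.
  destruct Hq as [H1 [H2 H3]]. rewrite <- H3, H1, (hom_inv H1). split.
  - intros ->. apply mul_Vl.
  - intros E. apply eq_of_inv_mul in E. exact E.
Qed.

Lemma pi_rot y k : pi (rot y (k * nz)) = one.
Proof. destruct Hq as [H1 [H2 H3]]. apply H3, rot_in_N. Qed.

Lemma bends_pi L s s' : bends L s s' -> pi s' = pi s.
Proof.
  intros H. apply (bends_ind_inv L (fun x => pi x = pi s)) with s; auto.
  intros a b [y [eps [He [HA ->]]]] Ha. now rewrite pi_hom, pi_rot, mul_1l.
Qed.

Lemma polygon_lift L l : 0 < L <= 4 -> Z.of_nat (length l) <= L -> pi (prod l) = one ->
  exists l', Forall2 (bends L) l l' /\ prod l' = one.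
Proof.
  intros HL Hl H. destruct Hq as [H1 [H2 H3]]. apply H3 in H. apply N_reducible in H.
  eapply polygon_bends; eauto.
Qed.

(** Modulo g^n the coning generators become finite in number, so the coned-off metric of G descends
    to a word metric of Q ([len_pi], [len_lift]). *)
Definition quotient_gens : list Q := map pi S ++ map (fun i => pi (npow g i)) (seq 0 n).
Notation SQ := quotient_gens.
Notation lq := (len (sym_list SQ)).

Lemma pi_gen s : coned (sym_list S) g s -> sym_list SQ (pi s).
Proof.
  destruct kap_small as [K1 [K2 K3]].
  intros [[H|H]|[k ->]].
  - left. apply in_or_app. left. now apply in_map.
  - right. apply in_or_app. left. rewrite <- (hom_inv pi_hom). now apply in_map.
  - left. apply in_or_app. right. apply in_map_iff.
    exists (Z.to_nat (k mod nz)). pose proof (Z.mod_pos_bound k nz ltac:(lia)). split.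
    + rewrite (Z.div_mod k nz) at 2 by lia. rewrite <- zpow_nat, Z2Nat.id by lia.
      rewrite zpow_add, pi_hom. replace (zpow g (nz * (k / nz))) with (rot one (k / nz * nz)).
      { now rewrite pi_rot, mul_1l. } unfold rotation. rewrite Z.mul_comm. grp.
    + apply in_seq. lia.
Qed.

Lemma gen_lift q : sym_list SQ q -> exists s, coned (sym_list S) g s /\ pi s = q.
Proof.
  assert (H : forall q, In q SQ -> exists s, coned (sym_list S) g s /\ pi s = q).
  { intros x Hx. apply in_app_or in Hx as [Hx|Hx]; apply in_map_iff in Hx as [s [<- Hs]].
    - exists s. split; auto. left. now left.
    - exists (npow g s). split; auto. right. exists (Z.of_nat s). now rewrite zpow_nat. }
  intros [K|K]; [auto|]. destruct (H _ K) as [s [Hs E]]. exists s⁻¹. split; [now apply HU|].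
  now rewrite (hom_inv pi_hom), E, inv_inv.
Qed.

Lemma quotient_symgen : symgen (sym_list SQ).
Proof.
  split.
  - intros x [K|K]; [right; now rewrite inv_inv|now left].
  - intros q. destruct Hq as [_ [Hs _]]. destruct (Hs q) as [x <-].
    destruct HU as [_ HG]. destruct (HG x) as [w [Hw <-]]. exists (map pi w). split.
    + apply Forall_map. eapply Forall_impl; [|exact Hw]. apply pi_gen.
    + symmetry. apply (hom_prod pi_hom).
Qed.

Lemma len_pi a : lq (pi a) <= lh a.
Proof.
  destruct (len_word _ HU a) as [w [Hw [<- <-]]]. rewrite (hom_prod pi_hom), <- (length_map pi w).
  apply (len_le _ quotient_symgen). apply Forall_map. eapply Forall_impl; [|exact Hw]. apply pi_gen.
Qed.

Lemma len_lift q : exists a, pi a = q /\ lh a = lq q.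
Proof.
  destruct (len_word _ quotient_symgen q) as [w [Hw [E1 E2]]].
  assert (H : exists w', Forall (coned (sym_list S) g) w' /\ map pi w' = w).
  { clear E1 E2. induction Hw as [|x w Hx Hw [w' [IH1 IH2]]]; [exists nil; auto|].
    destruct (gen_lift x Hx) as [s [Hs Es]]. exists (s :: w'). split; [now constructor|]. cbn. now rewrite IH2, Es. }
  destruct H as [w' [Hw' Em]]. exists (prod w').
  assert (Ep : pi (prod w') = q) by now rewrite (hom_prod pi_hom), Em.
  split; auto. pose proof (len_le _ HU w' Hw') as H. pose proof (len_pi (prod w')) as H1.
  rewrite Ep in H1. rewrite <- Em, length_map in E1. lia.
Qed.

(** Lift the sides without changing lengths and bend them until they close up. Bending does not
    lengthen sides and pi does not lengthen diagonals, so the inequality in G passes down with the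
    same constant. *)
Lemma quotient_hyp : hyp (sym_list SQ) del.
Proof.
  intros x y z w. unfold dist.
  destruct (len_lift (x⁻¹ ∙ y)) as [s1 [P1 L1]], (len_lift (y⁻¹ ∙ z)) as [s2 [P2 L2]],
    (len_lift (z⁻¹ ∙ w)) as [s3 [P3 L3]], (len_lift (w⁻¹ ∙ x)) as [s4 [P4 L4]].
  destruct (polygon_lift 4 [s1; s2; s3; s4]) as [l [F E]]; [lia|cbn; lia| |].
  { rewrite (hom_prod pi_hom). cbn. rewrite P1, P2, P3, P4. grp. }
  inversion F as [|? t1 ? l1 B1 F1]; subst. inversion F1 as [|? t2 ? l2 B2 F2]; subst.
  inversion F2 as [|? t3 ? l3 B3 F3]; subst. inversion F3 as [|? t4 ? l4 B4 F4]; subst.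
  inversion F4; subst. cbn in E. rewrite mul_1r in E.
  pose proof (bends_len 4 s1 t1 ltac:(lia) B1) as M1. pose proof (bends_len 4 s2 t2 ltac:(lia) B2) as M2.
  pose proof (bends_len 4 s3 t3 ltac:(lia) B3) as M3. pose proof (bends_len 4 s4 t4 ltac:(lia) B4) as M4.
  apply bends_pi in B1, B2, B3, B4. rewrite P1 in B1. rewrite P2 in B2. rewrite P3 in B3. rewrite P4 in B4.
  pose proof (cg_hyp _ _ _ _ _ _ CG one t1 (t1 ∙ t2) (t1 ∙ t2 ∙ t3)) as HH. unfold dist in HH.
  replace (one⁻¹ ∙ (t1 ∙ t2)) with (t1 ∙ t2) in HH by grp.
  replace (one⁻¹ ∙ t1) with t1 in HH by grp.
  replace (t1⁻¹ ∙ (t1 ∙ t2)) with t2 in HH by grp.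
  replace (t1⁻¹ ∙ (t1 ∙ t2 ∙ t3)) with (t2 ∙ t3) in HH by grp.
  replace ((t1 ∙ t2)⁻¹ ∙ (t1 ∙ t2 ∙ t3)) with t3 in HH by grp.
  replace (lh (one⁻¹ ∙ (t1 ∙ t2 ∙ t3))) with (lh t4) in HH.
  2:{ rewrite <- (len_inv _ HU t4). f_equal. rewrite inv_one, mul_1l.
      apply (mul_cancel_r t4). rewrite mul_Vl, <- E. grp. }
  pose proof (len_pi (t1 ∙ t2)) as A1. pose proof (len_pi (t2 ∙ t3)) as A2.
  rewrite pi_hom, B1, B2 in A1. rewrite pi_hom, B2, B3 in A2.
  replace (x⁻¹ ∙ y ∙ (y⁻¹ ∙ z)) with (x⁻¹ ∙ z) in A1 by grp.
  replace (y⁻¹ ∙ z ∙ (z⁻¹ ∙ w)) with (y⁻¹ ∙ w) in A2 by grp.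
  replace (lq (x⁻¹ ∙ w)) with (lq (w⁻¹ ∙ x)).
  2:{ rewrite <- (len_inv _ quotient_symgen (w⁻¹ ∙ x)). now rewrite inv_mul, inv_inv. }
  lia.
Qed.

Lemma quotient_hyperbolic : hyperbolic (G := Q).
Proof.
  exists SQ. split.
  - intros q. destruct quotient_symgen as [_ HG]. destruct (HG q) as [w [Hw E]].
    exists (length w), w. auto.
  - exists (Z.to_nat del). intros x y z w a b c' d e' f. rewrite !(wdist_iff SQ quotient_symgen).
    intros. pose proof (quotient_hyp x y z w). pose proof (cg_del _ _ _ _ _ _ CG).
    symd quotient_symgen (x, y, z, w). lia.
Qed.

(** Powers of g have small angles at all cosets but <g>, so a reduction of g^r with 0 < r < n turns
    at <g>. It needs r >= n - kap and leads to g^(r - n), whose exponent is too small for another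
    turn. *)
Lemma zpow_N k : N (zpow g k) -> (nz | k).
Proof.
  intros H.
  assert (Hrem : forall r, 0 <= r < nz -> N (zpow g r) -> r = 0).
  { clear k H. intros r Hr H. destruct kap_small as [K1 [K2 K3]].
    assert (Hlow : forall i, i <> 0 -> reducible nz (zpow g i) ->
      nz - kap <= Z.abs i /\ (0 < i -> reducible nz (zpow g (i - nz)))).
    { intros i Hi Hred. inversion Hred as [E|h y eps He Ha Hh]; subst.
      - exfalso. apply Hi. apply (cg_inj _ _ _ _ _ _ CG). now rewrite <- E, zpow_0.
      - destruct (classic (~ same y one)) as [Es|Es].
        { pose proof (ang_coset CG y one i Es) as A. rewrite mul_1l in A. destruct He as [-> | ->]; lia. }
        apply NNPP in Es. rewrite <- (ang_same CG _ _ _ _ Es) in Ha. unfold angle in Ha.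
        rewrite inv_one, !mul_1l, (c_zpow CG) in Ha.
        rewrite <- (zpow_0 g), (c_zpow CG) in Ha.
        split; [destruct He as [-> | ->]; lia|]. intros Hp.
        assert (eps = 1) by (destruct He as [-> | ->]; lia). subst eps.
        rewrite <- (rot_same y one) in Hh by auto. unfold rotation in Hh.
        replace (i - nz) with (- (1) * nz + i) by lia. rewrite zpow_add. revert Hh. now grp. }
    destruct (Z.eq_dec r 0) as [E|E]; auto. exfalso.
    destruct (Hlow r E (N_reducible _ H)) as [H1 H2].
    destruct (Hlow (r - nz) ltac:(lia) (H2 ltac:(lia))) as [H3 _]. lia. }
  destruct kap_small as [K1 [K2 K3]].
  exists (k / nz). pose proof (Z.div_mod k nz ltac:(lia)) as E. pose proof (Z.mod_pos_bound k nz ltac:(lia)).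
  rewrite (Hrem (k mod nz)) in E; [lia|lia|].
  destruct (nclosure_normal (fun x : G => x = npow g n)) as [[H1 [H2 H3]] H4].
  replace (zpow g (k mod nz)) with (rot one (- (k / nz) * nz) ∙ zpow g k).
  { apply H2; auto. apply rot_in_N. }
  replace (k mod nz) with (- (k / nz) * nz + k) by lia. unfold rotation. rewrite zpow_add. grp.
Qed.

Lemma pi_zpow_one k : pi (zpow g k) = one <-> (nz | k).
Proof.
  destruct Hq as [H1 [H2 H3]]. rewrite H3. split; [apply zpow_N|].
  intros [i ->]. pose proof (rot_in_N one (i)) as H. unfold rotation in H. revert H. now grp.
Qed.

Lemma order_pi_g : elt_order (pi g) n.
Proof.
  destruct kap_small as [K1 [K2 K3]]. split; [lia|]. split.
  - rewrite <- (hom_npow pi_hom), <- zpow_nat. apply pi_zpow_one. exists 1. lia.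
  - intros m Hm E. rewrite <- (hom_npow pi_hom), <- zpow_nat in E. apply pi_zpow_one in E.
    apply Z.divide_pos_le in E; lia.
Qed.

End Quotient.

(** * Torsion in the quotient *)

Section Geodesics.
Context {G : Group} {S : list G} {g : G} {del D : Z} {e c : G -> Z}
  (CG : cone_geom (sym_list S) g del D e c).
Local Open Scope Z_scope.
Notation dh := (dist (coned (sym_list S) g)).
Notation lh := (len (coned (sym_list S) g)).
Notation theta := (2 * D).
Notation kap := (turn_defect del D).
Notation ang := (angle (c := c)).
Notation gapy := (coset_gap (e := e)).
Notation same := (same (g := g)).
Notation rot := (rotation (g := g)).
Let HU : symgen (coned (sym_list S) g) := coned_symgen _ (cg_gen _ _ _ _ _ _ CG) g.
Let D0 : 0 <= D := cg_D _ _ _ _ _ _ CG.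

(** By [angle_dist] the geodesic has length gap + 1 + gap, so after gap steps it stands on z<g> and
    its next edge runs along the coset. *)
Lemma geodesic_turn w z : Forall (coned (sym_list S) g) w -> Z.of_nat (length w) = lh (prod w) ->
  theta < Z.abs (ang z one (prod w)) ->
  exists w1 k w2, w = w1 ++ zpow g k :: w2 /\ same z (prod w1) /\
    Z.abs (k - ang z one (prod w)) <= theta /\ Z.of_nat (length w1) = gapy z one.
Proof.
  intros Hw Lw HA. rewrite <- dist_one_l in Lw.
  pose proof (angle_dist CG z one (prod w) ltac:(lia)) as E0.
  pose proof (gapy_nonneg CG z one) as P1. pose proof (gapy_nonneg CG z (prod w)) as P2.
  set (j := Z.to_nat (gapy z one)).
  assert (Hsplit : forall i, Forall (coned (sym_list S) g) (firstn i w) /\ Forall (coned (sym_list S) g) (skipn i w)).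
  { intros i. apply Forall_app. now rewrite firstn_skipn. }
  assert (Hvert : forall i, (i <= length w)%nat ->
     dh one (prod (firstn i w)) <= Z.of_nat i /\ dh (prod (firstn i w)) (prod w) <= Z.of_nat (length w - i)).
  { intros i Hi. split.
    - rewrite dist_one_l. pose proof (len_le _ HU (firstn i w) (proj1 (Hsplit i))) as K.
      rewrite length_firstn in K. lia.
    - unfold dist. rewrite <- (firstn_skipn i w) at 2. rewrite prod_app, mul_Vl_r.
      pose proof (len_le _ HU (skipn i w) (proj2 (Hsplit i))) as K. now rewrite length_skipn in K. }
  destruct (Hvert j ltac:(lia)) as [A1 A2]. destruct (Hvert (Datatypes.S j) ltac:(lia)) as [B1 B2].
  set (p := prod (firstn j w)) in *. set (p' := prod (firstn (Datatypes.S j) w)) in *.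
  pose proof (dist_tri _ HU one p (prod w)) as T1. pose proof (dist_tri _ HU one p' (prod w)) as T2.
  pose proof (gapy_nonneg CG z p) as P3. pose proof (gapy_nonneg CG z p') as P4.
  pose proof (ang_add (c := c) z one p (prod w)) as C1. pose proof (ang_add (c := c) z one p' (prod w)) as C2.
  assert (Hp : Z.abs (ang z one p) <= D).
  { apply Z.le_ngt. intros K. apply (angle_dist CG) in K. lia. }
  assert (Hp' : Z.abs (ang z p' (prod w)) <= D).
  { apply Z.le_ngt. intros K. apply (angle_dist CG) in K. lia. }
  pose proof (angle_dist CG z p (prod w) ltac:(lia)) as E1.
  pose proof (angle_dist CG z one p' ltac:(lia)) as E2.
  assert (S1 : same z p) by (apply (gapy_zero CG); lia).
  assert (S2 : same z p') by (apply (gapy_zero CG); lia).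
  destruct (same_trans _ _ _ (same_sym _ _ S1) S2) as [k Ek].
  destruct (nth_error w j) as [s|] eqn:Es.
  2:{ apply nth_error_None in Es. lia. }
  apply nth_error_split in Es as [w1 [w2 [Ew Lj]]].
  assert (F1 : firstn j w = w1).
  { rewrite Ew, firstn_app, <- Lj, Nat.sub_diag, firstn_all. apply app_nil_r. }
  assert (F2 : firstn (Datatypes.S j) w = w1 ++ [s]).
  { rewrite Ew, firstn_app, <- Lj, firstn_all2 by lia. now replace (Datatypes.S (length w1) - length w1)%nat with 1%nat by lia. }
  unfold p in *. unfold p' in *. rewrite F1 in *. rewrite F2, prod_app in *.
  cbn [prod] in *. rewrite mul_1r in *. apply mul_cancel_l in Ek. subst s.
  exists w1, k, w2. split; auto. split; auto. split; [|lia].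
  assert (Ea : ang z (prod w1) (prod w1 ∙ zpow g k) = k).
  { rewrite (ang_same CG _ _ _ _ (same_sym _ _ S1)). unfold angle.
    rewrite mul_Vl_r, mul_Vl, (c_zpow CG), <- (zpow_0 g), (c_zpow CG). lia. }
  pose proof (ang_add (c := c) z (prod w1) (prod w1 ∙ zpow g k) (prod w)). lia.
Qed.

(** A second quantity to minimize after the length: g^k and g^(k - n) both count as one letter, and
    only the exponents tell them apart. *)
Definition total_turn (w : list G) : Z := fold_right (fun s t => Z.abs (c s) + t) 0 w.

Lemma total_turn_app u v : total_turn (u ++ v) = total_turn u + total_turn v.
Proof.
  induction u as [|x u IH]; [reflexivity|]. cbn [app].
  change (Z.abs (c x) + total_turn (u ++ v) = Z.abs (c x) + total_turn u + total_turn v). lia.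
Qed.

Lemma total_turn_nonneg w : 0 <= total_turn w.
Proof. induction w as [|x w IH]; [reflexivity|]. change (0 <= Z.abs (c x) + total_turn w). lia. Qed.

Definition minimal_word (P : G -> Prop) (w : list G) : Prop :=
  Forall (coned (sym_list S) g) w /\ P (prod w) /\
  forall w', Forall (coned (sym_list S) g) w' -> P (prod w') ->
    (length w <= length w')%nat /\ (length w' = length w -> total_turn w <= total_turn w').

Lemma minimal_word_ex (P : G -> Prop) x : P x -> exists w, minimal_word P w.
Proof.
  intros Hx. destruct (len_word _ HU x) as [w0 [H0 [_ E0]]]. subst x.
  destruct (exists_argmin w0 (fun w => Forall (coned (sym_list S) g) w /\ P (prod w))
     (fun w => Z.of_nat (length w))) as [w1 [[H1 P1] M1]]; auto; [intros; lia|].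
  destruct (exists_argmin w1 (fun w => Forall (coned (sym_list S) g) w /\ P (prod w) /\ length w = length w1)
     total_turn) as [w [[H2 [P2 L2]] M2]]; auto; [apply total_turn_nonneg|].
  exists w. split; auto. split; auto. intros w' H' P'. specialize (M1 w' (conj H' P')). split; [lia|].
  intros E. apply M2. split; auto. split; auto. congruence.
Qed.

Lemma minimal_word_len P w : minimal_word P w ->
  Z.of_nat (length w) = lh (prod w) /\ forall x, P x -> Z.of_nat (length w) <= lh x.
Proof.
  intros [H1 [H2 H3]].
  assert (K : forall x, P x -> Z.of_nat (length w) <= lh x).
  { intros x Hx. destruct (len_word _ HU x) as [w' [Hw' [L E]]]. subst x. destruct (H3 w' Hw' Hx). lia. }
  split; auto. pose proof (len_le _ HU w H1). pose proof (K _ H2). lia.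
Qed.

(** If u is not in <g>, the coset u<g> has bounded angle at <g>; but u g^m = g^m u, for multiples m
    of k, shifts the coordinate by m. *)
Lemma commuting_power u k : k <> 0 -> u ∙ zpow g k = zpow g k ∙ u -> exists m, u = zpow g m.
Proof.
  intros Hk E. apply NNPP. intros H.
  assert (Hs : ~ same one u) by (intros [m Em]; apply H; exists m; now rewrite Em, mul_1l).
  pose proof (ang_coset CG one u (k * (D + 1)) Hs) as A.
  rewrite <- zpow_mul, (zpow_commute _ _ _ E), zpow_mul in A. unfold angle in A.
  rewrite inv_one, !mul_1l, (c_shift CG) in A.
  assert (1 <= Z.abs k) by lia. pose proof (Z.mul_le_mono_nonneg_r 1 (Z.abs k) (D + 1) ltac:(lia) ltac:(lia)) as A1.
  rewrite <- (Z.abs_eq (D + 1)) in A1 at 2 by lia. rewrite <- Z.abs_mul in A1. lia.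
Qed.

Context (n : nat) (Hn : 1000 * (orbit_bound del D + D + 1) <= Z.of_nat n).
Notation nz := (Z.of_nat n).
Notation N := (nclosure (fun x : G => x = npow g n)).

(** An edge g^k with |k| > n/2 could be replaced by g^(k - n) or g^(k + n), which multiplies the
    product by a rotation in N. The 4 D is twice the error theta of [geodesic_turn]. *)
Lemma minimal_word_tame P w : (forall x a, N x -> P a -> P (x ∙ a)) -> minimal_word P w ->
  forall z, 2 * Z.abs (ang z one (prod w)) <= nz + 4 * D.
Proof.
  intros HP Hm z. destruct (minimal_word_len P w Hm) as [L _]. destruct Hm as [H1 [H2 H3]].
  destruct (kap_small CG n Hn) as [K1 [K2 K3]].
  destruct (Z_le_dec (Z.abs (ang z one (prod w))) theta) as [K|K]; [lia|].
  destruct (geodesic_turn w z H1 L ltac:(lia)) as [w1 [k [w2 [Ew [Hs [Hk _]]]]]].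
  enough (2 * Z.abs k <= nz) by lia. apply Z.le_ngt. intros Hbig.
  pose (eps := if Z_le_dec k 0 then -1 else 1).
  assert (Hlt : Z.abs (k - eps * nz) < Z.abs k) by (unfold eps; destruct (Z_le_dec k 0); lia).
  destruct (H3 (w1 ++ zpow g (k - eps * nz) :: w2)) as [_ M].
  - rewrite Ew in H1. apply Forall_app in H1 as [F1 F2]. apply Forall_app. split; auto.
    inversion F2; subst. constructor; auto. right. eauto.
  - replace (prod (w1 ++ zpow g (k - eps * nz) :: w2)) with (rot (prod w1) (- eps * nz) ∙ prod w).
    { apply HP; auto. apply rot_in_N. }
    rewrite Ew, !prod_app. cbn [prod]. unfold rotation.
    replace (k - eps * nz) with (- eps * nz + k) by lia. rewrite zpow_add. grp.
  - specialize (M ltac:(now rewrite Ew, !length_app)). rewrite Ew, !total_turn_app in M. cbn [total_turn fold_right] in M.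
    change (fold_right (fun s t => Z.abs (c s) + t) 0 w2) with (total_turn w2) in M.
    rewrite !(c_zpow CG) in M. lia.
Qed.

Context {Q : Group} {pi : G -> Q} (Hq : is_quotient N pi).

Lemma tame_lift q : exists b, pi b = q /\ forall z, 2 * Z.abs (ang z one b) <= nz + 4 * D.
Proof.
  destruct Hq as [H1 [H2 H3]]. destruct (H2 q) as [x Hx].
  destruct (minimal_word_ex (fun b => pi b = q) x Hx) as [w Hw]. exists (prod w). split; [apply Hw|].
  apply (minimal_word_tame (fun b => pi b = q)); auto. intros y a Hy Ha. apply H3 in Hy. now rewrite H1, Hy, mul_1l.
Qed.

Context (tf : torsion_free (G := G)).

Lemma coset_stabilizer h z j : h <> one -> j <> 0 -> same z (zpow h j ∙ z) -> exists m, h = rot z m.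
Proof.
  intros Hh Hj [k E].
  assert (E1 : zpow (z⁻¹ ∙ h ∙ z⁻¹⁻¹) j = zpow g k).
  { rewrite zpow_conj, inv_inv, mulA_r, E. now rewrite mul_Vl_r. }
  set (u := z⁻¹ ∙ h ∙ z⁻¹⁻¹) in *.
  assert (Hu : u <> one).
  { intros K. apply Hh. apply (mul_cancel_l z⁻¹). apply (mul_cancel_r z⁻¹⁻¹). fold u. rewrite K. grp. }
  assert (Hk : k <> 0).
  { intros ->. rewrite zpow_0 in E1. apply Hj. apply (torsion_free_zpow tf u j Hu E1). }
  destruct (commuting_power u k Hk) as [m Em].
  { rewrite <- E1. now apply zpow_commute. }
  exists m. unfold rotation. rewrite <- Em. unfold u. grp.
Qed.

(** * Powers of an element that is shortest among its conjugates *)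

Section ShortConjugate.
Context (w : list G) (Hw : Forall (coned (sym_list S) g) w).
Notation h := (prod w).
Context (Hlen : Z.of_nat (length w) = lh h)
  (Hmin : forall x, Z.of_nat (length w) <= dh x (h ∙ x))
  (Hfree : forall z j, j <> 0 -> ~ same z (zpow h j ∙ z)).

Lemma same_dist x y : same x y -> dh x y <= 1.
Proof. apply (dist_same_le CG). Qed.

(** If two consecutive copies of w turn at z after prefixes w1 and w1', then |w| = |w1| + 1 + |w1'|,
    and h moves the end of the shorter prefix by less than |w| unless that prefix is empty. In the
    remaining cases h or h^2 fixes z<g>, or the power of g that starts w can be conjugated away. *)
Lemma no_consecutive_turns z : theta < Z.abs (ang z one h) -> theta < Z.abs (ang z h (h ∙ h)) -> False.
Proof.
  intros A1 A2.
  assert (A2' : theta < Z.abs (ang (h⁻¹ ∙ z) one h)) by (rewrite <- (ang_left h), mul_Vr_r, mul_1r; exact A2).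
  destruct (geodesic_turn w z Hw Hlen A1) as [w1 [k [w2 [E1 [S1 [_ L1]]]]]].
  destruct (geodesic_turn w (h⁻¹ ∙ z) Hw Hlen A2') as [w1' [k' [w2' [E2 [S2 [_ L2]]]]]].
  apply (same_left h) in S2. rewrite mul_Vr_r in S2.
  assert (Ll : (length w = length w1 + 1 + length w1')%nat).
  { pose proof (angle_dist CG z one h ltac:(lia)) as K. rewrite dist_one_l, <- Hlen in K.
    rewrite <- (gapy_left h⁻¹ z h), mul_Vl in K. lia. }
  assert (Lw2 : length w2 = length w1').
  { rewrite E1, length_app in Ll. cbn in Ll. lia. }
  assert (Lw2' : length w2' = length w1).
  { rewrite E2, length_app in Ll. cbn in Ll. lia. }
  assert (Pre : forall a b a' b' : list G, a ++ b = a' ++ b' -> (length a' <= length a)%nat ->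
     exists v, a = a' ++ v).
  { intros a b a' b' E Hl. exists (skipn (length a') a). rewrite <- (firstn_skipn (length a') a) at 1. f_equal.
    pose proof (f_equal (firstn (length a')) E) as K. rewrite !firstn_app, Nat.sub_diag, firstn_all in K.
    replace (length a' - length a)%nat with 0%nat in K by lia. now rewrite !app_nil_r in K. }
  assert (Fsub : forall u v x, w = u ++ x ++ v -> dh (prod u) (prod u ∙ prod x) <= Z.of_nat (length x)).
  { intros u v x E. rewrite <- (mul_1r _ (prod u)) at 1. rewrite dist_left, dist_one_l.
    apply (len_le _ HU). rewrite E in Hw. apply Forall_app in Hw as [_ Hw']. now apply Forall_app in Hw' as [Hw' _]. }
  assert (S3 : same (prod w1) (h ∙ prod w1')) by (eapply same_trans; [apply same_sym|]; eauto).
  pose proof (same_dist _ _ S3) as D3.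
  destruct (le_lt_dec (length w1') (length w1)) as [Hc|Hc].
  - destruct (Pre _ _ _ _ (eq_trans (eq_sym E1) E2) Hc) as [v Ev].
    pose proof (Fsub w1' (zpow g k :: w2) v ltac:(rewrite E1, Ev, <- app_assoc; auto)) as D4.
    rewrite <- prod_app, <- Ev in D4. pose proof (Hmin (prod w1')) as M.
    pose proof (dist_tri _ HU (prod w1') (prod w1) (h ∙ prod w1')). rewrite Ev, length_app in *.
    assert (length w1' = 0)%nat by lia. destruct w1'; [|easy]. destruct w2; [|easy]. cbn in Ev. subst v.
    cbn [app] in *. cbn [prod] in S2. rewrite mul_1r in S2.
    destruct w1 as [|x w1].
    + apply (Hfree z 1); [lia|]. rewrite zpow_1. cbn [prod] in S1.
      eapply same_trans; [exact S2|]. apply same_sym. rewrite <- (mul_1r _ h) at 2. now apply same_left.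
    + pose proof (Fsub [x] [zpow g k] w1 E1) as D6.
      assert (Ex : x = zpow g k') by (rewrite E2 in E1; cbn [app] in E1; now injection E1). subst x.
      cbn [prod] in D6. rewrite mul_1r in D6.
      pose proof (Hmin (zpow g k')) as M2.
      assert (S4 : same (prod (zpow g k' :: w1)) (h ∙ zpow g k')).
      { eapply same_trans; [apply same_sym; exact S1|]. eapply same_trans; [exact S2|]. apply same_zpow. }
      pose proof (same_dist _ _ S4) as D5.
      pose proof (dist_tri _ HU (zpow g k') (prod (zpow g k' :: w1)) (h ∙ zpow g k')) as T5.
      change (prod (zpow g k' :: w1)) with (zpow g k' ∙ prod w1) in *. cbn [length] in *. lia.
  - destruct (Pre _ _ _ _ (eq_trans (eq_sym E2) E1) ltac:(lia)) as [v Ev].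
    pose proof (Fsub w1 (zpow g k' :: w2') v ltac:(rewrite E2, Ev, <- app_assoc; auto)) as D4.
    rewrite <- prod_app, <- Ev in D4. pose proof (Hmin (prod w1)) as M.
    pose proof (dist_tri _ HU (prod w1) (h ∙ prod w1') (h ∙ prod w1)) as T4. rewrite dist_left in T4.
    rewrite (dist_sym _ HU (prod w1') (prod w1)) in T4.
    pose proof (f_equal (@length G) Ev) as Lv. rewrite length_app in Lv.
    assert (length w1 = 0)%nat by lia. destruct w1; [|easy]. destruct w2'; [|easy].
    cbn [prod] in S1.
    assert (Eh : h = prod w1' ∙ zpow g k') by (rewrite E2, prod_app; cbn [prod]; now rewrite mul_1r).
    apply (Hfree z 2); [lia|].
    assert (S5 : same z (zpow h 2)).
    { eapply same_trans; [exact S2|]. exists k'. change 2 with (Z.succ 1). rewrite zpow_succ, zpow_1.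
      now rewrite Eh at 2; rewrite mul_assoc. }
    eapply same_trans; [exact S5|]. apply same_sym. rewrite <- (mul_1r _ (zpow h 2)) at 2. now apply same_left.
Qed.

(** If h^j avoids both coordinates, [angle_order] makes z<g> closer to h^j than to h^(j-1) and
    h^(j+1). These two then do have coordinates near those of h^-1 z and h z, so there are turns at
    z both before and after h^j. *)
Lemma power_coordinate_near z j :
  Z.abs (c (z⁻¹ ∙ zpow h j) - c (z⁻¹ ∙ (h ∙ z))) <= 2 * theta \/
  Z.abs (c (z⁻¹ ∙ zpow h j) - c (z⁻¹ ∙ (h⁻¹ ∙ z))) <= 2 * theta.
Proof.
  apply NNPP. intros H. apply not_or_and in H as [H1 H2].
  assert (Hs1 : ~ same z (h ∙ z)) by (pose proof (Hfree z 1 ltac:(lia)) as K; now rewrite zpow_1 in K).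
  assert (Hs2 : ~ same z (h⁻¹ ∙ z)).
  { intros K. apply (same_left h) in K. rewrite mul_Vr_r in K. apply Hs1. now apply same_sym. }
  assert (Hshift : forall i j, zpow h i ∙ zpow h j = zpow h (i + j)) by (intros; now rewrite zpow_add).
  assert (Hr : forall j, gapy (h ∙ z) (zpow h j) = gapy z (zpow h (j - 1)) /\
     gapy (h⁻¹ ∙ z) (zpow h j) = gapy z (zpow h (j + 1))).
  { intros i. split.
    - rewrite <- (gapy_left h⁻¹), mul_Vl_r. f_equal. rewrite <- (zpow_1 h) at 1. rewrite zpow_opp, Hshift. f_equal. lia.
    - rewrite <- (gapy_left h), mul_Vr_r. f_equal. rewrite <- (zpow_1 h) at 1. rewrite Hshift. f_equal. lia. }
  pose proof (Hr j) as [R1 R2].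
  pose proof (angle_order CG z (h ∙ z) (zpow h j) Hs1) as O1.
  pose proof (angle_order CG z (h⁻¹ ∙ z) (zpow h j) Hs2) as O2.
  unfold angle in O1, O2. specialize (O1 ltac:(lia)). specialize (O2 ltac:(lia)).
  pose proof (angle_order CG z (h ∙ z) (zpow h (j + 1)) Hs1) as O3.
  pose proof (angle_order CG z (h⁻¹ ∙ z) (zpow h (j - 1)) Hs2) as O4.
  rewrite (proj1 (Hr (j + 1))) in O3. rewrite (proj2 (Hr (j - 1))) in O4. unfold angle in O3, O4.
  replace (j + 1 - 1) with j in O3 by lia. replace (j - 1 + 1) with j in O4 by lia.
  apply (no_consecutive_turns (zpow h (- (j - 1)) ∙ z)).
  - rewrite <- (ang_left (zpow h (j - 1))), mul_assoc, Hshift.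
    replace (j - 1 + - (j - 1)) with 0 by lia. rewrite zpow_0, mul_1l, mul_1r.
    replace (zpow h (j - 1) ∙ h) with (zpow h j).
    2:{ rewrite <- (zpow_1 h) at 3. rewrite Hshift. f_equal. lia. }
    unfold angle. lia.
  - rewrite <- (ang_left (zpow h (j - 1))), !mul_assoc, Hshift.
    replace (j - 1 + - (j - 1)) with 0 by lia. rewrite zpow_0, mul_1l.
    replace (zpow h (j - 1) ∙ h) with (zpow h j).
    2:{ rewrite <- (zpow_1 h) at 3. rewrite Hshift. f_equal. lia. }
    replace (zpow h j ∙ h) with (zpow h (j + 1)).
    2:{ rewrite <- (zpow_1 h) at 3. now rewrite Hshift. }
    unfold angle. lia.
Qed.

Context (B : Z) (HB : forall z, Z.abs (ang z one h) <= B).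

(** The coordinate at z stays near one of two values. Steps of size at most B cannot jump between
    them unless the values are close. *)
Lemma power_angle z j : 0 <= j -> Z.abs (ang z one (zpow h j)) <= B + 8 * theta.
Proof.
  pose proof D0 as HD.
  set (a := c (z⁻¹ ∙ (h ∙ z))). set (b := c (z⁻¹ ∙ (h⁻¹ ∙ z))).
  set (f := fun j => c (z⁻¹ ∙ zpow h j)).
  assert (Hnear : forall j, Z.abs (f j - a) <= 2 * theta \/ Z.abs (f j - b) <= 2 * theta).
  { intros i. apply power_coordinate_near. }
  assert (Hstep : forall j, Z.abs (f (Z.succ j) - f j) <= B).
  { intros i. unfold f. pose proof (HB (zpow h (- i) ∙ z)) as K.
    rewrite <- (ang_left (zpow h i)), mul_assoc, <- zpow_add, mul_1r in K.
    replace (i + - i) with 0 in K by lia. rewrite zpow_0, mul_1l in K.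
    replace (zpow h i ∙ h) with (zpow h (Z.succ i)) in K; [exact K|].
    unfold Z.succ. now rewrite zpow_add, zpow_1. }
  assert (HB0 : 0 <= B) by (pose proof (HB one); lia).
  assert (Ef : ang z one (zpow h j) = f j - f 0) by (unfold f, angle; now rewrite zpow_0).
  rewrite Ef. clear Ef. clearbody f a b.
  destruct (Z_le_dec (Z.abs (a - b)) (B + 4 * theta)) as [K|K].
  - intros _. pose proof (Hnear j). pose proof (Hnear 0). lia.
  - intros Hj.
    assert (H0 : Z.abs (f 0 - a) <= 2 * theta /\ Z.abs (f j - a) <= 2 * theta \/
       Z.abs (f 0 - b) <= 2 * theta /\ Z.abs (f j - b) <= 2 * theta); [|lia].
    pattern j. apply natlike_ind; auto.
    + destruct (Hnear 0); auto.
    + intros i _ IH. pose proof (Hstep i). pose proof (Hnear (Z.succ i)). lia.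
Qed.

End ShortConjugate.
(** A shortest representative of the conjugacy class modulo N that is not a rotation has all angles
    of its positive powers below n - kap, so none of these powers is reducible. *)
Lemma torsion_conjugate (q : Q) i : 0 < i -> zpow q i = one -> exists x m, q = x ∙ zpow (pi g) m ∙ x⁻¹.
Proof.
  intros Hi Eq. destruct Hq as [P1 [P2 P3]].
  set (P := fun a => exists x, pi a = x ∙ q ∙ x⁻¹).
  assert (HP0 : exists a, P a).
  { destruct (P2 q) as [a Ha]. exists a, one. rewrite Ha. grp. }
  destruct HP0 as [a0 Ha0]. destruct (minimal_word_ex P a0 Ha0) as [w Hm].
  destruct (minimal_word_len P w Hm) as [Hlen Hmin]. pose proof Hm as [Hw [[x0 Ex0] _]].
  destruct (classic (exists z m, prod w = rot z m)) as [[z [m Em]]|Hnc].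
  { exists (x0⁻¹ ∙ pi z), m. replace q with (x0⁻¹ ∙ pi (prod w) ∙ x0) by (rewrite Ex0; grp).
    rewrite Em. unfold rotation. rewrite !P1, (hom_inv P1), (hom_zpow P1). grp. }
  destruct (classic (prod w = one)) as [E1|E1].
  { exfalso. apply Hnc. exists one, 0. rewrite E1. symmetry. apply rot_0. }
  exfalso.
  assert (Hfree : forall z j, j <> 0 -> ~ same z (zpow (prod w) j ∙ z)).
  { intros z j Hj Hs. apply Hnc. destruct (coset_stabilizer _ z j E1 Hj Hs) as [m Em]. eauto. }
  assert (Hconj : forall x, Z.of_nat (length w) <= dh x (prod w ∙ x)).
  { intros x. apply Hmin. exists (pi x⁻¹ ∙ x0). rewrite !P1, Ex0, !(hom_inv P1). grp. }
  assert (HB : forall z, Z.abs (ang z one (prod w)) <= (nz + 4 * D) / 2).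
  { intros z. apply Z.div_le_lower_bound; [lia|]. apply (minimal_word_tame P w); auto.
    intros x a Hx [y Hy]. exists y. apply P3 in Hx. now rewrite P1, Hx, mul_1l. }
  assert (HN : N (zpow (prod w) i)).
  { apply P3. rewrite (hom_zpow P1), Ex0, zpow_conj, Eq. grp. }
  apply (N_reducible CG n Hn) in HN. destruct (kap_small CG n Hn) as [K1 [K2 K3]].
  inversion HN as [E|h' y eps He HA _]; subst.
  - apply (Hfree one i); [lia|]. rewrite <- E, mul_1l. apply same_refl.
  - pose proof (power_angle w Hw Hlen Hconj Hfree _ HB y i ltac:(lia)) as K.
    pose proof (Z.mul_div_le (nz + 4 * D) 2 ltac:(lia)). destruct He as [-> | ->]; lia.
Qed.

Context (Hprime : prime nz).

Lemma torsion_order (q : Q) : q <> one -> elt_order q n \/ infinite_order q.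
Proof.
  intros Hq1. destruct (classic (infinite_order q)) as [K|K]; auto. left.
  apply not_all_ex_not in K as [i K]. apply imply_to_and in K as [Hi K]. apply NNPP in K.
  destruct (torsion_conjugate q (Z.of_nat i)) as [x [m E]]; [lia|now rewrite zpow_nat|].
  assert (Hpow : forall j, zpow q j = one <-> (nz | m * j)).
  { intros j. rewrite E, zpow_conj, zpow_mul, <- (hom_zpow (pi_hom n Hq)), <- (pi_zpow_one CG n Hn Hq). split.
    - intros H. apply (mul_cancel_l x). apply (mul_cancel_r x⁻¹). rewrite H. grp.
    - intros ->. grp. }
  assert (Hm : ~ (nz | m)).
  { intros H. apply Hq1. rewrite <- (zpow_1 q). apply Hpow. now rewrite Z.mul_1_r. }
  destruct Hprime as [H1 _]. split; [lia|]. split.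
  - rewrite <- zpow_nat. apply Hpow. now exists m.
  - intros j Hj H. rewrite <- zpow_nat in H. apply Hpow in H.
    apply (prime_mult _ Hprime) in H as [H|H]; [auto|]. apply Z.divide_pos_le in H; lia.
Qed.

End Geodesics.

(** * Infinite conjugacy classes *)

Section Axis.
Context {G : Group} {S : list G} {g : G} {del D : Z} {e c : G -> Z}
  (CG : cone_geom (sym_list S) g del D e c).
Local Open Scope Z_scope.
Notation dh := (dist (coned (sym_list S) g)).
Notation lh := (len (coned (sym_list S) g)).
Notation theta := (2 * D).
Notation kap := (turn_defect del D).
Notation ang := (angle (c := c)).
Notation gapy := (coset_gap (e := e)).
Notation same := (same (g := g)).
Notation rot := (rotation (g := g)).
Let HU : symgen (coned (sym_list S) g) := coned_symgen _ (cg_gen _ _ _ _ _ _ CG) g.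
Let D0 : 0 <= D := cg_D _ _ _ _ _ _ CG.

Lemma ang_zpow z k : Z.abs (ang z one (zpow g k)) <= D + Z.abs k.
Proof.
  destruct (classic (same z one)) as [Es|Es].
  - rewrite <- (ang_same CG _ _ _ _ Es). unfold angle.
    rewrite inv_one, !mul_1l, (c_zpow CG), <- (zpow_0 g), (c_zpow CG). lia.
  - pose proof (ang_coset CG z one k Es) as A. rewrite mul_1l in A. lia.
Qed.

Lemma ang_left_one z a b : ang z a (a ∙ b) = ang (a⁻¹ ∙ z) one b.
Proof. now rewrite <- (ang_left a (a⁻¹ ∙ z)), mul_Vr_r, mul_1r. Qed.

Lemma ang_letter z s : coned (sym_list S) g s -> Z.abs (ang z one s) <= D + Z.abs (c s).
Proof.
  intros Hs. destruct (Z_le_dec (Z.abs (ang z one s)) D) as [K|K]; [lia|].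
  pose proof (angle_dist CG z one s ltac:(lia)) as E. rewrite dist_one_l in E.
  pose proof (len_gen _ HU s Hs). pose proof (gapy_nonneg CG z one). pose proof (gapy_nonneg CG z s).
  assert (S1 : same z one) by (apply (gapy_zero CG); lia). assert (S2 : same z s) by (apply (gapy_zero CG); lia).
  destruct (same_trans _ _ _ (same_sym _ _ S1) S2) as [k Ek]. rewrite mul_1l in Ek. subst s.
  pose proof (ang_zpow z k). rewrite (c_zpow CG). lia.
Qed.

Lemma ang_bounded b : exists B, forall z, Z.abs (ang z one b) <= B.
Proof.
  destruct (len_word _ HU b) as [w [Hw [_ <-]]]. induction Hw as [|s w Hs Hw [B IH]].
  - exists 0. intros z. cbn [prod]. rewrite ang_refl. lia.
  - exists (D + Z.abs (c s) + B). intros z. cbn [prod]. pose proof (ang_letter z s Hs).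
    specialize (IH (s⁻¹ ∙ z)). rewrite <- ang_left_one in IH. pose proof (ang_add (c := c) z one s (s ∙ prod w)). lia.
Qed.

(** A power of g on the left moves c t by its exponent and c t^-1 by at most D, which separates t^-1
    from t at <g>. *)
Lemma axis_ex y : ~ same one y -> exists t, ~ same one t /\ 4 * theta < c t - c t⁻¹.
Proof.
  intros Hy. exists (zpow g (c y⁻¹ - c y + D + 4 * theta + 1) ∙ y).
  set (A := c y⁻¹ - c y + D + 4 * theta + 1). split.
  - intros [k E]. apply Hy. exists (- A + k). apply (mul_cancel_l (zpow g A)). rewrite E. grpz.
  - rewrite (c_shift CG), inv_mul, zpow_opp.
    assert (Hy' : ~ same one y⁻¹).
    { intros [k E]. apply Hy. exists (- k). rewrite mul_1l in *. rewrite <- (inv_inv y), E. now rewrite zpow_opp. }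
    pose proof (ang_coset CG one y⁻¹ (- A) Hy') as K. unfold angle in K. rewrite inv_one, !mul_1l in K. unfold A in *. lia.
Qed.

Section Powers.
Context (t : G) (Ht : ~ same one t) (Ht4 : 4 * theta < Z.abs (c t - c t⁻¹)).

Lemma ang_power i a b : ang (zpow t i) (zpow t a) (zpow t b) = c (zpow t (b - i)) - c (zpow t (a - i)).
Proof. unfold angle. rewrite zpow_opp, <- !zpow_add. f_equal; do 2 f_equal; lia. Qed.

Lemma not_same_succ i : ~ same (zpow t i) (zpow t (i + 1)).
Proof.
  intros H. apply Ht. apply (same_left (zpow t i)). rewrite mul_1r. now rewrite zpow_add, zpow_1 in H.
Qed.

(** Induction with Behrstock: t<g> separates 1 from the next power of t, which from <g> therefore
    looks like t. *)
Lemma power_coordinate i : 1 <= i -> Z.abs (c (zpow t i) - c t) <= theta.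
Proof.
  pose proof D0 as HD. intros Hi. replace i with (1 + (i - 1)) by lia.
  assert (Hj : 0 <= i - 1) by lia. revert Hj. generalize (i - 1) as j. clear i Hi.
  intros j Hj. pattern j. apply natlike_ind; auto.
  - rewrite Z.add_0_r, zpow_1. lia.
  - clear j Hj. intros j Hj IH.
    pose proof (behrstock0 CG one t (zpow t (1 + Z.succ j)) Ht) as B.
    pose proof (ang_power 1 (1 + Z.succ j) 0) as E. rewrite zpow_1, zpow_0 in E.
    replace (1 + Z.succ j - 1) with (1 + j) in E by lia.
    change (0 - 1) with (-1) in E. replace (zpow t (-1)) with t⁻¹ in E by (rewrite <- (zpow_1 t) at 1; now rewrite zpow_opp).
    specialize (B ltac:(lia)). unfold angle in B. rewrite inv_one, !mul_1l in B. lia.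
Qed.

Lemma power_gap i : 1 <= i -> i <= gapy one (zpow t i).
Proof.
  pose proof D0 as HD. intros Hi. replace i with (1 + (i - 1)) by lia.
  assert (Hj : 0 <= i - 1) by lia. revert Hj. generalize (i - 1) as j. clear i Hi.
  intros j Hj. pattern j. apply natlike_ind; auto.
  - rewrite Z.add_0_r, zpow_1. now apply (gapy_pos CG).
  - clear j Hj. intros j Hj IH.
    pose proof (angle_order CG t one (zpow t (1 + Z.succ j))) as B.
    pose proof (ang_power 1 (1 + Z.succ j) 0) as E. rewrite zpow_1, zpow_0 in E.
    replace (1 + Z.succ j - 1) with (1 + j) in E by lia.
    change (0 - 1) with (-1) in E. replace (zpow t (-1)) with t⁻¹ in E by (rewrite <- (zpow_1 t) at 1; now rewrite zpow_opp).
    pose proof (power_coordinate (1 + j) ltac:(lia)).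
    specialize (B ltac:(intros X; apply Ht; now apply same_sym) ltac:(lia)).
    replace (zpow t (1 + Z.succ j)) with (t ∙ zpow t (1 + j)) in B at 1.
    2:{ rewrite <- (zpow_1 t) at 1. rewrite <- zpow_add. f_equal. lia. }
    rewrite <- (mul_1r _ t) in B at 1. rewrite gapy_left in B. lia.
Qed.
End Powers.

Section PowerAngles.
Context (t : G) (Ht : ~ same one t) (Ht4 : 4 * theta < Z.abs (c t - c t⁻¹)).

Lemma power_angle_between i M : 0 < i < M -> 2 * theta < Z.abs (ang (zpow t i) one (zpow t M)).
Proof.
  intros Hi. pose proof (ang_power t i 0 M) as E. rewrite zpow_0 in E. rewrite E.
  pose proof (power_coordinate t Ht Ht4 (M - i) ltac:(lia)).
  assert (Ht' : ~ same one t⁻¹).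
  { intros X. apply Ht. apply same_sym. apply (same_left t) in X. now rewrite mul_Vr, mul_1r in X. }
  pose proof (power_coordinate t⁻¹ Ht' ltac:(rewrite inv_inv; lia) i ltac:(lia)) as K.
  replace (zpow t⁻¹ i) with (zpow t (0 - i)) in K; [lia|].
  rewrite <- (zpow_1 t) at 2. rewrite zpow_opp, zpow_mul. reflexivity.
Qed.

(** Walk along 1, t, ..., t^M. At each intermediate t^m<g> other than z<g> the points 1 and t^M are
    so far apart that z is separated from one of them: from 1, and the angle is still small, or from
    t^M, and the final angle is settled. *)
Lemma powers_angle_bounded : exists B, forall z M, 0 <= M -> Z.abs (ang z one (zpow t M)) <= B.
Proof.
  pose proof D0 as HD. destruct (ang_bounded t) as [B HB]. exists (2 * B + 2 * theta). intros z M HM.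
  set (f := fun m => ang z one (zpow t m)).
  assert (Hstep : forall m, Z.abs (f (Z.succ m) - f m) <= B).
  { intros m. unfold f, Z.succ. rewrite zpow_add, zpow_1. pose proof (HB ((zpow t m)⁻¹ ∙ z)) as K.
    rewrite <- ang_left_one in K. pose proof (ang_add (c := c) z one (zpow t m) (zpow t m ∙ t)). lia. }
  assert (HB0 : 0 <= B) by (pose proof (HB one); lia).
  assert (K : forall m, 0 <= m -> m <= M -> Z.abs (f m) <= theta \/
     (same z (zpow t m) /\ Z.abs (f m) <= theta + B) \/ Z.abs (f M) <= 2 * B + 2 * theta).
  { intros m Hm. pattern m. apply natlike_ind; auto.
    - left. unfold f. rewrite zpow_0, ang_refl. lia.
    - clear m Hm. intros m Hm IH HmM. pose proof (Hstep m).
      destruct (IH ltac:(lia)) as [H1|[[H1 H2]|H1]]; [| |auto].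
      + destruct (classic (same z (zpow t (Z.succ m)))) as [Hs|Hs]; [right; left; split; auto; lia|].
        destruct (Z.eq_dec (Z.succ m) M) as [E|E]; [rewrite E in *; lia|].
        pose proof (power_angle_between (Z.succ m) M ltac:(lia)) as A.
        pose proof (behrstock0 CG z (zpow t (Z.succ m)) one Hs) as B1.
        pose proof (behrstock0 CG z (zpow t (Z.succ m)) (zpow t M) Hs) as B2.
        pose proof (ang_add (c := c) (zpow t (Z.succ m)) one z (zpow t M)).
        pose proof (ang_opp (c := c) (zpow t (Z.succ m)) (zpow t M) z).
        pose proof (ang_add (c := c) z one (zpow t M) (zpow t (Z.succ m))) as A2. fold (f M) (f (Z.succ m)) in A2.
        fold (f (Z.succ m)) in B1. lia.
      + assert (Hs : ~ same z (zpow t (Z.succ m))).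
        { intros X. apply (not_same_succ t Ht m). eapply same_trans; [apply same_sym|]; eauto. }
        destruct (Z.eq_dec (Z.succ m) M) as [E|E]; [rewrite E in *; lia|].
        pose proof (power_angle_between (Z.succ m) M ltac:(lia)) as A.
        pose proof (behrstock0 CG z (zpow t (Z.succ m)) one Hs) as B1.
        pose proof (behrstock0 CG z (zpow t (Z.succ m)) (zpow t M) Hs) as B2.
        pose proof (ang_add (c := c) (zpow t (Z.succ m)) one z (zpow t M)).
        pose proof (ang_opp (c := c) (zpow t (Z.succ m)) (zpow t M) z).
        pose proof (ang_add (c := c) z one (zpow t M) (zpow t (Z.succ m))) as A2. fold (f M) (f (Z.succ m)) in A2.
        fold (f (Z.succ m)) in B1. lia. }
  specialize (K M HM ltac:(lia)). fold (f M). lia.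
Qed.
End PowerAngles.

Section Centralizer.
Context (n : nat) (Hn : 1000 * (orbit_bound del D + D + 1) <= Z.of_nat n).
Notation nz := (Z.of_nat n).
Notation N := (nclosure (fun x : G => x = npow g n)).
Context {Q : Group} {pi : G -> Q} (Hq : is_quotient N pi).

(** A nontrivial commutator would have an angle close to n at some y, and since a contributes
    little, both sides labelled h turn widely at y. Then y<g> is within |h| of both ends of a side
    labelled a, which is too long for that. *)
Lemma commute_lift h a B : (forall z, 2 * Z.abs (ang z one h) <= nz + 4 * D) ->
  (forall z, Z.abs (ang z one a) <= B) -> 10 * B <= nz -> 2 * lh h + 1 < lh a ->
  pi h ∙ pi a = pi a ∙ pi h -> h ∙ a = a ∙ h.
Proof.
  intros Hh Ha HB Hl E. destruct (kap_small CG n Hn) as [K1 [K2 K3]].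
  assert (HN : N (h ∙ a ∙ h⁻¹ ∙ a⁻¹)).
  { destruct Hq as [P1 [P2 P3]]. apply P3. rewrite !P1, !(hom_inv P1), E. grp. }
  apply (N_reducible CG n Hn) in HN. inversion HN as [E1|h' y eps He HA _]; subst.
  { apply (mul_cancel_r h⁻¹). apply (mul_cancel_r a⁻¹). rewrite <- E1. grp. }
  exfalso.
  set (p2 := h ∙ a) in *. set (p3 := p2 ∙ h⁻¹) in *. set (p4 := p3 ∙ a⁻¹) in *.
  pose proof (ang_left_one y h a) as A1. fold p2 in A1.
  pose proof (ang_left_one y p3 h) as A2. replace (p3 ∙ h) with p2 in A2 by (unfold p3; grp).
  pose proof (ang_left_one y p4 a) as A3. replace (p4 ∙ a) with p3 in A3 by (unfold p4; grp).
  pose proof (Ha (h⁻¹ ∙ y)) as B1. pose proof (Hh (p3⁻¹ ∙ y)) as B2. pose proof (Ha (p4⁻¹ ∙ y)) as B3.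
  pose proof (Hh y) as B0.
  pose proof (ang_opp (c := c) y p3 p2) as O1. pose proof (ang_opp (c := c) y p4 p3) as O2.
  pose proof (ang_add (c := c) y one h p2) as C1. pose proof (ang_add (c := c) y one p2 p3) as C2.
  pose proof (ang_add (c := c) y one p3 p4) as C3.
  assert (L1 : D < Z.abs (ang y one h)) by (destruct He as [-> | ->]; lia).
  assert (L2 : D < Z.abs (ang y p3 p2)) by (destruct He as [-> | ->]; lia).
  pose proof (angle_dist CG y _ _ L1) as M1. pose proof (angle_dist CG y _ _ L2) as M2.
  pose proof (dist_via CG y h p2) as M3.
  rewrite dist_one_l in M1.
  replace (dh p3 p2) with (lh h) in M2 by (unfold dist, p3; f_equal; grp).
  replace (dh h p2) with (lh a) in M3 by (unfold dist, p2; f_equal; grp).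
  pose proof (gapy_nonneg CG y one). pose proof (gapy_nonneg CG y p3). lia.
Qed.

Context (t : G) (Ht : ~ same one t) (Ht4 : 4 * theta < Z.abs (c t - c t⁻¹))
  (B : Z) (HB : forall z M, 0 <= M -> Z.abs (ang z one (zpow t M)) <= B).
Notation sig := (20 * D + 20).
Context (HnB : 10 * (B + 2 * (D + 2 * sig)) <= nz).

Lemma conjugate_power_angle s M z : 0 <= M -> 0 <= s <= 2 * sig ->
  Z.abs (ang z one (zpow g s ∙ zpow t M ∙ zpow g (- s))) <= B + 2 * (D + 2 * sig).
Proof.
  intros HM Hs. pose proof (ang_zpow z s) as A1.
  pose proof (HB ((zpow g s)⁻¹ ∙ z) M HM) as A2. rewrite <- ang_left_one in A2.
  pose proof (ang_zpow ((zpow g s ∙ zpow t M)⁻¹ ∙ z) (- s)) as A3. rewrite <- ang_left_one in A3.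
  pose proof (ang_add (c := c) z one (zpow g s) (zpow g s ∙ zpow t M)).
  pose proof (ang_add (c := c) z one (zpow g s ∙ zpow t M) (zpow g s ∙ zpow t M ∙ zpow g (- s))). lia.
Qed.

(* h nearly fixes three far apart directions, as seen from <g> and hence also as seen from h^-1 <g>;
   by [behrstock] this is impossible unless these cosets agree. *)
Lemma commutes_trivial h : (forall s, 0 <= s <= 2 * sig -> forall K, exists M, K <= M /\
    h ∙ (zpow g s ∙ zpow t M ∙ zpow g (- s)) = zpow g s ∙ zpow t M ∙ zpow g (- s) ∙ h) -> h = one.
Proof.
  intros H.
  assert (HM : forall s, 0 <= s <= 2 * sig -> exists a, h ∙ a = a ∙ h /\ Z.abs (c a - s - c t) <= 3 * D /\
     Z.abs (c (h ∙ a) - c a) <= D).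
  { intros s Hs0. destruct (H s Hs0 (lh h + 2)) as [M [H1 H2]]. pose proof (len_nonneg (coned (sym_list S) g) h).
    set (a := zpow g s ∙ zpow t M ∙ zpow g (- s)) in *. exists a. split; auto.
    pose proof (power_gap t Ht Ht4 M ltac:(lia)) as P.
    assert (Hs : ~ same one (zpow t M)) by (rewrite <- (gapy_zero CG); lia).
    pose proof (ang_coset CG one (zpow t M) (- s) Hs) as C1.
    pose proof (power_coordinate t Ht Ht4 M ltac:(lia)) as C2.
    unfold angle in C1. rewrite inv_one, !mul_1l in C1.
    assert (Ec : c a = c (zpow t M ∙ zpow g (- s)) + s) by (unfold a; now rewrite mulA_r, (c_shift CG)).
    split; [lia|]. rewrite H2. apply Z.le_ngt. intros N1.
    pose proof (angle_dist CG one a (a ∙ h)) as C3. unfold angle in C3. rewrite inv_one, !mul_1l in C3.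
    specialize (C3 N1). unfold dist in C3. rewrite mul_Vl_r in C3.
    assert (Eg : gapy one a = gapy one (zpow t M ∙ zpow g (- s))).
    { unfold coset_gap, a. rewrite inv_one, !mul_1l, mulA_r. apply (e_shift CG). }
    pose proof (gapy_lip CG one (zpow t M) (zpow t M ∙ zpow g (- s))) as C4.
    pose proof (dist_same_le CG _ _ (same_zpow (g := g) (zpow t M) (- s))).
    pose proof (gapy_nonneg CG one (a ∙ h)). lia. }
  pose proof D0 as HD.
  destruct (HM 0 ltac:(lia)) as [a0 [E0 [A0 B0]]]. destruct (HM sig ltac:(lia)) as [a1 [E1 [A1 B1]]].
  destruct (HM (2 * sig) ltac:(lia)) as [a2 [E2 [A2 B2]]].
  (* A nontrivial h in <g> would put t^M into <g> by [commuting_power], against [power_gap]. *)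
  destruct (classic (same one h⁻¹)) as [Hs|Hs].
  - destruct Hs as [k Ek]. rewrite mul_1l in Ek. destruct (Z.eq_dec k 0) as [->|Hk].
    { rewrite <- (inv_inv h), Ek. grp. }
    exfalso. destruct (H 0 ltac:(lia) 1) as [M [HM1 EM]].
    rewrite zpow_0, mul_1l in EM. cbn [Z.opp] in EM. rewrite zpow_0, mul_1r in EM.
    destruct (commuting_power CG (zpow t M) k Hk) as [m Em].
    { rewrite <- Ek. apply (mul_cancel_l h). apply (mul_cancel_r h).
      transitivity (h ∙ zpow t M); [grp|]. rewrite EM. grp. }
    pose proof (power_gap t Ht Ht4 M ltac:(lia)) as P.
    assert (gapy one (zpow t M) = 0); [|lia]. apply (gapy_zero CG). exists m. now rewrite mul_1l.
  - exfalso.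
    assert (F : forall a, Z.abs (c h⁻¹ - c a) <= theta \/ Z.abs (c (h ∙ one) - c (h ∙ a)) <= theta).
    { intros a. pose proof (behrstock0 CG h⁻¹ one a ltac:(intros X; apply Hs; now apply same_sym)) as K.
      unfold angle in K. rewrite inv_inv, inv_one, !mul_1l in K. lia. }
    clear -A0 A1 A2 B0 B1 B2 F HD. specialize (F a0) as F0. specialize (F a1) as F1. specialize (F a2) as F2.
    clear F. apply Z.abs_le in A0, A1, A2, B0, B1, B2.
    destruct F0 as [F0|F0], F1 as [F1|F1], F2 as [F2|F2]; apply Z.abs_le in F0, F1, F2; lia.
Qed.

(** In a finite class two conjugates of x by powers of the image of u = g^s t g^-s agree, so x
    commutes with a power of it. Exponents are multiples of K to make the lifted element long enough
    for [commute_lift]. *)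
Lemma quotient_icc : icc (G := Q).
Proof.
  intros x Hx [L HL]. pose proof D0 as HD.
  destruct (tame_lift CG n Hn Hq x) as [h [Eh Hh]].
  apply Hx. rewrite <- Eh. replace h with (one : G); [now rewrite (hom_one (pi_hom n Hq))|]. symmetry.
  assert (HK : forall s, 0 <= s <= 2 * sig -> forall K, exists M, K <= M /\
    h ∙ (zpow g s ∙ zpow t M ∙ zpow g (- s)) = zpow g s ∙ zpow t M ∙ zpow g (- s) ∙ h).
  { intros s Hs K0. set (K := Z.max K0 (2 * lh h + 10)). set (u := zpow g s ∙ t ∙ (zpow g s)⁻¹).
    destruct (pigeonhole_list (fun i => zpow (pi u) (Z.of_nat i * K) ∙ x ∙ (zpow (pi u) (Z.of_nat i * K))⁻¹) L)
      as [i [j [Hij E]]]; [intros; apply HL|].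
    exists ((Z.of_nat j - Z.of_nat i) * K).
    pose proof (len_nonneg (coned (sym_list S) g) h).
    assert (HKM : K <= (Z.of_nat j - Z.of_nat i) * K).
    { pose proof (Z.mul_le_mono_nonneg_r 1 (Z.of_nat j - Z.of_nat i) K ltac:(lia) ltac:(lia)). lia. }
    set (M := (Z.of_nat j - Z.of_nat i) * K) in *. split; [lia|].
    apply (commute_lift h _ (B + 2 * (D + 2 * sig))); auto.
    - intros z. apply conjugate_power_angle; lia.
    - pose proof (power_gap t Ht Ht4 M ltac:(lia)) as P.
      pose proof (gapy_le CG one (zpow t M) 0) as P1. rewrite zpow_0, mul_1r, (dist_sym _ HU), dist_one_l in P1.
      assert (P2 : lh (zpow t M) <= 1 + lh (zpow g s ∙ zpow t M ∙ zpow g (- s)) + 1).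
      { pose proof (len_gen _ HU (zpow g s) ltac:(right; eauto)) as Q1.
        pose proof (len_gen _ HU (zpow g (- s)) ltac:(right; eauto)) as Q2.
        set (a := zpow g s ∙ zpow t M ∙ zpow g (- s)).
        replace (zpow t M) with (zpow g (- s) ∙ a ∙ zpow g s) by (unfold a; grpz).
        pose proof (len_mul _ HU (zpow g (- s) ∙ a) (zpow g s)). pose proof (len_mul _ HU (zpow g (- s)) a). lia. }
      lia.
    - rewrite Eh. assert (Eu : pi (zpow g s ∙ zpow t M ∙ zpow g (- s)) = zpow (pi u) M).
      { rewrite <- (hom_zpow (pi_hom n Hq)). unfold u. now rewrite zpow_conj, zpow_opp. }
      rewrite Eu. unfold M. rewrite Z.mul_sub_distr_r. replace (Z.of_nat j * K - Z.of_nat i * K) with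
        (- (Z.of_nat i * K) + Z.of_nat j * K) by lia. rewrite zpow_add, <- zpow_opp.
      set (U := zpow (pi u) (Z.of_nat i * K)) in *. set (V := zpow (pi u) (Z.of_nat j * K)) in *.
      apply (mul_cancel_l U). apply (mul_cancel_r V⁻¹).
      assert (Huv : U ∙ V = V ∙ U) by (unfold U, V; rewrite <- !zpow_add; f_equal; lia).
      transitivity (U ∙ x ∙ U⁻¹ ∙ (V ∙ V⁻¹)); [grp|]. rewrite E. grp. }
  now apply commutes_trivial.
Qed.
End Centralizer.
End Axis.

(** * The wreath-like extension *)

Lemma icc_not_virtually_cyclic {Q : Group} (Hicc : icc (G := Q)) (x : Q) : x <> one -> ~ virtually_cyclic (G := Q).
Proof.
  intros Hx [H [HS [[L HL] [a [Ha Hcyc]]]]].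
  destruct (classic (a = one)) as [->|Ha1].
  - apply (Hicc x Hx). exists (map (fun l => l ∙ x ∙ l⁻¹) L). intros y.
    destruct (HL y) as [l [h [Hl [Hh ->]]]]. destruct (Hcyc h Hh) as [z ->]. rewrite zpow_one, mul_1r.
    now apply in_map with (f := fun l => l ∙ x ∙ l⁻¹).
  - apply (Hicc a Ha1). exists (map (fun l => l ∙ a ∙ l⁻¹) L). intros y.
    destruct (HL y) as [l [h [Hl [Hh ->]]]]. destruct (Hcyc h Hh) as [z ->].
    replace (l ∙ zpow a z ∙ a ∙ (l ∙ zpow a z)⁻¹) with (l ∙ a ∙ l⁻¹).
    + now apply in_map with (f := fun l => l ∙ a ∙ l⁻¹).
    + rewrite inv_mul. rewrite (mulA_r _ (zpow a z) a), <- (zpow_commute a a z eq_refl). grp.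
Qed.

Lemma gen_subgroup {G : Group} (X : G -> Prop) : is_subgroup (gen X).
Proof.
  split; [|split].
  - intros H HS _. apply HS.
  - intros x y Hx Hy H HS HX. apply HS; [now apply Hx|now apply Hy].
  - intros x Hx H HS HX. apply HS. now apply Hx.
Qed.

Lemma gen_in {G : Group} (X : G -> Prop) x : X x -> gen X x.
Proof. intros Hx H HS HX. now apply HX. Qed.

(** * Formal sums of cosets *)

Section Multiplicity.
Context {G : Group} {g : G}.
Local Open Scope Z_scope.
Notation same := (same (g := g)).
Notation sameb y z := (if excluded_middle_informative (same y z) then true else false).
(* The total exponent at the coset of z in a formal sum of cosets. *)
Fixpoint multiplicity (l : list (G * Z)) (z : G) : Z :=
  match l with
  | nil => 0
  | (y, k) :: l => (if excluded_middle_informative (same y z) then k else 0) + multiplicity l z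
  end.
Notation mult := multiplicity.

Lemma mult_app l l' z : mult (l ++ l') z = mult l z + mult l' z.
Proof. induction l as [|[y k] l IH]; cbn; [lia|]. rewrite IH. lia. Qed.

Definition drop_coset (z : G) (l : list (G * Z)) := filter (fun p => negb (sameb (fst p) z)) l.

Notation away := drop_coset.

Lemma mult_away z l y : mult (away z l) y = if excluded_middle_informative (same z y) then 0 else mult l y.
Proof.
  induction l as [|[x k] l IH]; cbn [away filter mult fst].
  - now destruct (excluded_middle_informative _).
  - destruct (excluded_middle_informative (same x z)) as [A|A]; cbn [negb mult]; unfold away in IH; rewrite IH;
      destruct (excluded_middle_informative (same z y)) as [B|B];
      destruct (excluded_middle_informative (same x y)) as [C|C]; try lia; exfalso.
    + apply B. eapply same_trans; [apply same_sym|]; eauto.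
    + apply A. eapply same_trans; [exact C|]. now apply same_sym.
Qed.

End Multiplicity.

Section Turns.
Context {G : Group} {S : list G} {g : G} {del D : Z} {e c : G -> Z}
  (CG : cone_geom (sym_list S) g del D e c).
Local Open Scope Z_scope.
Notation same := (same (g := g)).
Notation rot := (rotation (g := g)).
Notation mult := (multiplicity (g := g)).
Notation away := (drop_coset (g := g)).
Notation below := (below (g := g) (e := e)).
Context (n : nat) (Hn : 1000 * (orbit_bound del D + D + 1) <= Z.of_nat n).
Notation nz := (Z.of_nat n).
Notation N := (nclosure (fun x : G => x = npow g n)).
Context {Q : Group} {pi : G -> Q} (Hq : is_quotient N pi).

(** The index set is Q/<pi g>; its members are predicates, so that equality of indices is Leibniz
    equality. *)
Definition coset (q : Q) : Q -> Prop := fun r => exists k, r = q ∙ zpow (pi g) k.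

Lemma coset_eq q r : coset q = coset r <-> exists k, r = q ∙ zpow (pi g) k.
Proof.
  split.
  - intros E. change (coset q r). rewrite E. exists 0. grp.
  - intros [k ->]. apply functional_extensionality. intros x. apply propositional_extensionality. split.
    + intros [l ->]. exists (- k + l). grpz.
    + intros [l ->]. exists (k + l). grpz.
Qed.

Definition cosets : Type := {C : Q -> Prop | exists q, C = coset q}.

Lemma cosets_eq (i j : cosets) : proj1_sig i = proj1_sig j -> i = j.
Proof. destruct i as [C HC], j as [C' HC']. cbn. intros ->. f_equal. apply proof_irrelevance. Qed.

Definition cls (q : Q) : cosets := exist _ (coset q) (ex_intro _ q eq_refl).

Lemma cls_eq q r : cls q = cls r <-> exists k, r = q ∙ zpow (pi g) k.
Proof.
  rewrite <- coset_eq. split; [|intros E; now apply cosets_eq].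
  intros E. exact (f_equal (@proj1_sig _ _) E).
Qed.

Lemma cls_ex (i : cosets) : exists q, i = cls q.
Proof. destruct i as [C [q E]]. exists q. apply cosets_eq. exact E. Qed.

Lemma translate_coset b (i : cosets) : exists q, (fun r => proj1_sig i (b⁻¹ ∙ r)) = coset q.
Proof.
  destruct (cls_ex i) as [q ->]. exists (b ∙ q). apply functional_extensionality. intros r.
  apply propositional_extensionality. cbn. split.
  - intros [k E]. exists k. apply (mul_cancel_l b⁻¹). rewrite E. grp.
  - intros [k ->]. exists k. grp.
Qed.

Definition coset_act (b : Q) (i : cosets) : cosets := exist _ _ (translate_coset b i).

Lemma coset_act_cls b q : coset_act b (cls q) = cls (b ∙ q).
Proof.
  apply cosets_eq. cbn. apply functional_extensionality. intros r.
  apply propositional_extensionality. cbn. split.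
  - intros [k E]. exists k. apply (mul_cancel_l b⁻¹). rewrite E. grp.
  - intros [k ->]. exists k. grp.
Qed.

Lemma coset_action : is_action coset_act.
Proof.
  split.
  - intros i. destruct (cls_ex i) as [q ->]. now rewrite coset_act_cls, mul_1l.
  - intros a b i. destruct (cls_ex i) as [q ->]. now rewrite !coset_act_cls, mul_assoc.
Qed.

Lemma coset_transitive : transitive coset_act.
Proof.
  split; [exact (inhabits (cls one))|]. intros i j. destruct (cls_ex i) as [q ->], (cls_ex j) as [r ->].
  exists (r ∙ q⁻¹). rewrite coset_act_cls. f_equal. grp.
Qed.

Lemma coset_stabilizers i : iso_Zmod (fun q => coset_act q i = i) n.
Proof.
  destruct (cls_ex i) as [q ->].
  exists (fun k : Zgrp => q ∙ zpow (pi g) k ∙ q⁻¹). split; [|split].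
  - intros k l. cbn. rewrite zpow_add. grp.
  - intros b. rewrite coset_act_cls. split.
    + intros E. symmetry in E. apply cls_eq in E as [k Ek]. exists k. rewrite <- Ek. grp.
    + intros [k <-]. symmetry. apply cls_eq. exists k. grp.
  - intros k. rewrite <- (pi_zpow_one CG n Hn Hq k), (hom_zpow (pi_hom n Hq)). split.
    + intros E. apply (mul_cancel_l q). apply (mul_cancel_r q⁻¹). rewrite E. grp.
    + intros ->. grp.
Qed.

(** The indicator of one N-orbit of cosets of <g>; the weight of an element of N is then its
    exponent sum over that orbit. *)
Notation wt i := (fun y => if excluded_middle_informative (cls (pi y) = i) then 1 else 0).

Lemma cls_same y z : same y z -> cls (pi z) = cls (pi y).
Proof.
  intros [k ->]. symmetry. apply cls_eq. exists k. now rewrite (pi_hom n Hq), (hom_zpow (pi_hom n Hq)).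
Qed.

Lemma wt_same i y z : same y z -> wt i z = wt i y.
Proof. intros H. cbv beta. now rewrite (cls_same _ _ H). Qed.

Lemma wt_rot i y z k : wt i (rot z (k * nz) ∙ y) = wt i y.
Proof. cbv beta. now rewrite (pi_hom n Hq), (pi_rot n Hq), mul_1l. Qed.

Lemma below_rot w y k : exists R, below nz w R (rot y (k * nz)) (k * w y).
Proof.
  exists (coset_gap (e := e) y one + 1). induction k as [|k IH|k IH] using Z.peano_ind.
  - cbn [Z.mul]. rewrite rot_0. constructor.
  - replace (Z.succ k * nz) with (1 * nz + k * nz) by lia. rewrite rot_add.
    replace (Z.succ k * w y) with (1 * w y + k * w y) by lia. apply below_step; auto; lia.
  - replace (Z.pred k * nz) with (-1 * nz + k * nz) by lia. rewrite rot_add.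
    replace (Z.pred k * w y) with (-1 * w y + k * w y) by lia. apply below_step; auto; lia.
Qed.

Context {P : Group} {rho : G -> P} (Hr : is_quotient (comm_sub N) rho).

Lemma rho_hom : is_hom rho.
Proof. apply Hr. Qed.

Lemma rho_commute a b : N a -> N b -> rho a ∙ rho b = rho b ∙ rho a.
Proof.
  intros Ha Hb. destruct Hr as [H1 [H2 H3]].
  assert (E : rho (commutator a b) = one) by (apply H3, gen_in; eauto).
  unfold commutator in E. rewrite !H1, !(hom_inv H1) in E.
  apply inv_unique in E. rewrite <- E. grp.
Qed.

Definition turn (y : G) (k : Z) : P := rho (rot y (k * nz)).

Lemma turn_same y z k : same y z -> turn z k = turn y k.
Proof. intros H. unfold turn. now rewrite (rot_same _ _ _ H). Qed.

Lemma turn_add y k l : turn y (k + l) = turn y k ∙ turn y l.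
Proof. unfold turn. rewrite Z.mul_add_distr_r, rot_add. apply rho_hom. Qed.

Lemma turn_0 y : turn y 0 = one.
Proof. unfold turn. cbn [Z.mul]. rewrite rot_0. apply (hom_one rho_hom). Qed.

Lemma turn_conj x y k : turn (x ∙ y) k = rho x ∙ turn y k ∙ (rho x)⁻¹.
Proof. unfold turn. now rewrite rot_conj, !rho_hom, (hom_inv rho_hom). Qed.

Lemma turn_translate x y k : N x -> turn (x ∙ y) k = turn y k.
Proof.
  intros Hx. rewrite turn_conj. unfold turn. rewrite rho_commute; auto; [|apply rot_in_N]. grp.
Qed.

Lemma turn_cls y z k : cls (pi y) = cls (pi z) -> turn y k = turn z k.
Proof.
  intros H. apply cls_eq in H as [i Ei].
  rewrite <- (hom_zpow (pi_hom n Hq)), <- (pi_hom n Hq) in Ei. symmetry in Ei. apply (pi_eq n Hq) in Ei.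
  destruct (nclosure_normal (fun x : G => x = npow g n)) as [_ HN].
  pose proof (HN (y ∙ zpow g i) _ Ei) as K.
  rewrite <- (turn_same y (y ∙ zpow g i)) by apply same_zpow.
  rewrite <- (turn_translate _ (y ∙ zpow g i) k K). f_equal. grp.
Qed.

Section RhoWeight.
Context (w : G -> Z) (w_same : forall y z, same y z -> w z = w y)
  (w_rot : forall y z k, w (rot z (k * nz) ∙ y) = w y).

Lemma comm_sub_weight h : comm_sub N h -> exists R, below nz w R h 0.
Proof.
  intros H. apply (H (fun h => exists R, below nz w R h 0)).
  - split; [|split].
    + exists 0. constructor.
    + intros x y [R Hx] [R' Hy]. exists (Z.max R R'). change 0 with (0 + 0). apply below_mul.
      * eapply below_mono; [|exact Hx]. lia.
      * eapply below_mono; [|exact Hy]. lia.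
    + intros x [R Hx]. exists R. change 0 with (- 0). now apply below_inv.
  - intros x [a [b [Ha [Hb ->]]]].
    apply (N_below CG n w) in Ha as [R [k Ha]]. apply (N_below CG n w) in Hb as [R' [k' Hb]].
    apply (below_mono nz w R (Z.max R R')) in Ha; [|lia]. apply (below_mono nz w R' (Z.max R R')) in Hb; [|lia].
    exists (Z.max R R'). unfold commutator. replace 0 with ((- k + - k') + (k + k')) by lia.
    apply below_mul; apply below_mul; auto; now apply below_inv.
Qed.

(** Exponent sums over an orbit survive modulo [N,N], by [below_one_wt]; the freeness and
    independence of the summands rest on this. *)
Lemma rho_weight h k R h' k' R' : below nz w R h k -> below nz w R' h' k' -> rho h = rho h' -> k = k'.
Proof.
  intros H H' E. destruct Hr as [H1 [H2 H3]].
  assert (Hc : comm_sub N (h⁻¹ ∙ h')) by (apply H3; rewrite H1, (hom_inv H1), E; apply mul_Vl).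
  apply comm_sub_weight in Hc as [R0 Hc].
  set (M := Z.max (Z.max R R') R0).
  apply (below_mono nz w R M) in H; [|lia]. apply (below_mono nz w R' M) in H'; [|lia].
  apply (below_mono nz w R0 M) in Hc; [|lia].
  pose proof (below_mul _ _ _ _ _ _ _ (below_mul _ _ _ _ _ _ _ H Hc) (below_inv _ _ _ _ _ H')) as K.
  replace (h ∙ (h⁻¹ ∙ h') ∙ h'⁻¹) with (one : G) in K by grp.
  apply (below_one_wt CG nz (large_exponent CG n Hn) w w_same w_rot) in K. lia.
Qed.
End RhoWeight.

Lemma turn_inj y k l : turn y k = turn y l -> k = l.
Proof.
  intros E. destruct (below_rot (wt (cls (pi y))) y k) as [R Hk].
  destruct (below_rot (wt (cls (pi y))) y l) as [R' Hl].
  pose proof (rho_weight _ (wt_same _) (wt_rot _) _ _ _ _ _ _ Hk Hl E) as K. cbn in K.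
  destruct (excluded_middle_informative _) as [_|F]; [lia|easy].
Qed.

(* The i-th summand of the kernel. *)
Definition base_group (i : cosets) (p : P) : Prop := exists y k, cls (pi y) = i /\ p = turn y k.

Lemma base_group_iso (i : cosets) : exists f : Zgrp -> P, is_hom f /\ (forall a a', f a = f a' -> a = a') /\
  forall p, base_group i p <-> exists a, f a = p.
Proof.
  destruct (cls_ex i) as [q ->]. destruct Hq as [_ [Hs _]]. destruct (Hs q) as [y <-].
  exists (fun k : Zgrp => turn y k). split; [|split].
  - intros k l. apply turn_add.
  - intros k l. apply turn_inj.
  - intros p. split.
    + intros [z [k [E ->]]]. exists k. symmetry. now apply turn_cls.
    + intros [k <-]. now exists y, k.
Qed.

Lemma base_group_indep i p : base_group i p -> gen (fun y => exists j, j <> i /\ base_group j y) p -> p = one.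
Proof.
  intros [y [k [Ey ->]]] H.
  assert (K : exists h R, below nz (wt i) R h 0 /\ rho h = turn y k).
  { apply (H (fun p => exists h R, below nz (wt i) R h 0 /\ rho h = p)).
    - split; [|split].
      + exists one, 0. split; [constructor|apply (hom_one rho_hom)].
      + intros a b [h [R [Ha <-]]] [h' [R' [Hb <-]]]. exists (h ∙ h'), (Z.max R R'). split; [|apply rho_hom].
        change 0 with (0 + 0). apply below_mul.
        * eapply below_mono; [|exact Ha]. lia.
        * eapply below_mono; [|exact Hb]. lia.
      + intros a [h [R [Ha <-]]]. exists h⁻¹, R. split; [|apply (hom_inv rho_hom)].
        change 0 with (- 0). now apply below_inv.
    - intros a [j [Hj [z [l [Ez ->]]]]]. destruct (below_rot (wt i) z l) as [R HR].
      exists (rot z (l * nz)), R. split; auto. cbn in HR. rewrite Ez in HR.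
      destruct (excluded_middle_informative _); [easy|]. now rewrite Z.mul_0_r in HR. }
  destruct K as [h [R [HR E]]]. destruct (below_rot (wt i) y k) as [R' HR'].
  pose proof (rho_weight _ (wt_same _) (wt_rot _) _ _ _ _ _ _ HR HR' E) as K. cbn in K. rewrite Ey in K. clear HR HR'.
  destruct (excluded_middle_informative _) as [_|F]; [|easy]. replace k with 0 by lia. apply turn_0.
Qed.

Lemma rho_N_gen h : N h -> gen (fun y => exists i, base_group i y) (rho h).
Proof.
  intros H. apply (N_below CG n (fun _ => 0)) in H as [R [k H]].
  induction H as [|y eps h k Hy He H IH]; [rewrite (hom_one rho_hom); apply gen_subgroup|].
  rewrite rho_hom. apply gen_subgroup; auto. apply gen_in. exists (cls (pi y)), y, eps. now split.
Qed.

Notation sameb y z := (if excluded_middle_informative (same y z) then true else false).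
Fixpoint rotations (l : list (G * Z)) : G :=
  match l with nil => one | (y, k) :: l => rot y (k * nz) ∙ rotations l end.
Notation rots := rotations.
Lemma rots_N l : N (rots l).
Proof.
  destruct (nclosure_normal (fun x : G => x = npow g n)) as [[H1 [H2 H3]] H4].
  induction l as [|[y k] l IH]; cbn; auto. apply H2; auto. apply rot_in_N.
Qed.

Lemma rots_app l l' : rots (l ++ l') = rots l ∙ rots l'.
Proof. induction l as [|[y k] l IH]; cbn; [now rewrite mul_1l|]. now rewrite IH, mul_assoc. Qed.

Lemma rots_away z l : rho (rots l) = turn z (mult l z) ∙ rho (rots (away z l)).
Proof.
  induction l as [|[y k] l IH].
  - cbn. now rewrite turn_0, (hom_one rho_hom), mul_1l.
  - cbn [rots multiplicity drop_coset filter fst]. rewrite rho_hom, IH.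
    destruct (excluded_middle_informative (same y z)) as [A|A]; cbn [negb].
    + rewrite turn_add, <- mul_assoc. f_equal. symmetry. now apply turn_same.
    + cbn [rots]. rewrite Z.add_0_l, (rho_hom (rot y (k * nz))), !mul_assoc. f_equal.
      apply rho_commute; apply rot_in_N.
Qed.

Lemma rots_support l E : (forall z, (forall y, In y E -> ~ same y z) -> mult l z = 0) ->
  gen (fun p => exists i, In i (map (fun y => cls (pi y)) E) /\ base_group i p) (rho (rots l)).
Proof.
  remember (length l) as m eqn:Em. assert (Hm : (length l <= m)%nat) by lia. clear Em. revert l Hm.
  induction m as [|m IH]; intros l Hm H.
  - destruct l; [|cbn in Hm; lia]. cbn. rewrite (hom_one rho_hom). apply gen_subgroup.
  - destruct l as [|[z k] l]; [cbn; rewrite (hom_one rho_hom); apply gen_subgroup|].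
    rewrite (rots_away z). apply gen_subgroup.
    + destruct (classic (exists y, In y E /\ same y z)) as [[y [Hy Hs]]|Hno].
      * apply gen_in. exists (cls (pi y)). split; [now apply in_map with (f := fun y => cls (pi y))|].
        exists z, (mult ((z, k) :: l) z). split; auto. now apply cls_same.
      * rewrite H; [rewrite turn_0; apply gen_subgroup|]. intros y Hy Hs. apply Hno. eauto.
    + apply IH.
      * cbn [drop_coset filter fst length] in *. destruct (excluded_middle_informative (same z z)) as [A|A].
        -- cbn [negb]. pose proof (filter_length_le (fun p => negb (sameb (fst p) z)) l). lia.
        -- destruct A. apply same_refl.
      * intros y Hy. rewrite mult_away. destruct (excluded_middle_informative _); auto.
Qed.

Lemma rots_eq l l' : (forall z, mult l z = mult l' z) -> rho (rots l) = rho (rots l').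
Proof.
  intros H. set (neg := map (fun p : G * Z => (fst p, - snd p)) l').
  assert (Hneg : forall z, mult neg z = - mult l' z).
  { intros z. unfold neg. clear. induction l' as [|[y k] l IH]; cbn; [lia|]. rewrite IH.
    destruct (excluded_middle_informative _); lia. }
  assert (Hrev : rho (rots neg) ∙ rho (rots l') = one).
  { unfold neg. clear - Hr. induction l' as [|[y k] l IH]; cbn [map rots fst snd]; [now rewrite (hom_one rho_hom), mul_1l|].
    set (m := map _ l) in *. rewrite !rho_hom.
    rewrite (rho_commute (rot y (k * nz)) (rots l)) by (try apply rot_in_N; apply rots_N).
    transitivity (rho (rot y (- k * nz)) ∙ (rho (rots m) ∙ rho (rots l)) ∙ rho (rot y (k * nz))); [grp|].
    rewrite IH, mul_1r, <- rho_hom, <- rot_add. replace (- k * nz + k * nz) with 0 by lia.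
    rewrite rot_0. apply (hom_one rho_hom). }
  assert (K : rho (rots (l ++ neg)) = one).
  { pose proof (rots_support (l ++ neg) nil) as K. apply K.
    - intros z _. rewrite mult_app, Hneg, H. lia.
    - split; [auto|split]; [intros x y -> ->; apply mul_1l|intros x ->; apply inv_one].
    - intros s [i [[] _]]. }
  rewrite rots_app, rho_hom in K. apply (mul_cancel_r (rho (rots neg))). rewrite K.
  rewrite rho_commute by apply rots_N. auto.
Qed.

End Turns.

(** * Bounded cocycle *)

Section Cocycle.
Context {G : Group} {S : list G} {g : G} {del D : Z} {e c : G -> Z}
  (CG : cone_geom (sym_list S) g del D e c).
Local Open Scope Z_scope.
Notation dh := (dist (coned (sym_list S) g)).
Notation lh := (len (coned (sym_list S) g)).
Notation theta := (2 * D).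
Notation kap := (turn_defect del D).
Notation ang := (angle (c := c)).
Notation gapy := (coset_gap (e := e)).
Notation same := (same (g := g)).
Notation rot := (rotation (g := g)).
Let HU : symgen (coned (sym_list S) g) := coned_symgen _ (cg_gen _ _ _ _ _ _ CG) g.
Let D0 : 0 <= D := cg_D _ _ _ _ _ _ CG.
Context (n : nat) (Hn : 1000 * (orbit_bound del D + D + 1) <= Z.of_nat n).
Notation nz := (Z.of_nat n).
Notation N := (nclosure (fun x : G => x = npow g n)).
Context (Hodd : Z.odd nz = true).
Notation mult := (multiplicity (g := g)).
Notation rots := (rotations (g := g) n).

(* The integer nearest to a / n, for |a| <= 3n/4 and n odd. *)
Definition rnd (a : Z) : Z := if Z_lt_dec nz (2 * Z.abs a) then Z.sgn a else 0.

Lemma odd_half a : 2 * a <> nz.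
Proof. intros E. rewrite <- E, Z.odd_mul in Hodd. discriminate. Qed.

Lemma rnd_opp a : rnd (- a) = - rnd a.
Proof. unfold rnd. rewrite Z.abs_opp, Z.sgn_opp. destruct (Z_lt_dec _ _); lia. Qed.

Lemma rnd_0 : rnd 0 = 0.
Proof. unfold rnd. destruct (Z_lt_dec _ _); reflexivity. Qed.

Lemma rnd_big a : rnd a <> 0 -> nz < 2 * Z.abs a.
Proof. unfold rnd. destruct (Z_lt_dec _ _); auto. easy. Qed.

Lemma rnd_shift a eps : eps = 1 \/ eps = -1 -> nz <= 4 * (eps * a) -> 4 * Z.abs a <= 3 * nz ->
  rnd (a - eps * nz) = rnd a - eps.
Proof.
  destruct (kap_small CG n Hn) as [K1 [K2 K3]].
  intros He H1 H2. unfold rnd. pose proof (odd_half a). pose proof (odd_half (- a)).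
  destruct He as [-> | ->]; destruct (Z_lt_dec _ _), (Z_lt_dec _ _); lia.
Qed.

(** Some angle exceeds n/2, so another is at least n/4 by the zero sum; if the third vanished, the
    other two would be opposite and their roundings would cancel. *)
Lemma rnd_triangle a1 a2 a3 : a1 + a2 + a3 = 0 -> rnd a1 + rnd a2 + rnd a3 <> 0 ->
  (nz <= 4 * Z.abs a1 /\ nz <= 4 * Z.abs a3 /\ a2 <> 0) \/
  (nz <= 4 * Z.abs a1 /\ nz <= 4 * Z.abs a2 /\ a3 <> 0) \/
  (nz <= 4 * Z.abs a2 /\ nz <= 4 * Z.abs a3 /\ a1 <> 0).
Proof.
  intros E H.
  assert (Z1 : a1 <> 0). { intros ->. apply H. replace a3 with (- a2) by lia. rewrite rnd_opp, rnd_0. lia. }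
  assert (Z2 : a2 <> 0). { intros ->. apply H. replace a3 with (- a1) by lia. rewrite rnd_opp, rnd_0. lia. }
  assert (Z3 : a3 <> 0). { intros ->. apply H. replace a2 with (- a1) by lia. rewrite rnd_opp, rnd_0. lia. }
  assert (B : nz < 2 * Z.abs a1 \/ nz < 2 * Z.abs a2 \/ nz < 2 * Z.abs a3).
  { pose proof (rnd_big a1). pose proof (rnd_big a2). pose proof (rnd_big a3).
    destruct (Z.eq_dec (rnd a1) 0); [|auto]. destruct (Z.eq_dec (rnd a2) 0); [|auto].
    destruct (Z.eq_dec (rnd a3) 0); [|auto]. lia. }
  lia.
Qed.

Definition supported (a b : G) (l : list (G * Z)) : Prop := forall z, mult l z = rnd (ang z a b).

(** Two cosets at the same distance from 1 see each other near 1, so by Behrstock b cannot make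
    large angles at both. Thus each level has at most one coset with nonzero rounding, and supports
    are finite. *)
Lemma big_angle_level y z b : ~ same y z -> gapy y one = gapy z one ->
  nz < 2 * Z.abs (ang y one b) -> nz < 2 * Z.abs (ang z one b) -> False.
Proof.
  destruct (kap_small CG n Hn) as [K1 [K2 K3]]. intros Hs Hg Hy Hz.
  assert (Hs' : ~ same z y) by (intros X; apply Hs; now apply same_sym).
  pose proof (level_angle CG z y Hs ltac:(lia)) as A1. pose proof (level_angle CG y z Hs' ltac:(lia)) as A2.
  pose proof (behrstock0 CG z y b Hs') as B.
  pose proof (ang_add (c := c) y one b z). pose proof (ang_opp (c := c) y b z).
  pose proof (ang_add (c := c) z one b y). lia.
Qed.

Lemma supported_levels b (i : nat) : exists l, forall z,
  mult l z = if Z_lt_dec (gapy z one) (Z.of_nat i) then rnd (ang z one b) else 0.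
Proof.
  induction i as [|i [l IH]].
  - exists nil. intros z. cbn. destruct (Z_lt_dec _ _); [|auto]. pose proof (gapy_nonneg CG z one). lia.
  - destruct (classic (exists y, gapy y one = Z.of_nat i /\ rnd (ang y one b) <> 0)) as [[y [Hy Hb]]|Hno].
    + exists ((y, rnd (ang y one b)) :: l). intros z. cbn [multiplicity]. rewrite IH.
      destruct (excluded_middle_informative (same y z)) as [Hs|Hs].
      * rewrite (gapy_same CG y z) by auto. rewrite (ang_same CG y z) by auto.
        destruct (Z_lt_dec _ _), (Z_lt_dec _ _); lia.
      * destruct (Z.eq_dec (gapy z one) (Z.of_nat i)) as [E|E].
        -- assert (rnd (ang z one b) = 0).
           { destruct (Z.eq_dec (rnd (ang z one b)) 0) as [F|F]; auto. exfalso.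
             apply (big_angle_level y z b Hs); [lia|now apply rnd_big|now apply rnd_big]. }
           destruct (Z_lt_dec _ _), (Z_lt_dec _ _); lia.
        -- destruct (Z_lt_dec _ _), (Z_lt_dec _ _); lia.
    + exists l. intros z. rewrite IH. destruct (Z.eq_dec (gapy z one) (Z.of_nat i)) as [E|E].
      * assert (rnd (ang z one b) = 0).
        { destruct (Z.eq_dec (rnd (ang z one b)) 0) as [F|F]; auto. exfalso. apply Hno. eauto. }
        destruct (Z_lt_dec _ _), (Z_lt_dec _ _); lia.
      * destruct (Z_lt_dec _ _), (Z_lt_dec _ _); lia.
Qed.

Definition translate_list (x : G) (l : list (G * Z)) := map (fun p => (x ∙ fst p, snd p)) l.

Lemma mult_translate x l z : mult (translate_list x l) z = mult l (x⁻¹ ∙ z).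
Proof.
  induction l as [|[y k] l IH]; [reflexivity|]. cbn [translate_list map multiplicity fst snd].
  unfold translate_list in IH. rewrite IH. f_equal.
  destruct (excluded_middle_informative (same (x ∙ y) z)) as [A|A],
    (excluded_middle_informative (same y (x⁻¹ ∙ z))) as [B|B]; auto; exfalso.
  - apply B. apply (same_left x). now rewrite mul_Vr_r.
  - apply A. apply (same_left x) in B. now rewrite mul_Vr_r in B.
Qed.

Lemma rots_translate x l : rots (translate_list x l) = x ∙ rots l ∙ x⁻¹.
Proof.
  induction l as [|[y k] l IH]; cbn; [grp|]. unfold translate_list in IH. rewrite IH, rot_conj. grp.
Qed.

Lemma supported_translate x a b l : supported a b l -> supported (x ∙ a) (x ∙ b) (translate_list x l).
Proof.
  intros H z. rewrite mult_translate, H. rewrite <- (ang_left x). now rewrite mul_Vr_r.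
Qed.

Lemma supported_ex a b : exists l, supported a b l.
Proof.
  assert (H : forall b, exists l, supported one b l).
  { clear a b. intros b. destruct (supported_levels b (Z.to_nat (lh b + 1))) as [l Hl]. exists l. intros z.
    rewrite Hl. pose proof (len_nonneg (coned (sym_list S) g) b). rewrite Z2Nat.id by lia.
    destruct (Z_lt_dec _ _) as [K|K]; auto. symmetry.
    destruct (Z.eq_dec (rnd (ang z one b)) 0) as [F|F]; auto. exfalso. apply rnd_big in F.
    destruct (kap_small CG n Hn) as [K1 [K2 K3]].
    pose proof (angle_dist CG z one b ltac:(lia)) as E. rewrite dist_one_l in E.
    pose proof (gapy_nonneg CG z b). lia. }
  destruct (H (a⁻¹ ∙ b)) as [l Hl]. exists (translate_list a l).
  pose proof (supported_translate a _ _ _ Hl) as K. now rewrite mul_1r, mul_Vr_r in K.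
Qed.

Context {Q : Group} {pi : G -> Q} (Hq : is_quotient N pi).
Context {P : Group} {rho : G -> P} (Hr : is_quotient (comm_sub N) rho).

Definition corr_spec (a b : G) (p : P) : Prop := exists l, supported a b l /\ p = rho (rots l).
Definition corr (a b : G) : P := epsilon (inhabits one) (corr_spec a b).

Lemma corr_eq a b l : supported a b l -> corr a b = rho (rots l).
Proof.
  intros Hl. assert (K : corr_spec a b (corr a b)) by (unfold corr; apply epsilon_spec; exists (rho (rots l)), l; auto).
  destruct K as [l' [Hl' ->]]. apply (rots_eq n Hq Hr). intros z. now rewrite Hl, Hl'.
Qed.

Lemma corr_left x a b : corr (x ∙ a) (x ∙ b) = rho x ∙ corr a b ∙ (rho x)⁻¹.
Proof.
  destruct (supported_ex a b) as [l Hl]. rewrite (corr_eq _ _ _ Hl), (corr_eq _ _ _ (supported_translate x _ _ _ Hl)).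
  now rewrite rots_translate, !(rho_hom n Hr), (hom_inv (rho_hom n Hr)).
Qed.

Lemma corr_loop l0 a b l : supported a b l -> (forall z, mult l0 z + rnd (ang z a b) = 0) -> rho (rots l0) ∙ corr a b = one.
Proof.
  intros Hl H. rewrite (corr_eq _ _ _ Hl), <- (rho_hom n Hr), <- rots_app, <- (hom_one (rho_hom n Hr)).
  apply (rots_eq n Hq Hr (l0 ++ l) nil). intros z. rewrite mult_app, Hl. apply H.
Qed.

Lemma corr_opp a b : corr b a = (corr a b)⁻¹.
Proof.
  destruct (supported_ex a b) as [l Hl], (supported_ex b a) as [l' Hl'].
  rewrite (corr_eq _ _ _ Hl'). symmetry. apply inv_unique. rewrite (corr_eq _ _ _ Hl), <- (corr_eq _ _ _ Hl').
  apply (corr_loop l b a l' Hl'). intros z. rewrite Hl, ang_opp, rnd_opp. lia.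
Qed.

(* The lift of the image of b that undoes, on average, the turns made by b. *)
Definition sigma (b : G) : P := (corr one b)⁻¹ ∙ rho b.

Lemma corr_N a b : exists h, N h /\ corr a b = rho h.
Proof.
  destruct (supported_ex a b) as [l Hl]. exists (rots l). split; [apply rots_N|]. now apply corr_eq.
Qed.

Lemma sigma_inv b : sigma b⁻¹ = (sigma b)⁻¹.
Proof.
  unfold sigma. pose proof (corr_left b⁻¹ b one) as E. rewrite mul_Vl, mul_1r, (corr_opp one b) in E. rewrite E.
  rewrite (hom_inv (rho_hom n Hr)). grp.
Qed.

(** Around a closed triangle the factors rho b1, rho b2, rho b3 cancel and only corrections remain,
    translated to the sides. *)
Lemma sigma_mul3 b1 b2 b3 : b1 ∙ b2 ∙ b3 = one ->
  sigma b1 ∙ sigma b2 ∙ sigma b3 = corr b1 one ∙ corr (b1 ∙ b2) b1 ∙ corr one (b1 ∙ b2).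
Proof.
  intros E. pose proof (rho_hom n Hr) as Hh.
  pose proof (corr_left b1 b2 one) as E1. rewrite mul_1r in E1.
  pose proof (corr_left (b1 ∙ b2) b3 one) as E2. rewrite mul_1r, E in E2.
  rewrite E1, E2, !(corr_opp one). unfold sigma.
  assert (E3 : rho b3 = (rho (b1 ∙ b2))⁻¹) by (symmetry; apply inv_unique; rewrite <- Hh, E; apply (hom_one Hh)).
  rewrite E3, Hh. rewrite ?inv_inv. grp.
Qed.

(* A coset where two sides of a triangle turn by similar amounts at the same vertex p, while the third
   side does not fix its coordinate, is the one closest to p among these. *)
Lemma turn_at_vertex p q s : exists E, (length E <= 1)%nat /\ forall z,
  nz <= 4 * Z.abs (ang z p q) -> nz <= 4 * Z.abs (ang z p s) -> ang z q s <> 0 -> exists y, In y E /\ same y z.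
Proof.
  destruct (kap_small CG n Hn) as [K1 [K2 K3]].
  set (bad := fun z => nz <= 4 * Z.abs (ang z p q) /\ nz <= 4 * Z.abs (ang z p s) /\ ang z q s <> 0).
  assert (U : forall y z, bad y -> bad z -> gapy y p <= gapy z p -> same y z).
  { intros y z [Y1 [Y2 Y3]] [Z1 [Z2 Z3]] Hg. apply NNPP. intros Hs. apply Y3.
    assert (Hs' : ~ same z y) by (intros X; apply Hs; now apply same_sym).
    assert (A : Z.abs (ang z p y) <= theta).
    { apply Z.le_ngt. intros X. pose proof (angle_order CG z y p Hs' X). lia. }
    pose proof (ang_add (c := c) z p y q). pose proof (ang_add (c := c) z p y s).
    unfold angle. rewrite (coordinate_exact CG z y q s Hs'); lia. }
  destruct (classic (exists y, bad y)) as [[y Hy]|Hno].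
  - exists [y]. split; [auto|]. intros z H1 H2 H3. exists y. split; [now left|].
    destruct (Z.le_ge_cases (gapy y p) (gapy z p)); [|apply same_sym]; apply U; try easy; split; auto.
  - exists nil. split; [auto|]. intros z H1 H2 H3. destruct Hno. exists z. now split.
Qed.

(** By [rnd_triangle] a coset with nonzero total has two large angles at a common vertex, and
    [turn_at_vertex] allows one such coset per vertex. *)
Lemma triangle_support p q s : exists E, (length E <= 3)%nat /\ forall z,
  (forall y, In y E -> ~ same y z) -> rnd (ang z p q) + rnd (ang z q s) + rnd (ang z s p) = 0.
Proof.
  destruct (turn_at_vertex p q s) as [E1 [L1 H1]], (turn_at_vertex q p s) as [E2 [L2 H2]],
    (turn_at_vertex s p q) as [E3 [L3 H3]].
  exists (E1 ++ E2 ++ E3). split; [rewrite !length_app; lia|]. intros z Hz.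
  destruct (Z.eq_dec (rnd (ang z p q) + rnd (ang z q s) + rnd (ang z s p)) 0) as [F|F]; auto. exfalso.
  pose proof (ang_add (c := c) z p q s). pose proof (ang_opp (c := c) z p s). pose proof (ang_opp (c := c) z p q).
  pose proof (ang_opp (c := c) z q s).
  assert (K : exists y, In y (E1 ++ E2 ++ E3) /\ same y z); [|destruct K as [y [Hy Hs]]; eapply Hz; eauto].
  apply rnd_triangle in F as [F|[F|F]]; [| | |lia].
  - destruct (H1 z) as [y [Hy Hs]]; [lia|lia|lia|]. exists y. split; auto. apply in_or_app. auto.
  - destruct (H2 z) as [y [Hy Hs]]; [lia|lia|lia|]. exists y. split; auto. apply in_or_app. right. apply in_or_app. auto.
  - destruct (H3 z) as [y [Hy Hs]]; [lia|lia|lia|]. exists y. split; auto. apply in_or_app. right. apply in_or_app. auto.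
Qed.

Lemma sigma_triangle b1 b2 b3 : b1 ∙ b2 ∙ b3 = one -> exists L : list (cosets (g := g) (pi := pi)), (length L <= 3)%nat /\
  gen (fun p => exists i, In i L /\ base_group n (rho := rho) i p) (sigma b1 ∙ sigma b2 ∙ sigma b3).
Proof.
  intros E. destruct (triangle_support b1 one (b1 ∙ b2)) as [L [HL H]].
  exists (map (fun y => cls (pi y)) L). split; [now rewrite length_map|].
  destruct (supported_ex b1 one) as [l1 H1], (supported_ex (b1 ∙ b2) b1) as [l2 H2], (supported_ex one (b1 ∙ b2)) as [l3 H3].
  rewrite (sigma_mul3 _ _ _ E), (corr_eq _ _ _ H1), (corr_eq _ _ _ H2), (corr_eq _ _ _ H3).
  rewrite <- !(rho_hom n Hr), <- !rots_app. apply (rots_support n Hq Hr).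
  intros z Hz. rewrite !mult_app, H1, H2, H3. specialize (H z Hz). lia.
Qed.

(** * Invariance of the corrected lift under a turn *)

Section Bend.
Context (b y : G) (eps : Z) (He : eps = 1 \/ eps = -1) (Hb : forall z, 4 * Z.abs (ang z one b) <= 3 * nz)
  (Ha : nz <= 4 * (eps * ang y one b)).
Notation r := (rot y (- eps * nz)).

(** The coset z<g> lies on the side of 1 as seen from y; quantifying over its points makes this a
    property of the coset. *)
Let before (z : G) : Prop := exists k, Z.abs (ang y one (z ∙ zpow g k)) <= theta.

Lemma before_same z z' : same z z' -> before z -> before z'.
Proof. intros [i ->] [k Hk]. exists (- i + k). now rewrite mulA_r, <- zpow_add, Z.add_assoc, Z.add_opp_diag_r. Qed.

Lemma before_angle z : ~ same y z -> before z -> Z.abs (ang y one z) <= theta + D.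
Proof. intros Hs [k Hk]. pose proof (ang_same_pt CG y z _ one Hs (same_zpow z k)). lia. Qed.

Lemma not_before_angle z : ~ before z -> theta < Z.abs (ang y one z).
Proof. intros H. apply Z.lt_nge. intros K. apply H. exists 0. now rewrite zpow_0, mul_1r. Qed.

Lemma ang_bend z : ang y one (r ∙ z) = ang y one z - eps * nz.
Proof. rewrite (ang_rot CG). lia. Qed.

Lemma ang_bend_inv z : ang y one (r⁻¹ ∙ z) = ang y one z + eps * nz.
Proof. pose proof (ang_bend (r⁻¹ ∙ z)) as K. rewrite mul_Vr_r in K. lia. Qed.

Lemma same_bend z : same y (r⁻¹ ∙ z) <-> same y z.
Proof.
  split; intros H.
  - apply (same_left r) in H. rewrite mul_Vr_r in H. eapply same_trans; [apply rot_fix|exact H].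
  - apply (same_left r). rewrite mul_Vr_r. eapply same_trans; [apply same_sym, rot_fix|exact H].
Qed.

(* Cosets seen from y on the side of 1 keep their angle, those on the side of b are moved along. *)
Lemma bend_cases z :
  (same y z /\ ang z one (r ∙ b) = ang y one b - eps * nz) \/
  (~ same y z /\ before z /\ ~ before (r⁻¹ ∙ z) /\ ang z one (r ∙ b) = ang z one b /\ ang (r⁻¹ ∙ z) one b = 0) \/
  (~ same y z /\ ~ before z /\ ~ before (r⁻¹ ∙ z) /\ ang z one (r ∙ b) = ang (r⁻¹ ∙ z) one b) \/
  (~ same y z /\ ~ before z /\ before (r⁻¹ ∙ z) /\ ang z one (r ∙ b) = 0).
Proof.
  destruct (kap_small CG n Hn) as [K1 [K2 K3]].
  pose proof (Hb y) as Hy.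
  destruct (classic (same y z)) as [Hs|Hs].
  { left. split; auto. rewrite (ang_same CG _ _ _ _ Hs). apply ang_bend. }
  right. set (w := r⁻¹ ∙ z).
  assert (Hsw : ~ same y w) by (unfold w; now rewrite same_bend).
  pose proof (ang_bend_inv z) as Aw. fold w in Aw. pose proof (ang_bend b) as Ab.
  assert (Ez : ang z one (r ∙ b) = ang w r⁻¹ b).
  { unfold w. rewrite <- (ang_left r (r⁻¹ ∙ z)), mul_Vr_r, mul_Vr. reflexivity. }
  assert (Er : ang y r⁻¹ w = ang y one z).
  { unfold w. rewrite <- (mul_1r _ r⁻¹) at 1. rewrite rot_opp. unfold angle.
    rewrite <- (mul_1r _ (rot y (- (- eps * nz)))).
    pose proof (ang_rot CG y (- (- eps * nz)) one z) as X1. pose proof (ang_rot CG y (- (- eps * nz)) one one) as X2.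
    unfold angle in X1, X2. rewrite ?mul_1r in *. lia. }
  pose proof (ang_add (c := c) y one z b) as C1. pose proof (ang_add (c := c) y one z (r ∙ b)) as C2.
  pose proof (ang_add (c := c) y one w b) as C3.
  pose proof (ang_opp (c := c) y one w) as O1. pose proof (ang_opp (c := c) y one z) as O2.
  pose proof (ang_opp (c := c) y r⁻¹ w) as O3.
  (* The coordinates of z and w at y differ by n, so z and w are not both on the side of 1; in the
     other cases [coordinate_exact] replaces points separated from z or w by y. *)
  destruct (classic (before z)) as [Bz|Bz]; destruct (classic (before w)) as [Bw|Bw].
  - exfalso. apply (before_angle z Hs) in Bz. apply (before_angle w Hsw) in Bw. destruct He as [-> | ->]; lia.
  - left. apply (before_angle z Hs) in Bz as Cz. split; auto. split; auto. split; auto. split.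
    + unfold angle. rewrite (coordinate_exact CG y z b (r ∙ b) Hs); destruct He as [-> | ->]; lia.
    + unfold angle. rewrite (coordinate_exact CG y w b one Hsw); destruct He as [-> | ->]; lia.
  - right. right. apply not_before_angle in Bz as Cz. apply (before_angle w Hsw) in Bw as Cw.
    split; auto. split; auto. split; auto.
    unfold angle. rewrite (coordinate_exact CG y z (r ∙ b) one Hs); destruct He as [-> | ->]; lia.
  - right. left. apply not_before_angle in Bz as Cz. apply not_before_angle in Bw as Cw.
    split; auto. split; auto. split; auto. rewrite Ez. unfold angle. f_equal.
    rewrite (coordinate_exact CG y w r⁻¹ one Hsw); lia.
Qed.

Lemma bend_tame z : 4 * Z.abs (ang z one (r ∙ b)) <= 3 * nz.
Proof.
  pose proof (Hb y). pose proof (Hb z). pose proof (Hb (r⁻¹ ∙ z)).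
  destruct (bend_cases z) as [[_ E]|[[_ [_ [_ [E _]]]]|[[_ [_ [_ E]]]|[_ [_ [_ E]]]]]]; rewrite E; try lia.
Qed.

Let move (z : G) : G := if excluded_middle_informative (same y z \/ before z) then z else r ∙ z.

Lemma mult_move l z : mult (map (fun p => (move (fst p), snd p)) l) z =
  if excluded_middle_informative (same y z) then mult l z else
  (if excluded_middle_informative (before z) then mult l z else 0) +
  (if excluded_middle_informative (before (r⁻¹ ∙ z)) then 0 else mult l (r⁻¹ ∙ z)).
Proof.
  induction l as [|[x k] l IH]; cbn [map multiplicity fst snd].
  { repeat destruct (excluded_middle_informative _); lia. }
  rewrite IH. clear IH. unfold move.
  assert (F : forall u v, same u v -> before u -> before v) by (intros u v; apply before_same).
  assert (F' : same (r ∙ x) z <-> same x (r⁻¹ ∙ z)) by (rewrite <- (same_left r x (r⁻¹ ∙ z)), mul_Vr_r; tauto).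
  assert (Ty : same x (r⁻¹ ∙ z) -> same y z -> same y x).
  { intros A B. apply same_bend in B. eapply same_trans; [exact B|now apply same_sym]. }
  assert (Ty' : same x (r⁻¹ ∙ z) -> same y x -> same y z).
  { intros A B. apply same_bend. eapply same_trans; eauto. }
  assert (Tz : same x z -> same y z -> same y x) by (intros A B; eapply same_trans; [exact B|now apply same_sym]).
  assert (Tz' : same x z -> same y x -> same y z) by (intros A B; eapply same_trans; eauto).
  pose proof (F x z) as F1. pose proof (F z x) as F2. pose proof (F x (r⁻¹ ∙ z)) as F3. pose proof (F (r⁻¹ ∙ z) x) as F4.
  pose proof (same_sym (g := g) x z) as Sxz. pose proof (same_sym (g := g) x (r⁻¹ ∙ z)) as Sxw.
  assert (Byy : same y z -> same x (r⁻¹ ∙ z) -> same x z).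
  { intros A B. eapply same_trans; [|exact A]. apply same_sym. auto. }
  destruct (excluded_middle_informative (same y x \/ before x)) as [A1|A1];
  destruct (excluded_middle_informative (same y z)) as [A2|A2];
  destruct (excluded_middle_informative (before z)) as [A3|A3];
  destruct (excluded_middle_informative (before (r⁻¹ ∙ z))) as [A4|A4];
  destruct (excluded_middle_informative (same x z)) as [A5|A5];
  destruct (excluded_middle_informative (same x (r⁻¹ ∙ z))) as [A6|A6];
  try destruct (excluded_middle_informative (same (r ∙ x) z)) as [A7|A7];
  try lia; exfalso; tauto.
Qed.

Lemma supported_bend l : supported one b l ->
  supported one (r ∙ b) ((y, - eps) :: map (fun p => (move (fst p), snd p)) l).
Proof.
  intros Hl z. cbn [multiplicity]. rewrite mult_move, !Hl.
  destruct (bend_cases z) as [[A E]|[[A [B [C [E F]]]]|[[A [B [C E]]]|[A [B [C E]]]]]]; rewrite E;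
    repeat match goal with |- context [excluded_middle_informative ?X] =>
      destruct (excluded_middle_informative X); try tauto end; rewrite ?F, ?rnd_0; try lia.
  rewrite (ang_same CG _ _ _ _ A). rewrite (rnd_shift (ang y one b) eps); auto. lia.
Qed.

Lemma rots_move l : rho (rots (map (fun p => (move (fst p), snd p)) l)) = rho (rots l).
Proof.
  induction l as [|[x k] l IH]; [reflexivity|]. cbn [map rotations fst snd].
  rewrite !(rho_hom n Hr), IH. f_equal. unfold move. destruct (excluded_middle_informative _); auto.
  apply (turn_translate n Hr). apply rot_in_N.
Qed.

(** The correction of r b is rho r times that of b, because moving cosets within their N-orbits
    changes nothing modulo [N,N]; the factor cancels against the one in rho (r b). *)
Lemma sigma_bend : sigma (r ∙ b) = sigma b.
Proof.
  destruct (supported_ex one b) as [l Hl]. unfold sigma.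
  rewrite (corr_eq _ _ _ Hl), (corr_eq _ _ _ (supported_bend l Hl)). cbn [rotations].
  rewrite !(rho_hom n Hr), rots_move, inv_mul.
  transitivity ((rho (rots l))⁻¹ ∙ ((rho r)⁻¹ ∙ rho r) ∙ rho b); [grp|]. rewrite mul_Vl. grp.
Qed.
End Bend.

Lemma bends_sigma s s' : clos_refl_trans G (bend (g := g) (del := del) (D := D) (c := c) n 3) s s' ->
  (forall z, 4 * Z.abs (ang z one s) <= 3 * nz) -> sigma s' = sigma s.
Proof.
  intros H Hs. destruct (kap_small CG n Hn) as [K1 [K2 K3]].
  enough (K : sigma s' = sigma s /\ forall z, 4 * Z.abs (ang z one s') <= 3 * nz) by apply K.
  apply (bends_ind_inv (g := g) (del := del) (D := D) (c := c) n 3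
    (fun x => sigma x = sigma s /\ forall z, 4 * Z.abs (ang z one x) <= 3 * nz)) with s; auto.
  intros a b [y [eps [He [HA ->]]]] [E T].
  (* A third of n - kap is at least n/4, the threshold of [rnd_shift]. *)
  assert (HA' : nz <= 4 * (eps * ang y one a)) by (destruct He as [-> | ->]; lia).
  split.
  - rewrite <- E. now apply sigma_bend.
  - now apply bend_tame.
Qed.

Lemma section_cocycle : exists sec : Q -> P, (forall b, exists x, sec b = rho x /\ pi x = b) /\
  forall a b, exists L : list (cosets (g := g) (pi := pi)), (length L <= 3)%nat /\
    gen (fun p => exists i, In i L /\ base_group n (rho := rho) i p) (sec a ∙ sec b ∙ (sec (a ∙ b))⁻¹).
Proof.
  destruct (kap_small CG n Hn) as [K1 [K2 K3]].
  destruct (choice (fun q b => pi b = q /\ forall z, 4 * Z.abs (ang z one b) <= 3 * nz)) as [lift Hlift].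
  { intros q. destruct (tame_lift CG n Hn Hq q) as [b [Eb Hb]]. exists b. split; auto.
    intros z. specialize (Hb z). lia. }
  exists (fun q => sigma (lift q)). split.
  - intros b. destruct (corr_N one (lift b)) as [h [Hh E]]. exists (h⁻¹ ∙ lift b).
    unfold sigma. rewrite E, (rho_hom n Hr), (hom_inv (rho_hom n Hr)). split; auto.
    rewrite (pi_hom n Hq), (hom_inv (pi_hom n Hq)). destruct Hq as [_ [_ H3]].
    rewrite (proj2 (H3 h) Hh), inv_one, mul_1l. apply Hlift.
  - intros a b. destruct (Hlift a) as [Pa Ta], (Hlift b) as [Pb Tb], (Hlift (a ∙ b)) as [Pc Tc].
    destruct (polygon_lift CG n Hn Hq 3 [lift a; lift b; (lift (a ∙ b))⁻¹]) as [l [F E]]; [lia|cbn; lia| |].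
    { rewrite (hom_prod (pi_hom n Hq)). cbn. rewrite (hom_inv (pi_hom n Hq)), Pa, Pb, Pc. grp. }
    inversion F as [|? b1 ? l1 B1 F1]; subst. inversion F1 as [|? b2 ? l2 B2 F2]; subst.
    inversion F2 as [|? b3 ? l3 B3 F3]; subst. inversion F3; subst. cbn in E. rewrite mul_1r, mul_assoc in E.
    destruct (sigma_triangle b1 b2 b3 E) as [L [HL H]]. exists L. split; auto.
    rewrite <- sigma_inv, <- (bends_sigma _ _ B1 Ta), <- (bends_sigma _ _ B2 Tb), <- (bends_sigma _ _ B3); auto.
    intros z. rewrite <- (ang_left (lift (a ∙ b))), mul_1r, mul_Vr, ang_opp, Z.abs_opp. apply Tc.
Qed.

Notation base := (base_group (g := g) (pi := pi) (rho := rho) n).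

Lemma quotient_wreath : exists (I : Type) (act : Q -> I -> I), is_action act /\ transitive act /\
  (forall i, iso_Zmod (fun q => act q i = i) n) /\ WRb Zgrp Q I act P.
Proof.
  exists (cosets (g := g) (pi := pi)), coset_act. split; [apply coset_action|]. split; [apply coset_transitive|].
  split; [apply (coset_stabilizers CG n Hn Hq)|].
  pose proof (rho_hom n Hr) as Rh. pose proof (pi_hom n Hq) as Ph.
  assert (Hsurj : forall p, exists x, rho x = p) by apply Hr.
  (* The projection to Q is pi after a set-theoretic section of rho, well defined because [N,N] lies
     in N. *)
  destruct (choice (fun p x => rho x = p) Hsurj) as [pre Hpre].
  assert (Heps : forall x, pi (pre (rho x)) = pi x).
  { intros x. apply (pi_eq n Hq). destruct Hr as [_ [_ H3]].
    assert (K : comm_sub N ((pre (rho x))⁻¹ ∙ x)) by (apply H3; rewrite Rh, (hom_inv Rh), Hpre; apply mul_Vl).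
    destruct (nclosure_normal (fun x : G => x = npow g n)) as [HS _]. pose proof HS as [S1 [S2 S3]].
    apply K; auto. intros s [u [v [Hu [Hv ->]]]]. unfold commutator. auto. }
  assert (Hbase : forall i p, base i p -> exists h, N h /\ rho h = p).
  { intros i p [y [k [_ ->]]]. exists (rot y (k * nz)). split; [apply rot_in_N|auto]. }
  assert (Hconj : forall x i p, base i p ->
    base (coset_act (pi x) i) (rho x ∙ p ∙ (rho x)⁻¹)).
  { intros x i p [y [k [<- ->]]]. exists (x ∙ y), k. split; [now rewrite coset_act_cls, Ph|].
    symmetry. apply (turn_conj n Hr). }
  exists (fun p => pi (pre p)), (base). refine (conj _ (conj _ (conj _ (conj _ (conj _ (conj _ (conj _ (conj _ _)))))))).
  - intros p q. destruct (Hsurj p) as [x <-], (Hsurj q) as [y <-]. now rewrite <- Rh, !Heps, Ph.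
  - intros b. destruct Hq as [_ [Hs _]]. destruct (Hs b) as [x <-]. exists (rho x). apply Heps.
  - apply (base_group_iso CG n Hn Hq Hr).
  - intros i p Hp. destruct (Hbase i p Hp) as [h [Hh <-]]. rewrite Heps. destruct Hq as [_ [_ H3]]. now apply H3.
  - intros i j p q _ Hp Hq'. destruct (Hbase i p Hp) as [h [Hh <-]], (Hbase j q Hq') as [h' [Hh' <-]].
    now apply (rho_commute n Hr).
  - intros p E. destruct (Hsurj p) as [x <-]. rewrite Heps in E. apply (rho_N_gen CG n Hr).
    destruct Hq as [_ [_ H3]]. now apply H3.
  - intros i p. apply (base_group_indep CG n Hn Hq Hr).
  - intros x i p. destruct (Hsurj x) as [y <-]. rewrite Heps. split; intros Hp; [now apply Hconj|].
    apply (Hconj y⁻¹) in Hp.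
    destruct (coset_action (g := g) (pi := pi)) as [A1 A2]. rewrite <- A2, <- Ph, mul_Vl, (hom_one Ph), A1 in Hp.
    rewrite (hom_inv Rh) in Hp. revert Hp. now grp.
  - destruct section_cocycle as [sec [H1 H2]]. exists sec, 3%nat. split; auto.
    intros b. destruct (H1 b) as [x [-> <-]]. apply Heps.
Qed.

End Cocycle.

Lemma prime_odd p : prime p -> (2 < p)%Z -> Z.odd p = true.
Proof.
  intros Hp H2. rewrite <- Z.negb_even. destruct (Z.even p) eqn:E; auto. exfalso.
  apply Z.even_spec in E as [k Ek].
  destruct (prime_divisors p Hp 2) as [K|[K|[K|K]]]; [now exists k; lia|lia|lia|lia|lia].
Qed.

Theorem theorem2p2 (G : Group) (hypG : hyperbolic (G := G))
  (tfG : torsion_free (G := G)) (ncG : ~ cyclic (G := G))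
  (g : G) (gnt : g <> one) (gnpp : ~ proper_power g) :
  exists N0 : nat, forall n : nat, prime (Z.of_nat n) -> (N0 < n)%nat ->
    let N := nclosure (fun x => x = npow g n) in
    forall (Q : Group) (pi : G -> Q), is_quotient N pi ->
      (* (a) *)
      (forall (P : Group) (rho : G -> P), is_quotient (comm_sub N) rho ->
         exists (I : Type) (act : Q -> I -> I),
           is_action act /\ transitive act /\
           (forall i, iso_Zmod (fun q => act q i = i) n) /\
           WRb Zgrp Q I act P) /\
      (* (b) *)
      ~ virtually_cyclic (G := Q) /\ icc (G := Q) /\ hyperbolic (G := Q) /\
      (* (c) *)
      elt_order (pi g) n /\
      (forall q : Q, q <> one -> elt_order q n \/ infinite_order q).
Proof.
  destruct (cone_geom_ex hypG tfG g gnt gnpp) as [S [del [D [e [c CG]]]]].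
  assert (Hy : exists y, ~ same (g := g) one y).
  { apply not_all_not_ex. intros H. apply ncG. exists g. intros x. destruct (NNPP _ (H x)) as [k ->].
    exists k. apply mul_1l. }
  destruct Hy as [y Hy]. destruct (axis_ex CG y Hy) as [t [Ht Ht4]].
  assert (Ht4' : (4 * (2 * D) < Z.abs (c t - c t⁻¹))%Z) by lia.
  destruct (powers_angle_bounded CG t Ht Ht4') as [B HB].
  (* The summands serve the rotation arguments, the angles of powers of t in [quotient_icc], and the
     oddness of n. *)
  exists (Z.to_nat (1000 * (orbit_bound del D + D + 1)) +
          Z.to_nat (10 * (B + 2 * (D + 2 * (20 * D + 20)))) + 2)%nat.
  intros n Hp Hn0 N Q pi Hq.
  assert (Hn : (1000 * (orbit_bound del D + D + 1) <= Z.of_nat n)%Z) by lia.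
  assert (Hicc : icc (G := Q)) by (eapply (quotient_icc CG n Hn Hq t Ht Ht4' B HB); lia).
  pose proof (order_pi_g CG n Hn Hq) as Hord.
  split; [|split; [|split; [|split; [|split]]]]; auto.
  - intros P rho Hr. apply (quotient_wreath CG n Hn (prime_odd _ Hp ltac:(lia)) Hq Hr).
  - apply (icc_not_virtually_cyclic Hicc (pi g)). intros E. destruct Hord as [_ [_ H]].
    apply (H 1%nat); [lia|]. cbn. now rewrite mul_1r.
  - apply (quotient_hyperbolic CG n Hn Hq).
  - intros q. now apply (torsion_order CG n Hn Hq tfG Hp).
Qed.
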